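(* Let $p_i(x,y)=r_i(x)+s_i(x)y$, $i=1,2$, be two finite linear-like submersions. Then $p_1$ is o-topologically equivalent to $p_2$ if and only if either $Z_{p_1}=Z_{p_2}=\emptyset$, or both of the following conditions hold: (a) $\mathscr{F}(p_1)$ and $\mathscr{F}(p_2)$ are o-topologically equivalent. (b) There exist an o-equivalence homeomorphism $h$ between $\mathscr{F}(p_1)$ and $\mathscr{F}(p_2)$ and an increasing bijection $\sigma:r_1(Z_{p_1})\to r_2(Z_{p_2})$ such that $$\sigma(p_1(\nu_a))=p_2(h(\nu_a))\quad\text{for each } a\in Z_{p_1}.$$ If $r_1(Z_{p_1})$ is a singleton, there further exist (for this same $h$ and $\sigma$) a number $m\in\mathbb{R}\setminus r_1(Z_{p_1})$, an extension of $\sigma$ to an increasing bijection $\overline{\sigma}:r_1(Z_{p_1})\cup\{m\}\to r_2(Z_{p_2})\cup\{\overline{\sigma}(m)\}$ and a connected component $\xi$ of $p_1^{-1}(m)$ such that $\overline{\sigma}(m)=p_2(h(\xi))$.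
   Context: A linear-like function is a function $p:\mathbb{R}^2\to\mathbb{R}$ of the form $p(x,y)=r(x)+s(x)y$, where $r,s:\mathbb{R}\to\mathbb{R}$ are $C^\infty$; put $Z_p=\{x\in\mathbb{R}: s(x)=0\}$. It is a submersion if its gradient vanishes nowhere. A finite linear-like submersion is a linear-like submersion for which $Z_p$ is finite (possibly empty). For $a\in\mathbb{R}$, $\nu_a=\{a\}\times\mathbb{R}$; when $a\in Z_p$ this line is a connected component of the level set $p^{-1}(r(a))$. For a $C^\infty$ submersion $f:\mathbb{R}^2\to\mathbb{R}$, $\mathscr{F}(f)$ denotes the regular foliation of $\mathbb{R}^2$ whose leaves are the connected components of the level sets of $f$. For a leaf $\gamma$ of $\mathscr{F}(f)$, $f(\gamma)$ denotes the constant value of $f$ on $\gamma$. Two functions $f,g:\mathbb{R}^2\to\mathbb{R}$ are o-topologically equivalent if there exist orientation preserving homeomorphisms $h:\mathbb{R}^2\to\mathbb{R}^2$ and $\ell:\mathbb{R}\to\mathbb{R}$ (so $\ell$ is increasing) such that $\ell\circ f=g\circ h$. Two regular foliations $\mathscr{F},\mathscr{G}$ of $\mathbb{R}^2$ are o-topologically equivalent if there is an orientation preserving homeomorphism $h:\mathbb{R}^2\to\mathbb{R}^2$ carrying each leaf of $\mathscr{F}$ onto a leaf of $\mathscr{G}$; such $h$ is called an o-equivalence homeomorphism between $\mathscr{F}$ and $\mathscr{G}$. *)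

(* Defs.v *)
From HB Require Import structures.
From mathcomp Require Import all_boot all_order all_algebra.
From mathcomp Require Import all_classical all_reals all_analysis.

Set Implicit Arguments.
Unset Strict Implicit.
Unset Printing Implicit Defensive.

Import Order.TTheory GRing.Theory Num.Theory.
Import numFieldNormedType.Exports.

Local Open Scope classical_set_scope.
Local Open Scope ring_scope.

Definition smooth (R : realType) (f : R -> R) : Prop :=
  forall (n : nat) (x : R), derivable (f^`(n))%classic x 1.

Definition linear_like (R : realType) (r s : R -> R) : R * R -> R :=
  fun z => r z.1 + s z.1 * z.2.

Definition zeros (R : realType) (s : R -> R) : set R := [set x | s x = 0].

Definition gradient (R : realType) (f : R * R -> R) (z : R * R) : R * R :=
  ('D_((1, 0) : R * R) f z, 'D_((0, 1) : R * R) f z).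

Definition submersion (R : realType) (f : R * R -> R) : Prop :=
  forall z : R * R, gradient f z <> (0, 0).

Definition finite_linear_like_submersion (R : realType) (r s : R -> R) : Prop :=
  [/\ smooth r, smooth s, submersion (linear_like r s) & finite_set (zeros s)].

Definition homeomorphism (T U : topologicalType) (h : T -> U) : Prop :=
  continuous h /\
  exists g : U -> T, [/\ continuous g, cancel h g & cancel g h].

(* The loop c : [0, 1] -> R^2 avoids w and has winding number k around w:
   theta is a continuous determination of the argument of c - w. *)
Definition winding (R : realType) (c : R -> R * R) (w : R * R) (k : int) : Prop :=
  exists theta : R -> R,
    [/\ {within `[0, 1], continuous theta},
        (forall t, t \in `[0, 1] -> exists2 rho : R, 0 < rho &
           c t = w + (rho * cos (theta t), rho * sin (theta t))) &
        theta 1 - theta 0 = k%:~R * (2 * pi)].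

Definition circle (R : realType) (z : R * R) (rho : R) : R -> R * R :=
  fun t => z + (rho * cos (2 * pi * t), rho * sin (2 * pi * t)).

(* Local degree +1 at every point: positively oriented circles around z are
   mapped to loops that wind exactly once, positively, around h z. *)
Definition o_homeo2 (R : realType) (h : R * R -> R * R) : Prop :=
  homeomorphism h /\
  forall (z : R * R) (rho : R), 0 < rho -> winding (h \o circle z rho) (h z) 1.

Definition o_homeo1 (R : realType) (l : R -> R) : Prop :=
  homeomorphism l /\ {homo l : x y / x < y}.

Definition o_equiv_fun (R : realType) (f g : R * R -> R) : Prop :=
  exists h l, [/\ o_homeo2 h, o_homeo1 l & l \o f = g \o h].

Definition is_component (T : topologicalType) (A C : set T) : Prop :=
  exists2 x, A x & C = connected_component A x.

(* A foliation of the plane is represented by the set of its leaves. *)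
Definition foliation (R : realType) (f : R * R -> R) : set (set (R * R)) :=
  [set C | exists c : R, is_component (f @^-1` [set c]) C].

Definition o_equiv_homeo (R : realType) (F G : set (set (R * R)))
    (h : R * R -> R * R) : Prop :=
  o_homeo2 h /\ forall C, F C -> G (h @` C).

Definition o_equiv_fol (R : realType) (F G : set (set (R * R))) : Prop :=
  exists h, o_equiv_homeo F G h.

Definition nu (R : realType) (a : R) : set (R * R) := [set z | z.1 = a].

(* A map A -> B between subsets of R is represented by a total function, of
   which only the values on A are constrained. *)
Definition incr_bij (R : realType) (A B : set R) (f : R -> R) : Prop :=
  set_bij A B f /\ {in A &, {homo f : x y / x < y}}.

(* Main.v *)
(** Cut the plane along the lines nu_a, a in Z_p, into strips. In a strip the
    leaves are graphs over the whole base interval, one for each value of p, and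
    nu_a is not separated, in the leaf space, from the two leaves of value r(a) in
    the adjacent strips; conversely, one of two inseparable leaves is always a line
    nu_a. By finiteness a homeomorphism respecting the leaves then carries the lines
    nu_a to lines nu_b, which gives the direct implication.

    Conversely, let h carry leaves to leaves. It maps the lines nu_a to lines nu_b
    by the same argument, and it preserves or reverses their order; in the latter
    case compose with the rotation by pi. The hypothesis on sigma and on m forces
    p_2 o h to increase with p_1 in one strip, hence in all of them, because the
    direction of monotonicity is transmitted across each nu_a. It follows that
    r_1' and r_2' have the same sign at corresponding zeros, and, h preserving the
    orientation, that s_1 and s_2 have the same sign on corresponding strips.

    From these data alone a homeomorphism with l o p_1 = p_2 o h is built: after
    making r_1 and r_2 affine near the zeros and choosing l and the map phi of the
    base to be translations near the relevant points, a level-preserving map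
    supported in a cone around each nu_a changes s_1 into s_2 o phi near a, and then
    (x, y) is sent to (phi x, (l (p_1 (x, y)) - r_2 (phi x)) / s_2 (phi x)). *)

Require Import Defs.
From HB Require Import structures.
From mathcomp Require Import all_boot all_order all_algebra.
From mathcomp Require Import all_classical all_reals all_analysis.
From mathcomp Require Import ring lra.

Set Implicit Arguments.
Unset Strict Implicit.
Unset Printing Implicit Defensive.

Import Order.TTheory GRing.Theory Num.Theory.
Import numFieldNormedType.Exports.

Local Open Scope classical_set_scope.
Local Open Scope ring_scope.

(** * Increasing bijections of the line *)

(** The final formula extends to a homeomorphism across nu_a only if s_1 / (s_2 o phi) has a finite
    nonzero limit at a. In general it has none: submersivity only makes s_1 and s_2 vanish with zero
    derivative, possibly to different or infinite order. The cone maps remove this obstacle. If r(x)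
    = r(a) + eta (x - a) with eta = 1 or -1, a point at level r(a) + eta u has abscissa x with x - a
    - u = - eta s(x) y. Stretching this gap by t(a + u) / s(a + u) while keeping the level replaces
    s by t, and the height changes by an amount that tends to 0 at nu_a.

    If all the lines nu_a have the same level, sigma carries no information on the direction in
    which levels are carried; the additional level m supplies the second point of comparison.

    Orientation enters at two places. For a given h, winding numbers exclude opposite signs of s_1
    and s_2 on corresponding strips. For a constructed h, the local degree need only be computed at
    one place, and far to the right the maps are simple enough for that. *)

Section IncreasingBijections.
Context {R : realType}.
Implicit Types (f g : R -> R) (x y t : R).

(** The inverse is carried along, so that its continuity follows from [incb_continuous] by
    symmetry. *)
Definition incb f g := [/\ {homo f : x y / x < y}, cancel f g & cancel g f].

Lemma incb_mono f g : incb f g -> {mono f : x y / x < y}.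
Proof. by case=> h _ _; apply: (leW_mono (le_mono h)). Qed.

Lemma incb_sym f g : incb f g -> incb g f.
Proof. by move=> fg; case: (fg) => h fK gK; split => // x y xy; rewrite -(incb_mono fg) !gK. Qed.

Lemma incb_comp f f' g g' : incb f f' -> incb g g' -> incb (g \o f) (f' \o g').
Proof.
move=> [f1 f2 f3] [g1 g2 g3]; split; last exact: can_comp.
  by move=> x y xy /=; apply/g1/f1.
exact: can_comp.
Qed.

Lemma incb_shift c : incb (fun x => x + c) (fun x => x - c).
Proof. by split=> [x y|x|x]; rewrite ?ltrD2r ?addrK ?subrK. Qed.

Lemma incb_continuous f g : incb f g -> continuous f.
Proof.
move=> fg x; have h := incb_mono fg; case: (fg) => _ fK gK.
apply/cvgrPdist_lt => e e0; near=> y.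
rewrite ltr_distlC; apply/andP; split.
  have : g (f x - e) < y.
    near: y; apply: lt_nbhsr; rewrite -h gK; lra.
  by rewrite -h gK.
have : y < g (f x + e).
  near: y; apply: lt_nbhsl; rewrite -h gK; lra.
by rewrite -h gK.
Unshelve. all: by end_near. Qed.

(** Affine interpolation on [t, u]; the inverse is built by the same rule, with thresholds f t and g
    u. *)
Lemma incb_glue f f' g g' t u : incb f f' -> incb g g' -> t < u -> f t < g u ->
  exists k k', [/\ incb k k', forall x, x <= t -> k x = f x &
    forall x, u <= x -> k x = g x].
Proof.
move=> ff gg tu ftu.
have mf := incb_mono ff; have mg := incb_mono gg.
have [_ fK fK'] := ff; have [_ gK gK'] := gg.
have mf' := incb_mono (incb_sym ff); have mg' := incb_mono (incb_sym gg).
pose A := f t; pose B := g u.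
pose k x := if x <= t then f x else if u <= x then g x else
  A + (x - t) * ((B - A) / (u - t)).
pose k' y := if y <= A then f' y else if B <= y then g' y else
  t + (y - A) * ((u - t) / (B - A)).
have kR x : t < x -> x < u -> A < A + (x - t) * ((B - A) / (u - t)) < B.
  move=> tx xu; have c0 : 0 < (B - A) / (u - t) by rewrite divr_gt0 // /A /B; lra.
  have cE : (B - A) / (u - t) * (u - t) = B - A by rewrite divfK //; lra.
  by apply/andP; split; nra.
have k'R y : A < y -> y < B -> t < t + (y - A) * ((u - t) / (B - A)) < u.
  move=> tx xu; have c0 : 0 < (u - t) / (B - A) by rewrite divr_gt0 // /A /B; lra.
  have cE : (u - t) / (B - A) * (B - A) = u - t by rewrite divfK // /A /B; lra.
  by apply/andP; split; nra.
exists k, k'; split; last 2 first.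
- by move=> x xt; rewrite /k xt.
- move=> x ux; rewrite /k ux; case: ifP => // xt; lra.
split.
- move=> x y xy; rewrite /k.
  case: (lerP x t) => xt; case: (lerP y t) => yt; last 2 first.
  + lra.
  + case: (lerP u x) => ux; case: (lerP u y) => uy.
    * by rewrite mg.
    * lra.
    * have /andP[_ h] := kR x xt ux; apply: lt_le_trans h _.
      by rewrite /B leNgt mg -leNgt.
    * rewrite ltrD2l ltr_pM2r; first lra.
      by rewrite divr_gt0 //; rewrite /A /B; lra.
  + by rewrite mf.
  + have fA : f x <= A by rewrite /A leNgt mf -leNgt.
    case: (lerP u y) => uy.
      have : B <= g y by rewrite /B leNgt mg -leNgt.
      by rewrite /A /B in fA * => ?; lra.
    by have /andP[h _] := kR y yt uy; exact: le_lt_trans h.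
- move=> x; rewrite /k; case: (lerP x t) => xt.
    by rewrite /k' ifT ?fK // /A leNgt mf -leNgt.
  case: (lerP u x) => ux.
    have Bg : B <= g x by rewrite /B leNgt mg -leNgt.
    rewrite /k' ifF; last by apply/negbTE; rewrite -ltNge; rewrite /A /B in Bg *; lra.
    by rewrite Bg gK.
  have /andP[h1 h2] := kR x xt ux.
  rewrite /k' ifF; last by apply/negbTE; rewrite -ltNge.
  rewrite ifF; last by apply/negbTE; rewrite -ltNge.
  by field; rewrite /A /B; apply/andP; split; lra.
- move=> y; rewrite /k'; case: (lerP y A) => yA.
    by rewrite /k ifT ?fK' // leNgt -mf fK' -leNgt.
  case: (lerP B y) => yB.
    have ug : u <= g' y by rewrite leNgt -mg gK' -leNgt.
    rewrite /k ifF; last by apply/negbTE; rewrite -ltNge; lra.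
    by rewrite ug gK'.
  have /andP[h1 h2] := k'R y yA yB.
  rewrite /k ifF; last by apply/negbTE; rewrite -ltNge.
  rewrite ifF; last by apply/negbTE; rewrite -ltNge.
  by field; rewrite /A /B; apply/andP; split; lra.
Qed.

(** Induction on the sorted list: the germ at the least point is glued to the map already built for
    the others. Each G a is a global bijection of which only the germ at a is retained. *)
Lemma incb_germs (A : seq R) (G : R -> R -> R) :
  (forall a, a \in A -> exists g, incb (G a) g) ->
  {in A &, forall a b, a < b -> G a a < G b b} ->
  exists k k', incb k k' /\ forall a, a \in A -> \forall x \near a, k x = G a x.
Proof.
wlog sA : A / sorted <%R A.
  move=> H h1 h2.
  have mE x : (x \in sort <=%R (undup A)) = (x \in A) by rewrite mem_sort mem_undup.
  have [|||k [k' [kk H']]] := H (sort <=%R (undup A)).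
  - by rewrite sort_lt_sorted undup_uniq.
  - by move=> a; rewrite mE; exact: h1.
  - by move=> a b; rewrite !mE; exact: h2.
  - by exists k, k'; split => // a aA; apply: H'; rewrite mE.
elim: A sA => [|b A IH] sA h1 h2.
  by exists id, id; split => //; split.
have [g gg] := h1 b (mem_head _ _).
case: A IH sA h1 h2 => [|c A] IH sA h1 h2.
  exists (G b), g; split => // a; rewrite inE => /eqP ->.
  by apply: filterE.
have [||k [k' [kk kG]]] := IH (path_sorted sA).
- by move=> a aA; apply: h1; rewrite inE aA orbT.
- by move=> a a' aA aA'; apply: h2; rewrite inE ?aA ?aA' orbT.
have bc : b < c by move: sA => /= /andP[].
have le_c a : a \in c :: A -> c <= a.
  rewrite inE => /predU1P[->//|aA]; apply: ltW.
  by move: sA => /= /andP[_]; rewrite lt_path_sortedE => /andP[/allP /(_ _ aA)].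
have kc : k c = G c c by have /nbhs_singleton := kG c (mem_head _ _).
(* The value m separates the two pieces: t is chosen with G b t < m and u with m < k u, which is
   what [incb_glue] asks for. *)
pose m := (G b b + G c c) / 2.
have [Gm mG] : G b b < m /\ m < G c c.
  have : G b b < G c c by apply: h2; rewrite ?inE ?eqxx ?orbT.
  by rewrite /m; split; lra.
have [_ gK gK'] := gg; have [_ kK kK'] := kk.
have bgm : b < g m by rewrite -(incb_mono gg) gK'.
have kmc : k' m < c by rewrite -(incb_mono kk) kK' kc.
pose t := (b + Num.min (g m) c) / 2.
have [bt tc tm] : [/\ b < t, t < c & t < g m].
  by rewrite /t; case: (lerP (g m) c) => ?; split; lra.
pose u := (Num.max t (k' m) + c) / 2.
have [tu uc um] : [/\ t < u, u < c & k' m < u].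
  by rewrite /u; case: (lerP t (k' m)) => ?; split; lra.
have gk : G b t < k u.
  apply: (@lt_trans _ _ m); first by rewrite -[X in _ < X]gK' (incb_mono gg).
  by rewrite -[X in X < _]kK' (incb_mono kk).
have [q [q' [qq qg qk]]] := incb_glue gg kk tu gk.
exists q, q'; split => // a; rewrite inE => /predU1P[->|aA].
  by near=> x; apply: qg; near: x; exact: lt_le_nbhsl.
have ua : u < a by apply: lt_le_trans uc (le_c _ aA).
near=> x; rewrite qk; first by near: x; exact: kG.
by near: x; exact: lt_le_nbhsr.
Unshelve. all: by end_near. Qed.

End IncreasingBijections.

(** * Winding numbers *)

Section Winding.
Context {R : realType}.
Implicit Types (u v w z : R * R) (c : R -> R * R).

Definition dotp u v : R := u.1 * v.1 + u.2 * v.2.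
Definition crossp u v : R := u.1 * v.2 - u.2 * v.1.
(** This also forces both vectors to be nonzero, since otherwise both products vanish. *)
Definition not_opposite u v := crossp u v = 0 -> 0 < dotp u v.

(* Half-angle formula for the argument in ]-pi, pi[ of x + iy. *)
Definition slit_arg (x y : R) : R := atan (y / (Num.sqrt (x ^+ 2 + y ^+ 2) + x)) *+ 2.

Lemma slit_norm_gt0 (x y : R) : (y = 0 -> 0 < x) -> 0 < Num.sqrt (x ^+ 2 + y ^+ 2) + x.
Proof.
move=> xy.
have s0 : 0 <= x ^+ 2 + y ^+ 2 by nra.
have := sqr_sqrtr s0; have := sqrtr_ge0 (x ^+ 2 + y ^+ 2).
set q := Num.sqrt _ => q0 qE.
have [y0|/eqP y0] := eqVneq y 0; first by have := xy y0; lra.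
have y2 : 0 < y ^+ 2 by rewrite exprn_even_gt0 //=; apply/eqP.
nra.
Qed.

Lemma slit_argP (x y : R) : (y = 0 -> 0 < x) ->
  let q := Num.sqrt (x ^+ 2 + y ^+ 2) in
  [/\ 0 < q, x = q * cos (slit_arg x y) & y = q * sin (slit_arg x y)].
Proof.
move=> xy q; have := slit_norm_gt0 xy; rewrite /slit_arg -/q => qx0.
have s0 : 0 <= x ^+ 2 + y ^+ 2 by nra.
have qE : q ^+ 2 = x ^+ 2 + y ^+ 2 := sqr_sqrtr s0.
have q0 : 0 < q.
  have q0 : 0 <= q := sqrtr_ge0 _.
  rewrite lt_neqAle q0 andbT; apply/eqP => q0'.
  move: qE; rewrite -q0' => qE; have y0 : y = 0 by nra.
  by have := xy y0; nra.
set t := y / (q + x).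
have tE : t * (q + x) = y by rewrite /t divfK //; lra.
set a := atan t.
have t1 : 0 < 1 + t ^+ 2 by nra.
have c2 : cos a ^+ 2 = (1 + t ^+ 2)^-1 by rewrite /a cos_atan exprVn sqr_sqrtr // ltW.
have c0 : cos a != 0.
  by rewrite /a cos_atan invr_neq0 // lt0r_neq0 // sqrtr_gt0.
have sE : sin a = t * cos a.
  by rewrite -[X in X * _](atanK t) -/a /tan divfK.
(* Half-angle identity: a is half the argument and q the modulus. *)
have cE : cos a ^+ 2 * (2 * q) = q + x.
  have -> : 2 * q = (1 + t ^+ 2) * (q + x).
    apply: (mulIf (lt0r_neq0 qx0)).
    have : (t * (q + x)) ^+ 2 = y ^+ 2 by rewrite tE.
    lra.
  by rewrite c2 mulKf // lt0r_neq0.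
split => //.
- rewrite cos_mulr2n; nra.
- rewrite sin_mulr2n sE.
  have : q * ((cos a * (t * cos a)) *+ 2) = t * (cos a ^+ 2 * (2 * q)) by ring.
  by move=> ->; rewrite cE.
Qed.

Lemma slit_arg_continuous (f g : R -> R) t :
  {for t, continuous f} -> {for t, continuous g} -> (g t = 0 -> 0 < f t) ->
  {for t, continuous (fun s => slit_arg (f s) (g s))}.
Proof.
move=> cf cg fg; rewrite /slit_arg.
have D : {for t, continuous (fun s => Num.sqrt (f s ^+ 2 + g s ^+ 2) + f s)}.
  apply: (@cvgD _ _ _ _ _ (fun s => Num.sqrt (f s ^+ 2 + g s ^+ 2)) f) => //.
  apply: (@continuous_comp _ _ _ (fun s => f s ^+ 2 + g s ^+ 2) Num.sqrt).
    apply: (@cvgD _ _ _ _ _ (fun s => f s ^+ 2) (fun s => g s ^+ 2));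
    rewrite !expr2; exact: cvgM.
  exact: sqrt_continuous.
apply: (@cvgMn _ _ _ _ _ (fun s => atan (g s / (Num.sqrt (f s ^+ 2 + g s ^+ 2) + f s)))).
apply: (@continuous_comp _ _ _ (fun s => g s / (Num.sqrt (f s ^+ 2 + g s ^+ 2) + f s)) atan); last exact: continuous_atan.
apply: (@cvgM _ _ _ _ g) => //; apply: (@cvgV _ _ _ _ (fun s => Num.sqrt (f s ^+ 2 + g s ^+ 2) + f s)) => //.
by rewrite lt0r_neq0 // slit_norm_gt0.
Qed.

(* Poincare-Bohl: the angle from c1 - w1 to c2 - w2 stays in ]-pi, pi[, hence
   returns to its initial value. *)
Lemma winding_not_opposite c1 c2 w1 w2 k :
  continuous c1 -> continuous c2 -> c1 0 = c1 1 -> c2 0 = c2 1 ->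
  (forall t, t \in `[0, 1] -> not_opposite (c1 t - w1) (c2 t - w2)) ->
  winding c1 w1 k -> winding c2 w2 k.
Proof.
move=> cc1 cc2 l1 l2 H [theta [ct pt wt]].
(* As complex numbers, u + iv is the conjugate of c1 - w1 times c2 - w2. Adding its argument to
   theta therefore gives an argument of c2 - w2, with modulus Q / q. *)
pose u t := dotp (c1 t - w1) (c2 t - w2).
pose v t := crossp (c1 t - w1) (c2 t - w2).
have cfst c w : continuous c -> continuous (fun t => (c t - w).1).
  move=> cc t; apply: (@cvgB _ _ _ _ _ (fun t => (c t).1) (fun=> w.1)); last exact: cvg_cst.
  exact: (continuous_comp (cc t) cvg_fst).
have csnd c w : continuous c -> continuous (fun t => (c t - w).2).
  move=> cc t; apply: (@cvgB _ _ _ _ _ (fun t => (c t).2) (fun=> w.2)); last exact: cvg_cst.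
  exact: (continuous_comp (cc t) cvg_snd).
have cu : continuous u.
  move=> t; apply: (@cvgD _ _ _ _ _ (fun t => (c1 t - w1).1 * (c2 t - w2).1)
    (fun t => (c1 t - w1).2 * (c2 t - w2).2)); apply: cvgM;
    first [exact: cfst|exact: csnd].
have cv : continuous v.
  move=> t; apply: (@cvgB _ _ _ _ _ (fun t => (c1 t - w1).1 * (c2 t - w2).2)
    (fun t => (c1 t - w1).2 * (c2 t - w2).1)); apply: cvgM;
    first [exact: cfst|exact: csnd].
exists (fun t => theta t + slit_arg (u t) (v t)); split.
- move=> t; apply: cvgD; first exact: ct.
  move: t; apply: continuous_in_subspaceT => t; rewrite inE /= => t01.
  by apply: slit_arg_continuous; [exact: cu|exact: cv|exact: H].
- move=> t t01; have [q q0 c1E] := pt t t01.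
  have [Q0 uE vE] := slit_argP (H t t01).
  set Q := Num.sqrt _ in Q0 uE vE.
  exists (Q / q); first by rewrite divr_gt0.
  have E1 : (c1 t - w1).1 = q * cos (theta t) by rewrite c1E /=; ring.
  have E2 : (c1 t - w1).2 = q * sin (theta t) by rewrite c1E /=; ring.
  rewrite -[LHS](subrK w2) addrC; congr (_ + _).
  rewrite [LHS]surjective_pairing cosD sinD.
  have cs := cos2Dsin2 (theta t).
  set a := slit_arg _ _ in uE vE *.
  have q1 : q != 0 by rewrite lt0r_neq0.
  have X1 : (c2 t - w2).1 * q = Q * (cos (theta t) * cos a - sin (theta t) * sin a).
    rewrite mulrBr ![Q * (_ * _)]mulrCA -uE -vE /dotp /crossp E1 E2.
    rewrite -[LHS]mulr1 -cs; ring.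
  have X2 : (c2 t - w2).2 * q = Q * (sin (theta t) * cos a + cos (theta t) * sin a).
    rewrite mulrDr ![Q * (_ * _)]mulrCA -uE -vE /dotp /crossp E1 E2.
    rewrite -[LHS]mulr1 -cs; ring.
  congr (_, _).
    by apply: (mulIf q1); rewrite X1; field.
  by apply: (mulIf q1); rewrite X2; field.
- by rewrite -wt /u /v l1 l2; ring.
Qed.

End Winding.

(** * Continuity at a point, by structural rules *)

Section PointwiseContinuity.
Context {R : realType} {T : topologicalType} (x : T).
Implicit Types f g : T -> R.

Lemma pair_continuous f g : {for x, continuous f} -> {for x, continuous g} ->
  {for x, continuous (fun y => (f y, g y) : R * R)}.
Proof. exact: cvg_pair. Qed.

Lemma cst_continuous_at (c : R) : {for x, continuous (fun=> c)}.
Proof. exact: cvg_cst. Qed.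

Lemma add_continuous_at f g : {for x, continuous f} -> {for x, continuous g} ->
  {for x, continuous (fun y => f y + g y)}.
Proof. exact: cvgD. Qed.

Lemma opp_continuous_at f : {for x, continuous f} ->
  {for x, continuous (fun y => - f y)}.
Proof. exact: cvgN. Qed.

Lemma mul_continuous_at f g : {for x, continuous f} -> {for x, continuous g} ->
  {for x, continuous (fun y => f y * g y)}.
Proof. exact: cvgM. Qed.

Lemma inv_continuous_at f : {for x, continuous f} -> f x != 0 ->
  {for x, continuous (fun y => (f y)^-1)}.
Proof. by move=> ? ?; exact: cvgV. Qed.

Lemma comp_continuous_at f (k : R -> R) : {for x, continuous f} ->
  continuous k -> {for x, continuous (fun y => k (f y))}.
Proof. by move=> cf ck; exact: (continuous_comp cf (ck _)). Qed.

Lemma comp2_continuous_at (c : T -> R * R) (k : R * R -> R) :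
  {for x, continuous c} -> continuous k -> {for x, continuous (fun y => k (c y))}.
Proof. by move=> cf ck; exact: (continuous_comp cf (ck _)). Qed.

Lemma fst_continuous_at (c : T -> R * R) : {for x, continuous c} ->
  {for x, continuous (fun y => (c y).1)}.
Proof. by move=> cc; exact: (continuous_comp cc cvg_fst). Qed.

Lemma snd_continuous_at (c : T -> R * R) : {for x, continuous c} ->
  {for x, continuous (fun y => (c y).2)}.
Proof. by move=> cc; exact: (continuous_comp cc cvg_snd). Qed.

End PointwiseContinuity.

Lemma id_continuous_at {R : realType} (x : R) : {for x, continuous (fun y : R => y)}.
Proof. exact: cvg_id. Qed.

Lemma id2_continuous_at {R : realType} (x : R * R) :
  {for x, continuous (fun y : R * R => y)}.
Proof. exact: cvg_id. Qed.

(** The context is tried first, so the continuity of an opaque subterm can be supplied as a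
    hypothesis. An inverse leaves the goal that its argument is nonzero. *)
Ltac cont_at t F := first [assumption | lazymatch F with
  | (fun _ => ?c) => apply: (@cst_continuous_at _ _ t c)
  | (fun x => x) => first [apply: (@id_continuous_at _ t) | apply: (@id2_continuous_at _ t)]
  | (fun x => (@?f x, @?g x)) => apply: (@pair_continuous _ _ t f g)
  | (fun x => @?f x + @?g x) => apply: (@add_continuous_at _ _ t f g)
  | (fun x => - @?f x) => apply: (@opp_continuous_at _ _ t f)
  | (fun x => @?f x * @?g x) => apply: (@mul_continuous_at _ _ t f g)
  | (fun x => (@?f x)^-1) => apply: (@inv_continuous_at _ _ t f)
  | fst => apply: (@fst_continuous_at _ _ t id)
  | snd => apply: (@snd_continuous_at _ _ t id)
  | (fun x => fst (@?c x)) => apply: (@fst_continuous_at _ _ t c)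
  | (fun x => snd (@?c x)) => apply: (@snd_continuous_at _ _ t c)
  | id => first [apply: (@id_continuous_at _ t) | apply: (@id2_continuous_at _ t)]
  end].
Ltac cont1 := lazymatch goal with
  | |- @prop_for _ ?t (fun y => continuous_at y ?F) _ => cont_at t F
  | |- continuous_at ?t ?F => cont_at t F
  | |- continuous ?F => let t := fresh "t" in move=> t; cont_at t F end.
Ltac cont := repeat cont1.

(** * Independence of the local degree from the circle *)

Section Degree.
Context {R : realType}.
Implicit Types (z w : R * R) (h : R * R -> R * R).

(** Serves twice: for winding numbers along a homotopy, and for the direction of monotonicity across
    the zeros of s1. *)
Lemma locally_constant (P : R -> Prop) :
  (forall x, \forall y \near x, P y <-> P x) -> forall x y, P x -> P y.
Proof.
move=> Ploc x y Px.
have cT : connected [set: R] by apply/connected_intervalP.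
have oP : open [set t | P t].
  rewrite openE => t /= Pt; by apply: filterS (Ploc t) => u [_]; apply.
have oN : open [set t | ~ P t].
  rewrite openE => t /= Pt; by apply: filterS (Ploc t) => u [h _] /h.
have : [set t | P t] = [set: R].
  apply: cT; first by exists x.
    by exists [set t | P t] => //; rewrite setTI.
  exists [set t | P t]; last by rewrite setTI.
  by rewrite -(setCK [set t | P t]); apply: open_closedC; exact: oN.
by move=> PT; have : [set t | P t] y by rewrite PT.
Qed.

Lemma circle_loop z rho : circle z rho 0 = circle z rho 1 :> R * R.
Proof.
by rewrite /circle mulr0 mulr1 sin0 cos0 [2 * pi]mulr_natl cos2pi sin2pi.
Qed.

Lemma dotpp_gt0 (u : R * R) : u <> 0 -> 0 < dotp u u.
Proof.
move=> u0; rewrite /dotp; have [a0|a0] := eqVneq u.1 0; last first.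
  have : 0 < u.1 ^+ 2 by rewrite exprn_even_gt0.
  nra.
have [b0|b0] := eqVneq u.2 0; first by exfalso; apply: u0; rewrite [u]surjective_pairing a0 b0.
have : 0 < u.2 ^+ 2 by rewrite exprn_even_gt0.
nra.
Qed.

(** Moving the centre and the radius of a circle is a homotopy. By injectivity the image loop never
    meets the image of the moving centre, so the winding number is locally constant in the
    parameter. *)
Lemma winding_circle_indep h z rho z' rho' k :
  continuous h -> injective h -> 0 < rho -> 0 < rho' ->
  winding (h \o circle z rho) (h z) k -> winding (h \o circle z' rho') (h z') k.
Proof.
move=> ch ih r0 r0'.
pose zt t : R * R := (z.1 + t * (z'.1 - z.1), z.2 + t * (z'.2 - z.2)).
(* Interpolating the logarithm keeps the radius positive for all real t, as [locally_constant] works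
   on the whole line. *)
pose rt t : R := expR (ln rho + t * (ln rho' - ln rho)).
have z0 : zt 0 = z by rewrite /zt !mul0r !addr0 -surjective_pairing.
have z1 : zt 1 = z' by rewrite /zt !mul1r ![z.1 + _]addrC ![z.2 + _]addrC !subrK -surjective_pairing.
have rt0 : rt 0 = rho by rewrite /rt mul0r addr0 lnK.
have rt1 : rt 1 = rho' by rewrite /rt mul1r addrC subrK lnK.
pose P t := winding (h \o circle (zt t) (rt t)) (h (zt t)) k.
suff PP : forall t, \forall u \near t, P u <-> P t.
  move=> W; have : P 1.
    by apply: (locally_constant PP (x := 0)); rewrite /P z0 rt0.
  by rewrite /P z1 rt1.
have czt : continuous zt by rewrite /zt; cont.
have crt : continuous rt.
  move=> t; apply: (@comp_continuous_at _ _ t _ expR); last exact: continuous_expR.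
  by cont.
pose D (u : R * R) : R * R := h (circle (zt u.1) (rt u.1) u.2) - h (zt u.1).
have cC : continuous (fun u : R * R => circle (zt u.1) (rt u.1) u.2).
  have c1 (u : R * R) : {for u, continuous (fun v : R * R => zt v.1)}.
    exact: (continuous_comp cvg_fst (czt _)).
  have c2 (u : R * R) : {for u, continuous (fun v : R * R => rt v.1)}.
    exact: (continuous_comp cvg_fst (crt _)).
  have c3 (u : R * R) : {for u, continuous (fun v : R * R => 2 * pi * v.2)} by cont.
  move=> u; apply: (@cvgD _ _ _ _ _ (fun v : R * R => zt v.1)); first exact: c1.
  have c4 := comp_continuous_at (c3 u) (@continuous_cos R).
  have c5 := comp_continuous_at (c3 u) (@continuous_sin R).
  have c6 := c2 u.
  have c7 : {for u, continuous (fun v : R * R =>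
    (rt v.1 * cos (2 * pi * v.2), rt v.1 * sin (2 * pi * v.2)) : R * R)} by cont.
  exact: c7.
have cD : continuous D.
  move=> u; apply: (@cvgB _ _ _ _ _ (fun u : R * R => h (circle (zt u.1) (rt u.1) u.2)) (fun u : R * R => h (zt u.1))).
    exact: (continuous_comp (cC u) (ch _)).
  apply: (continuous_comp (f := fun u : R * R => zt u.1) _ (ch _)).
  exact: (continuous_comp cvg_fst (czt _)).
have D0 u : D u <> 0.
  move=> /eqP; rewrite /D subr_eq0 => /eqP /ih.
  rewrite /circle -[X in _ = X]addr0 => /addrI [/eqP].
  rewrite mulf_eq0 [_ == 0]gt_eqF ?expR_gt0 //= => /eqP c0 /eqP.
  rewrite mulf_eq0 [_ == 0]gt_eqF ?expR_gt0 //= => /eqP s0.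
  have := cos2Dsin2 (2 * pi * u.2); rewrite c0 s0 => ?; lra.
move=> t.
(* Nearby loops must stay within a right angle of each other at all times s; compactness of [0, 1]
   makes the neighbourhood of t uniform in s. *)
have : \forall u \near t, `[0, 1]%classic `<=` [set s | 0 < dotp (D (u, s)) (D (t, s))].
  have /compact_near_coveringP K := @segment_compact R 0 1.
  apply: (K R (nbhs t) (fun u s => 0 < dotp (D (u, s)) (D (t, s)))) => s _.
  have : {for (s, t), continuous (fun v : R * R => dotp (D (v.2, v.1)) (D (t, v.1)))}.
    have c1 : {for (s, t), continuous (fun v : R * R => D (v.2, v.1))}.
      apply: (@continuous_comp _ _ _ (fun v : R * R => (v.2, v.1)) D); last exact: cD.
      by cont.
    have c2 : {for (s, t), continuous (fun v : R * R => D (t, v.1))}.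
      apply: (@continuous_comp _ _ _ (fun v : R * R => (t, v.1)) D); last exact: cD.
      by cont.
    by rewrite /dotp; cont.
  move=> /cvgrPdist_lt /(_ _ (dotpp_gt0 (D0 (t, s)))) /=.
  apply: filterS => v /=; rewrite ltr_norml; lra.
apply: filterS => u Hu.
have cc q : continuous (h \o circle (zt q) (rt q)).
  move=> s; apply: (@continuous_comp _ _ _ (circle (zt q) (rt q)) h); last exact: ch.
  have -> : circle (zt q) (rt q) = (fun u : R * R => circle (zt u.1) (rt u.1) u.2) \o (fun s => (q, s)) by [].
  apply: continuous_comp (cC _).
  by cont.
have ll q : (h \o circle (zt q) (rt q)) 0 = (h \o circle (zt q) (rt q)) 1.
  by rewrite /= circle_loop.
split; apply: winding_not_opposite => // s s01 _.
  exact: (Hu s s01).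
by have := Hu s s01; rewrite /dotp /D /= mulrC [X in _ + X]mulrC.
Qed.

End Degree.

(** * Leaves and inseparable points *)

Section Leaves.
Context {R : realType}.
Implicit Types (r s d : R -> R) (z w : R * R) (a x y t : R).

(* A weakening of smoothness stable under reparametrisation of x and under
   x |-> -x. Submersivity forces s'(a) = 0 and r'(a) <> 0 at a zero a of s;
   d a is the sign of r'(a). *)
Definition tame r s d := [/\ continuous r, continuous s, finite_set (zeros s) &
  forall a, s a = 0 -> (d a = 1 \/ d a = -1) /\
    forall e, 0 < e -> exists2 dl, 0 < dl & forall x y, a - dl < x -> x < y ->
      y < a + dl -> `|s y - s x| <= e * (d a * (r y - r x)) /\ 0 < d a * (r y - r x)].

Definition between x t y := (x <= t /\ t <= y) \/ (y <= t /\ t <= x).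

(** The first disjunct makes each zero of s a class of its own. *)
Definition same_strip s x y := x = y \/ forall t, between x t y -> s t <> 0.

Definition same_leaf r s z w :=
  same_strip s z.1 w.1 /\ linear_like r s z = linear_like r s w.

(* The leaves of z and w are equal or not separated in the leaf space. *)
Definition inseparable r s z w := forall U V, nbhs z U -> nbhs w V ->
  exists u v, [/\ U u, V v & same_leaf r s u v].

Lemma between_sym x t y : between x t y -> between y t x.
Proof. by rewrite /between; tauto. Qed.

Lemma between_l x y : between x x y.
Proof. by rewrite /between; case: (lerP x y) => ?; [left|right]; split; lra. Qed.

Lemma between_r x y : between x y y.
Proof. by apply/between_sym/between_l. Qed.

Lemma between_xx x t : between x t x -> t = x.
Proof. by case=> -[? ?]; apply/eqP; rewrite eq_le; apply/andP. Qed.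

Lemma between_split x y v t : between x t v -> between x t y \/ between y t v.
Proof.
rewrite /between; case: (lerP t y) => ? [[? ?]|[? ?]].
- by left; left; split; lra.
- by right; right; split; lra.
- by right; left; split; lra.
- by left; right; split; lra.
Qed.

Lemma same_strip_refl s x : same_strip s x x.
Proof. by left. Qed.

Lemma same_strip_sym s x y : same_strip s x y -> same_strip s y x.
Proof. by case=> [->|H]; [left|right => t /between_sym; exact: H]. Qed.

Lemma same_strip_trans s y x v : same_strip s x y -> same_strip s y v -> same_strip s x v.
Proof.
case=> [->//|H1] [<-|H2]; first by right.
by right => t /(between_split y) [/H1|/H2].
Qed.

Lemma same_leaf_refl r s z : same_leaf r s z z.
Proof. by split => //; left. Qed.

Lemma same_leaf_sym r s z w : same_leaf r s z w -> same_leaf r s w z.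
Proof. by case=> h1 h2; split; [exact: same_strip_sym|rewrite h2]. Qed.

Lemma same_leaf_trans r s z w v : same_leaf r s w z -> same_leaf r s z v -> same_leaf r s w v.
Proof. by case=> h1 h2 [h3 h4]; split; [exact: same_strip_trans h1 h3|rewrite h2]. Qed.

Lemma same_strip_zero s a x : s a = 0 -> same_strip s a x -> x = a.
Proof.
move=> sa [->//|]; move=> /(_ a); case; rewrite /between ?sa //.
by case: (lerP a x) => ?; [left|right]; split; lra.
Qed.

Lemma finite_isolated (Z : set R) x : finite_set Z ->
  exists2 dl, 0 < dl & forall t, `|t - x| < dl -> Z t -> t = x.
Proof.
move=> fZ.
have : closed (Z `\ x).
  have /accessible_finite_set_closed fc : accessible_space R.
    exact/hausdorff_accessible/norm_hausdorff.
  by apply: fc; exact: finite_setD.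
move=> /closed_openC oZ.
have : nbhs x (~` (Z `\ x)) by apply: open_nbhs_nbhs; split => //= -[].
move=> /nbhs_ballP [e /= e0 He]; exists e => // t tx Zt; apply: contrapT => nt.
have : ball x e t by rewrite /ball /= distrC.
by move=> /He; apply.
Qed.

Lemma near_between (P : R -> Prop) a x : a <> x -> (\forall t \near a, P t) ->
  exists t, [/\ P t, t <> a & between a t x].
Proof.
move=> ax /nbhs_ballP [e /= e0 He].
have [xa|xa] : a < x \/ x < a by case: (ltgtP a x) ax => // *; [left|right].
  have m0 : 0 < Num.min (e / 2) (x - a) by rewrite lt_min; apply/andP; split; lra.
  exists (a + Num.min (e / 2) (x - a)); split; last by left; case: (lerP (e / 2) (x - a)) m0 => *; split; lra.
    apply: He; rewrite /ball /= opprD addNKr normrN gtr0_norm //.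
    by case: (lerP (e / 2) (x - a)) => *; lra.
  by move=> ?; lra.
have m0 : 0 < Num.min (e / 2) (a - x) by rewrite lt_min; apply/andP; split; lra.
exists (a - Num.min (e / 2) (a - x)); split; last by right; case: (lerP (e / 2) (a - x)) m0 => *; split; lra.
  apply: He; rewrite /ball /= opprB addrCA subrr addr0 gtr0_norm //.
  by case: (lerP (e / 2) (a - x)) => *; lra.
by move=> ?; lra.
Qed.


Lemma linear_like_continuous r s : continuous r -> continuous s ->
  continuous (linear_like r s).
Proof.
move=> cr cs z.
have c1 : {for z, continuous (fun w : R * R => r w.1)} by apply: comp_continuous_at cr; cont.
have c2 : {for z, continuous (fun w : R * R => s w.1)} by apply: comp_continuous_at cs; cont.
by rewrite /linear_like; cont.
Qed.

(* Near a zero of s, at bounded height, r dominates s * y. *)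
Lemma tame_level_sign r s d a M : tame r s d -> s a = 0 ->
  exists2 dl, 0 < dl & forall z, z.1 <> a -> `|z.1 - a| < dl -> `|z.2| <= M ->
    0 < d a * (linear_like r s z - r a) * (z.1 - a).
Proof.
move=> [_ _ _ T] sa; have [da H] := T a sa.
(* The inverse of this number is the e of tameness: it gives e * |y| <= 1/2 for |y| <= M, so s * y
   is at most half the increment of r. *)
have N0 : 0 < 2 * (`|M| + 1) by have := normr_ge0 M; lra.
have e0 : 0 < (2 * (`|M| + 1))^-1 by rewrite invr_gt0.
have [dl dl0 K] := H _ e0; exists dl => // -[x y] /= xa.
rewrite ltr_norml => /andP[x1 x2] yM.
set e := _^-1 in e0 K.
have eM : e * `|y| <= 1 / 2.
  have eE : e * (2 * (`|M| + 1)) = 1 by rewrite /e mulVf // lt0r_neq0.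
  have yM' : `|y| <= `|M| := le_trans yM (ler_norm M).
  nra.
have [ax|{}xa] : a < x \/ x < a by apply/orP; rewrite -neq_lt eq_sym; exact/eqP.
- have [|||k1 k2] := K a x; try lra.
  rewrite sa subr0 in k1.
  rewrite pmulr_lgt0; last lra.
  have sy : `|s x * y| <= 1 / 2 * (d a * (r x - r a)).
    rewrite normrM; apply: le_trans (ler_wpM2r (normr_ge0 y) k1) _.
    by rewrite mulrAC; apply: ler_wpM2r => //; exact: ltW.
  rewrite /linear_like /=; case: da => dE; rewrite dE in k2 sy *; move: sy; rewrite ler_norml => /andP[? ?]; lra.
- have [|||k1 k2] := K x a; try lra.
  rewrite sa sub0r normrN in k1.
  rewrite nmulr_lgt0; last lra.
  have sy : `|s x * y| <= 1 / 2 * (d a * (r a - r x)).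
    rewrite normrM; apply: le_trans (ler_wpM2r (normr_ge0 y) k1) _.
    by rewrite mulrAC; apply: ler_wpM2r => //; exact: ltW.
  rewrite /linear_like /=; case: da => dE; rewrite dE in k2 sy *; move: sy; rewrite ler_norml => /andP[? ?]; lra.
Qed.

End Leaves.

(** * Leaves as connected components of level sets *)

Section Components.
Context {R : realType}.
Implicit Types (r s d : R -> R) (z w : R * R) (a x y t : R).

(** Inside the level set of r a, the line nu_a is thus open as well as closed. *)
Lemma tame_vertical_open r s d a : tame r s d -> s a = 0 ->
  open [set z : R * R | z.1 = a \/ linear_like r s z <> r a].
Proof.
move=> T sa; have [cr cs _ _] := T.
rewrite openE => z /= zP.
have [za|/eqP za] := eqVneq z.1 a.
  have [dl dl0 H] := tame_level_sign (`|z.2| + 1) T sa.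
  apply/nbhs_ballP; exists (Num.min dl 1) => /=; first by rewrite lt_min dl0 ltr01.
  move=> w [/= w1 w2].
  have {}w1 : `|z.1 - w.1| < dl by apply: lt_le_trans w1 _; rewrite ge_min lexx.
  have {}w2 : `|z.2 - w.2| < 1 by apply: lt_le_trans w2 _; rewrite ge_min lexx orbT.
  have [->|/eqP wa] := eqVneq w.1 a; [by left|right => wr].
  have := H w wa; rewrite wr subrr mulr0 mul0r ltxx => K; apply/notF/K.
    by rewrite distrC -za.
  rewrite -[w.2](subrK z.2) (le_trans (ler_normD _ _)) // addrC lerD2l.
  by rewrite distrC ltW.
have {zP} zn : linear_like r s z != r a by apply/eqP; case: zP.
have /cvgrPdist_lt /(_ `|linear_like r s z - r a|) := linear_like_continuous cr cs (x := z).
rewrite normr_gt0 subr_eq0 zn => /(_ isT); apply: filterS => w /= Hw; right => wr.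
by move: Hw; rewrite wr ltxx.
Qed.

Lemma is_interval_strip s x : is_interval [set y | forall t, between x t y -> s t <> 0].
Proof.
move=> y1 y2 /= H1 H2 y /andP[y1y yy2] t.
case: (lerP x y) => xy [[? ?]|[? ?]].
- by apply: H2; left; split; lra.
- by apply: H2; left; split; lra.
- by apply: H1; right; split; lra.
- by apply: H1; right; split; lra.
Qed.

Lemma connected_componentE r s d z : tame r s d ->
  connected_component (linear_like r s @^-1` [set linear_like r s z]) z =
  [set w | same_leaf r s z w].
Proof.
move=> T; have [cr cs _ _] := T; apply/seteqP; split.
- move=> w [C [Cz CL Cc] Cw]; split; last by have := CL w Cw.
  apply: contrapT => nss.
  have [a [sa aw]] : exists a, s a = 0 /\ between z.1 a w.1.
    apply: contrapT => H; apply: nss; right => t tb st; apply: H; by exists t.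
  have Ci : is_interval (fst @` C).
    apply/connected_intervalP/connected_continuous_connected => //.
    by apply: continuous_subspaceT => u; exact: cvg_fst.
  have [[a' y] Cay /= aE] : (fst @` C) a.
    case: aw => -[h1 h2].
      by apply: (Ci z.1 w.1); [exists z|exists w|rewrite h1 h2].
    by apply: (Ci w.1 z.1); [exists w|exists z|rewrite h1 h2].
  rewrite aE {a' aE} in Cay.
  have pE v : C v -> linear_like r s v = r a.
    move=> Cv; have := CL v Cv; have := CL _ Cay; rewrite /= /linear_like /= sa mul0r addr0.
    by move=> -> ->.
  have E : C `&` [set v | v.1 = a] = C.
    apply: Cc; first by exists (a, y).
      exists [set z : R * R | z.1 = a \/ linear_like r s z <> r a].
        exact: tame_vertical_open T sa.
      apply/seteqP; split => v /= [Cv]; first by move=> ?; split => //; left.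
      by case=> // /(_ (pE v Cv)).
    exists [set v | v.1 = a] => //.
    apply: (@preimage_closed _ _ fst [set a]) => [? _|]; first exact: cvg_fst.
    exact/accessible_closed_set1/hausdorff_accessible/norm_hausdorff.
  have [za wa] : z.1 = a /\ w.1 = a by rewrite -E in Cz Cw; case: Cz Cw => ? ? [].
  by apply: nss; left; rewrite za wa.
- apply: connected_component_max; first exact: same_leaf_refl.
    by move=> w [].
  have [sz|/eqP sz] := eqVneq (s z.1) 0.
    have -> : [set w | same_leaf r s z w] = (fun y => (z.1, y)) @` [set: R].
      apply/seteqP; split => w.
        by move=> [/(same_strip_zero sz) <- _]; exists w.2 => //; rewrite -surjective_pairing.
      by move=> [y _ <-]; split; [left|rewrite /linear_like /= sz !mul0r].
    apply: connected_continuous_connected; first by apply/connected_intervalP.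
    by apply: continuous_subspaceT; cont.
  pose f x : R * R := (x, (linear_like r s z - r x) / s x).
  have -> : [set w | same_leaf r s z w] = f @` [set y | forall t, between z.1 t y -> s t <> 0].
    apply/seteqP; split => w.
      move=> [H wE]; exists w.1.
        case: H => // <- t; move/between_xx ->; exact: sz.
      rewrite /f [in RHS](surjective_pairing w); congr (_, _).
      have sw : s w.1 != 0.
        apply/eqP; case: H => [<- //|]; apply; exact: between_r.
      by rewrite wE /linear_like addrC addKr mulrC mulKf.
    move=> [x H <-]; split; first by right.
    have sx : s x <> 0 by apply: H; exact: between_r.
    rewrite [in RHS]/linear_like /= mulrC divfK; last exact/eqP.
    by rewrite addrC subrK.
  apply: connected_continuous_connected.
    by apply/connected_intervalP; exact: is_interval_strip.
  apply: continuous_in_subspaceT => x; rewrite inE /= => H.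
  have sx : s x <> 0 by apply: H; exact: between_r.
  have c1 := cr x; have c2 := cs x.
  by rewrite /f; cont; apply/eqP.
Qed.

End Components.

(** * Which leaves are inseparable *)

Section Inseparable.
Context {R : realType}.
Implicit Types (r s d : R -> R) (z w : R * R) (a x y t : R).

Lemma nbhs_fst (z : R * R) (U : set R) : nbhs z.1 U -> nbhs z (fst @^-1` U).
Proof. exact: (@cvg_fst _ _ (nbhs z.1) (nbhs z.2)). Qed.

Lemma finite_near (Z : set R) x : finite_set Z -> \forall t \near x, Z t -> t = x.
Proof.
move=> /(finite_isolated x) [dl dl0 H]; apply/nbhs_ballP; exists dl => //= t.
by rewrite /ball /= distrC; exact: H.
Qed.

Lemma near_between_all (P : R -> Prop) x : (\forall t \near x, P t) ->
  \forall y \near x, forall t, between x t y -> P t.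
Proof.
move=> /nbhs_ballP [e /= e0 He]; apply/nbhs_ballP; exists e => //= y.
rewrite /ball /= ltr_norml => /andP[? ?] t tb; apply: He.
by rewrite /ball /= ltr_norml; apply/andP; case: tb => -[? ?]; split; lra.
Qed.

Lemma near_same_strip s x : finite_set (zeros s) -> s x <> 0 ->
  \forall y \near x, same_strip s x y.
Proof.
move=> fZ sx; apply: filterS (near_between_all (finite_near x fZ)) => y H.
by right => t tb st; apply: sx; rewrite -(H t tb st).
Qed.

(** For t between a and x, the point (t, y) and the point over x at the same level share a leaf; as
    t tends to a they tend to (a, y) and w. *)
Lemma inseparable_adjacent r s a x y w : continuous r -> continuous s -> a <> x ->
  (forall t, between a t x -> t <> a -> s t <> 0) -> w.1 = x ->
  linear_like r s w = r a -> s a = 0 -> inseparable r s (a, y) w.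
Proof.
move=> cr cs ax H wx wE sa U V nU nV.
have sx : s x != 0 by apply/eqP; apply: H => [|/esym//]; exact: between_r.
pose u t : R * R := (t, y).
pose v t : R * R := (x, (linear_like r s (t, y) - r x) / s x).
have cu : continuous u by rewrite /u; cont.
have cv : continuous v.
  move=> t; have c1 : {for t, continuous (fun t => linear_like r s (t, y))}.
    by apply: comp2_continuous_at (linear_like_continuous cr cs); cont.
  by rewrite /v; cont.
have va : v a = w.
  rewrite /v [RHS]surjective_pairing wx; congr (_, _); rewrite {1}/linear_like /= sa mul0r addr0 -wE.
  by rewrite /linear_like wx addrC addKr mulrC mulKf.
have nU' : \forall t \near a, U (u t) := cu a _ nU.
have nV' : \forall t \near a, V (v t).
  by apply: (cv a); rewrite /= va.
have [t [[Ut Vt] ta tb]] := near_between ax (filterI nU' nV').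
exists (u t), (v t); split => //; split.
  right => q qb; apply: H.
    by move: tb qb; rewrite /u /v /between /= => -[[? ?]|[? ?]] [[? ?]|[? ?]]; first [by left; split; lra|by right; split; lra].
  move=> qa; apply: ta; move: tb qb; rewrite /u /v /between /= qa => tb qb.
  apply/eqP; rewrite eq_le; apply/andP.
  by move: tb qb ax => [[? ?]|[? ?]] [[? ?]|[? ?]] /eqP; rewrite neq_lt => /orP [?|?]; split; lra.
rewrite [RHS]/linear_like /= [s x * _]mulrC divfK //.
by rewrite addrC subrK.
Qed.

Lemma inseparable_level r s z w : continuous r -> continuous s ->
  inseparable r s z w -> linear_like r s z = linear_like r s w.
Proof.
move=> cr cs H; apply/eqP; rewrite -subr_eq0 -normr_le0 leNgt; apply/negP => e0.
set p := linear_like r s in H e0.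
set e := `| _ | in e0.
have cp : continuous p := linear_like_continuous cr cs.
have e2 : 0 < e / 2 by lra.
have /cvgrPdist_lt /(_ _ e2) nz := cp z.
have /cvgrPdist_lt /(_ _ e2) nw := cp w.
have [u [v [Uu Vv [_ uv]]]] := H _ _ nz nw.
rewrite -/p /= in Uu Vv uv.
have : e < e; last by rewrite ltxx.
rewrite {1}/e -(subrK (p u) (p z)) -addrA {2}uv.
apply: le_lt_trans (ler_normD _ _) _.
by rewrite [`|p v - p w|]distrC; lra.
Qed.

Lemma inseparable_strip r s z w : inseparable r s z w ->
  forall U V : set R, nbhs z.1 U -> nbhs w.1 V ->
  exists x y, [/\ U x, V y & same_strip s x y].
Proof.
move=> H U V nU nV; have [u [v [Uu Vv [uv _]]]] := H _ _ (nbhs_fst nU) (nbhs_fst nV).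
by exists u.1, v.1.
Qed.

(** Inseparable leaves have equal levels, so two different ones cannot lie in strips that are both
    open around z and w. A zero t strictly between would have to be crossed by the leaves passing
    near z and near w. *)
Lemma inseparableP r s d z w : tame r s d -> inseparable r s z w -> s z.1 <> 0 ->
  ~ same_leaf r s z w ->
  [/\ s w.1 = 0, linear_like r s z = linear_like r s w &
    forall t, between z.1 t w.1 -> t <> w.1 -> s t <> 0].
Proof.
move=> [cr cs fZ _] H sz nl.
have pE := inseparable_level cr cs H.
have Hs := inseparable_strip H.
have nz := near_same_strip fZ sz.
have sw : s w.1 = 0.
  apply: contrapT => sw; have nw := near_same_strip fZ sw.
  have [x [y [h1 h2 h3]]] := Hs _ _ nz nw.
  apply: nl; split => //; apply: same_strip_trans h1 _; apply: same_strip_trans h3 _.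
  exact: same_strip_sym.
split => // t tb tw st.
have tw0 : 0 < `|t - w.1| by rewrite normr_gt0 subr_eq0; exact/eqP.
have nw : \forall v \near w.1, `|w.1 - v| < `|t - w.1|.
  by apply/nbhs_ballP; exists `|t - w.1|.
have [x [y [h1 h2 h3]]] := Hs _ _ nz nw.
have := same_strip_trans h1 h3 => -[zy|].
  move: h2; rewrite /= -zy ltr_norml; case: tb => -[h4 h5].
    by rewrite ler0_norm ?subr_le0 // => /andP[? ?]; lra.
  by rewrite ger0_norm ?subr_ge0 // => /andP[? ?]; lra.
move=> /(_ t); apply => //; move: h2; rewrite /= ltr_norml.
case: tb => -[h4 h5].
  by rewrite ler0_norm ?subr_le0 // => /andP[? ?]; left; split; lra.
by rewrite ger0_norm ?subr_ge0 // => /andP[? ?]; right; split; lra.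
Qed.

End Inseparable.

(** * Homeomorphisms preserving the leaves *)

Section LeafIso.
Context {R : realType}.
Implicit Types (r s d : R -> R) (z w : R * R) (a x y t : R).

Definition leaf_iso r1 s1 r2 s2 (h g : R * R -> R * R) :=
  [/\ continuous h, continuous g, cancel h g, cancel g h &
    forall z w, same_leaf r1 s1 z w <-> same_leaf r2 s2 (h z) (h w)].

Definition level_point r s x c : R * R := (x, (c - r x) / s x).

Lemma level_pointK r s x c : s x <> 0 -> linear_like r s (level_point r s x c) = c.
Proof.
by move=> /eqP sx; rewrite /linear_like /= mulrC divfK // addrC subrK.
Qed.

Lemma level_point_linear_like r s z : s z.1 <> 0 ->
  level_point r s z.1 (linear_like r s z) = z.
Proof.
move=> /eqP sz; rewrite [RHS]surjective_pairing; congr (_, _).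
by rewrite /linear_like addrC addKr mulrC mulKf.
Qed.

Lemma leaf_iso_sym r1 s1 r2 s2 h g : leaf_iso r1 s1 r2 s2 h g -> leaf_iso r2 s2 r1 s1 g h.
Proof. by case=> ch cg hK gK L; split => // z w; rewrite L !gK. Qed.

Lemma inseparable_image r1 s1 r2 s2 h g z w : leaf_iso r1 s1 r2 s2 h g ->
  inseparable r1 s1 z w -> inseparable r2 s2 (h z) (h w).
Proof.
move=> [ch _ _ _ L] I U V nU nV.
have [u [v [Uu Vv uv]]] := I _ _ (ch _ _ nU) (ch _ _ nV).
by exists (h u), (h v); split => //; apply/L.
Qed.

Lemma right_adjacent (Z : set R) a : finite_set Z ->
  exists2 x, a < x & forall t, Z t -> a <= t -> t <= x -> t = a.
Proof.
move=> /(finite_isolated a) [dl dl0 H]; exists (a + dl / 2); first lra.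
move=> t Zt at1 tx; apply: H => //; rewrite ger0_norm ?subr_ge0 //; lra.
Qed.

Lemma left_adjacent (Z : set R) a : finite_set Z ->
  exists2 x, x < a & forall t, Z t -> x <= t -> t <= a -> t = a.
Proof.
move=> /(finite_isolated a) [dl dl0 H]; exists (a - dl / 2); first lra.
move=> t Zt at1 tx; apply: H => //; rewrite ler0_norm ?subr_le0 //; lra.
Qed.

Lemma finite_set_max (Z : set R) : finite_set Z -> Z !=set0 ->
  exists2 m, Z m & forall t, Z t -> t <= m.
Proof.
move=> /finite_seqP [l ->] [x]; elim: l x => [//|b l IH] x _.
case: l IH => [_|c l /(_ c)]; first by exists b => [|t] /=; rewrite !inE // => /eqP ->.
case=> [|m ml mm]; first by rewrite /= inE eqxx.
exists (Num.max b m) => [|t]; rewrite /= inE.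
  by case: (lerP b m) => _; rewrite ?eqxx // ml orbT.
by case/predU1P => [->|/mm tm]; rewrite le_max ?lexx // tm orbT.
Qed.

Section Fixed.
Context (r1 s1 d1 r2 s2 d2 : R -> R) (h g : R * R -> R * R).
Context (T1 : tame r1 s1 d1) (T2 : tame r2 s2 d2).
Context (hg : leaf_iso r1 s1 r2 s2 h g).

(* A vertical leaf nu_a is not separated from a leaf on its right and one on
   its left; a leaf in a strip is not separated only from the two bounding
   vertical leaves. If nu_a is mapped into a strip, then its right neighbour is
   mapped to some vertical leaf, and going back, the next vertical leaf on the
   right of nu_a exists and is mapped into a strip too; but there are only
   finitely many. *)
Lemma vertical_to_vertical a y : s1 a = 0 -> s2 (h (a, y)).1 = 0.
Proof.
have [cr1 cs1 fZ1 _] := T1; have [cr2 cs2 fZ2 _] := T2.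
have [ch cg hK gK L] := hg.
have vert r s b y1 y2 : s b = 0 -> same_leaf r s (b, y1) (b, y2).
  by move=> sb; split; [left|rewrite /linear_like /= sb !mul0r].
have vertZ b y1 y2 : s1 b = 0 -> s2 (h (b, y1)).1 = 0 -> (h (b, y2)).1 = (h (b, y1)).1.
  by move=> sb sh; have /L [] := vert r1 s1 b y1 y2 sb; move=> /(same_strip_zero sh).
move=> sa; apply: contrapT => nh.
pose A : set R := [set b | s1 b = 0 /\ s2 (h (b, 0)).1 <> 0].
(* Take the largest zero whose line is not sent to a vertical line; a larger one will be
   produced. *)
have {a y sa nh} [a [sa ha] amax] : exists2 m, A m & forall t, A t -> t <= m.
  apply: finite_set_max; first by apply: sub_finite_set fZ1 => t [].
  by exists a; split => // ?; apply: nh; rewrite (vertZ _ 0).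
have [x ax xZ] := right_adjacent a fZ1.
have sx : s1 x <> 0 by move=> sx; have := xZ x sx (ltW ax) (lexx _); lra.
pose w := level_point r1 s1 x (r1 a).
have I1 : inseparable r1 s1 (a, 0) w.
  apply: (@inseparable_adjacent _ _ _ _ x) => //; first by move=> E; move: ax; rewrite E ltxx.
    move=> t [[? ?]|[? ?]] ta st; last lra.
    by apply: ta; apply: xZ.
  exact: level_pointK.
have N1 : ~ same_leaf r1 s1 (a, 0) w by move=> [/(same_strip_zero sa) /= E _]; lra.
have [sb _ _] : [/\ s2 (h w).1 = 0, linear_like r2 s2 (h (a, 0)) = linear_like r2 s2 (h w) &
    forall t, between (h (a, 0)).1 t (h w).1 -> t <> (h w).1 -> s2 t <> 0].
  apply: (inseparableP T2 (inseparable_image hg I1)) => //.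
  by move=> /L.
set b := (h w).1 in sb.
(* Pull back a neighbour of nu_b. It is inseparable from the leaf of w, hence comes from nu_a or
   from a vertical line to the right of x; the latter would contradict maximality. *)
have back x' : b <> x' -> (forall t, between b t x' -> t <> b -> s2 t <> 0) ->
    let v := g (level_point r2 s2 x' (r2 b)) in
    [/\ s1 v.1 = 0, linear_like r1 s1 w = linear_like r1 s1 v, v.1 = a \/ x < v.1 & x < v.1 -> False].
  move=> bx' H v.
  have sx' : s2 x' <> 0 by apply: H => [|/esym //]; exact: between_r.
  have I2 : inseparable r2 s2 (h w) (level_point r2 s2 x' (r2 b)).
    rewrite [h w]surjective_pairing; apply: (@inseparable_adjacent _ _ _ _ x') => //.
    exact: level_pointK.
  have N2 : ~ same_leaf r1 s1 w v.
    by move=> /L; rewrite /v gK => -[/(same_strip_zero sb) /= E _]; apply: bx'.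
  have I3 : inseparable r1 s1 w v.
    by rewrite -[w](hK w); exact: (inseparable_image (leaf_iso_sym hg)).
  have [sv pv H3] := inseparableP T1 I3 sx N2.
  split => //.
    case: (ltgtP x v.1) => [|vx|vx]; [by right| |by exfalso; apply: sx; rewrite vx].
    left; case: (ltgtP v.1 a) => // va.
      exfalso; apply: (H3 a) => //; last lra.
      by right; split; [exact: ltW|exact: ltW].
    by have := xZ _ sv (ltW va) (ltW vx).
  move=> xv; have : v.1 <= a.
    apply: amax; split => // s0; apply: sx'.
    have := vertZ v.1 0 v.2 sv s0; rewrite -surjective_pairing /v gK /= => ->.
    exact: s0.
  lra.
have [x1 bx1 H1] := right_adjacent b fZ2.
have [x2 bx2 H2] := left_adjacent b fZ2.
have B1 : b <> x1 by move=> E; move: bx1; rewrite E ltxx.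
have B2 : b <> x2 by move=> E; move: bx2; rewrite E ltxx.
have [||_ p1 [q1|q1] n1] := back x1 => //.
  by move=> t [[? ?]|[? ?]] tb st; [apply: tb; apply: H1|lra].
have [||_ p2 [q2|q2] n2] := back x2 => //.
  by move=> t [[? ?]|[? ?]] tb st; [lra|apply: tb; apply: H2].
(* Both neighbours of nu_b come from nu_a, so they would be a single leaf although b separates
   them. *)
have : same_leaf r1 s1 (g (level_point r2 s2 x1 (r2 b))) (g (level_point r2 s2 x2 (r2 b))).
  by split; [left; rewrite q1 q2|rewrite -p1 -p2].
move=> /L; rewrite !gK => -[/= [E|H] _]; first by move: bx1 bx2; rewrite E; lra.
by apply: (H b) => //; right; split; exact: ltW.
Qed.

(** The height 0 is immaterial, by [vimageP]. *)
Definition vimage a := (h (a, 0)).1.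

Lemma vimage_zero a : s1 a = 0 -> s2 (vimage a) = 0.
Proof. exact: vertical_to_vertical. Qed.

Lemma vimageP a z : s1 a = 0 -> (h z).1 = vimage a <-> z.1 = a.
Proof.
have [_ _ _ _ L] := hg; move=> sa; split => za.
  have : same_leaf r2 s2 (h (a, 0)) (h z).
    split; first by left; rewrite za.
    by rewrite /linear_like za vimage_zero // !mul0r.
  by move=> /L [/(same_strip_zero sa)].
have : same_leaf r1 s1 (a, 0) z.
  by split; [left; rewrite za|rewrite /linear_like za sa !mul0r].
by move=> /L [/(same_strip_zero (vimage_zero sa))].
Qed.

Lemma plane_IVT (k : R * R -> R) z w v : continuous k -> k z < v -> v < k w ->
  exists u, k u = v /\ between z.1 u.1 w.1.
Proof.
move=> ck kz kw.
pose c t : R * R := (z.1 + t * (w.1 - z.1), z.2 + t * (w.2 - z.2)).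
have cc : continuous c by rewrite /c; cont.
have c0 : c 0 = z by rewrite /c !mul0r !addr0 -surjective_pairing.
have c1 : c 1 = w by rewrite /c !mul1r ![_ + (_ - _)]addrC !subrK -surjective_pairing.
have [|||t] := @IVT R (k \o c) 0 1 v => //.
- by apply: continuous_subspaceT => t; exact: (continuous_comp (cc t) (ck _)).
- by rewrite /= c0 c1; case: (lerP (k z) (k w)) => *; apply/andP; split; lra.
rewrite in_itv /= => /andP[t0 t1] ktv; exists (c t); split => //=.
case: (lerP z.1 w.1) => zw; [left|right]; split; nra.
Qed.

(** The difference (h z).1 - vimage a vanishes on nu_a only, so it has a constant sign on each side
    of it; both signs occur because h is onto. *)
Lemma vimage_side a : s1 a = 0 ->
  (forall z, (vimage a < (h z).1) = (a < z.1)) \/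
  (forall z, (vimage a < (h z).1) = (z.1 < a)).
Proof.
move=> sa; have [ch _ _ gK _] := hg.
pose k z := (h z).1.
have ck : continuous k by move=> z; exact: (continuous_comp (ch z) cvg_fst).
have nx z w : k z < vimage a -> vimage a < k w -> between z.1 a w.1.
  by move=> h1 h2; have [u [ku ub]] := plane_IVT ck h1 h2; rewrite -((vimageP u sa).1 ku).
have ne z : z.1 <> a -> k z < vimage a \/ vimage a < k z.
  move=> za; apply/orP; rewrite -neq_lt; apply/eqP => E; exact/za/(vimageP z sa).
pose zr : R * R := (a + 1, 0); pose zl : R * R := (a - 1, 0).
pose wp := g (vimage a + 1, 0); pose wm := g (vimage a - 1, 0).
have kp : k wp = vimage a + 1 by rewrite /k /wp gK.
have km : k wm = vimage a - 1 by rewrite /k /wm gK.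
have := nx wm wp; rewrite kp km => /(_ ltac:(lra) ltac:(lra)) wb.
have np : wp.1 <> a by move=> /(vimageP wp sa); rewrite -/(k wp) kp; lra.
have nm : wm.1 <> a by move=> /(vimageP wm sa); rewrite -/(k wm) km; lra.
have {}wb : (wm.1 < a /\ a < wp.1) \/ (wp.1 < a /\ a < wm.1).
  by case: wb => -[h1 h2]; [left|right]; rewrite !lt_neqAle h1 h2 !andbT;
    split; apply/eqP => // /esym.
have eq z : z.1 = a -> k z = vimage a by move=> /(vimageP z sa).
case: wb => -[h1 h2]; [left|right] => z; apply/idP/idP => zz.
- have := nx wm z; rewrite km => /(_ ltac:(lra) zz) [[? ?]|[? ?]]; last lra.
  by rewrite lt_neqAle; apply/andP; split=> //; apply/eqP => /esym /eq; rewrite /k; lra.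
- have [] // : k z < vimage a \/ vimage a < k z by apply: ne => E; lra.
  by move=> kz; have := nx z wp kz; rewrite kp => /(_ ltac:(lra)) [[? ?]|[? ?]]; lra.
- have := nx wm z; rewrite km => /(_ ltac:(lra) zz) [[? ?]|[? ?]]; first lra.
  by rewrite lt_neqAle; apply/andP; split=> //; apply/eqP => /eq; rewrite /k; lra.
- have [] // : k z < vimage a \/ vimage a < k z by apply: ne => E; lra.
  by move=> kz; have := nx z wp kz; rewrite kp => /(_ ltac:(lra)) [[? ?]|[? ?]]; lra.
Qed.

(** If two zeros behaved differently, the preimage of a point to the right of both image lines would
    order them one way, and that of a point to the left of both the other way. *)
Lemma vimage_sides :
  (forall a, s1 a = 0 -> forall z, (vimage a < (h z).1) = (a < z.1)) \/
  (forall a, s1 a = 0 -> forall z, (vimage a < (h z).1) = (z.1 < a)).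
Proof.
have [_ _ _ gK _] := hg.
apply: contrapT => /not_orP [] /existsNP [a /not_implyP [sa Na]]
  /existsNP [a' /not_implyP [sa' Na']].
have [//|Ha] := vimage_side sa; have [Ha'|//] := vimage_side sa'.
pose m := Num.max (vimage a) (vimage a') + 1.
pose n := Num.min (vimage a) (vimage a') - 1.
have := Ha (g (m, 0)); have := Ha' (g (m, 0)); have := Ha (g (n, 0)); have := Ha' (g (n, 0)).
rewrite !gK /= /m /n.
have [E1 E2] : vimage a < m /\ vimage a' < m.
  by rewrite /m; case: (lerP (vimage a) (vimage a')) => *; split; lra.
have [E3 E4] : (vimage a < n) = false /\ (vimage a' < n) = false.
  rewrite /n; case: (lerP (vimage a) (vimage a')) => *; split; apply/negbTE; rewrite -leNgt; lra.
rewrite -/m -/n E1 E2 E3 E4 => /esym/negbT h1 /esym/negbT h2 /esym h3 /esym h4.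
by rewrite -leNgt in h1; rewrite -leNgt in h2; lra.
Qed.

End Fixed.
End LeafIso.

(** * Direction in which levels are carried *)

Section LevelDirection.
Context {R : realType}.
Implicit Types (z w : R * R) (a x y t : R).

Lemma finite_set_min (Z : set R) : finite_set Z -> Z !=set0 ->
  exists2 m, Z m & forall t, Z t -> m <= t.
Proof.
move=> fZ [x Zx]; have [||m [b Zb <-] H] := @finite_set_max R (-%R @` Z).
- exact: finite_image.
- by exists (- x), x.
- by exists b => // t Zt; rewrite -lerN2; apply: H; exists t.
Qed.

(** Nearest in the sense that no other point of Z intervenes: the last one on the left of x if there
    is one, else the least of all. *)
Lemma nearest_point (Z : set R) x : finite_set Z -> Z !=set0 -> ~ Z x ->
  exists2 a, Z a & forall t, between a t x -> t <> a -> ~ Z t.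
Proof.
move=> fZ [b Zb] Zx.
have [[c [Zc cx]]|N] := pselect (exists c, Z c /\ c < x).
  have [||a [Za ax] H] := @finite_set_max R [set t | Z t /\ t < x].
  - by apply: sub_finite_set fZ => t [].
  - by exists c.
  - exists a => // t [[h1 h2]|[h1 h2]] ta Zt; last lra.
    apply: ta; apply/eqP; rewrite eq_le h1 andbT; apply: H; split => //.
    by rewrite lt_neqAle h2 andbT; apply/eqP => E; apply: Zx; rewrite -E.
have [a Za H] := finite_set_min fZ (ex_intro _ b Zb).
exists a => // t tb ta Zt; have := H t Zt => at1; case: tb => -[h1 h2].
  have : t <> x by move=> E; apply: Zx; rewrite -E.
  move=> /eqP tx; apply: N; exists t; split => //.
  by rewrite lt_neqAle tx.
by apply: ta; apply/eqP; rewrite eq_le h2.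
Qed.

Context (r1 s1 d1 r2 s2 d2 : R -> R) (h g : R * R -> R * R).
Context (T1 : tame r1 s1 d1) (T2 : tame r2 s2 d2).
Context (hg : leaf_iso r1 s1 r2 s2 h g).
Context (side : forall a, s1 a = 0 -> forall z, (vimage h a < (h z).1) = (a < z.1)).
Local Notation p1 := (linear_like r1 s1).
Local Notation p2 := (linear_like r2 s2).

Lemma side_left a z : s1 a = 0 -> ((h z).1 < vimage h a) = (z.1 < a).
Proof.
move=> sa; have V := vimageP T1 T2 hg z sa.
rewrite !lt_neqAle ![_ <= _]leNgt side //; congr (~~ _ && _).
by apply/eqP/eqP => /V.
Qed.

Lemma vimage_surj b : s2 b = 0 -> exists2 a, s1 a = 0 & vimage h a = b.
Proof.
move=> sb; exists (g (b, 0)).1; first exact: (vertical_to_vertical T2 T1 (leaf_iso_sym hg)).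
have sa := vertical_to_vertical T2 T1 (leaf_iso_sym hg) 0 sb.
have [_ _ _ gK _] := hg.
by have := (vimageP T1 T2 hg (g (b, 0)) sa).2 erefl; rewrite gK.
Qed.

Lemma image_nonzero z : s1 z.1 <> 0 -> s2 (h z).1 <> 0.
Proof.
move=> sz s0; have [a sa /esym /(vimageP T1 T2 hg _ sa) E] := vimage_surj s0.
by apply: sz; rewrite E.
Qed.

Lemma image_same_strip z w : same_strip s1 z.1 w.1 -> s1 z.1 <> 0 ->
  same_strip s2 (h z).1 (h w).1.
Proof.
move=> zw sz; right => b bb sb; have [a sa ab] := vimage_surj sb.
have sw : s1 w.1 <> 0 by move=> sw; apply: sz; rewrite (same_strip_zero sw (same_strip_sym zw)).
have za : a <> z.1 by move=> E; apply: sz; rewrite -E.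
have wa : a <> w.1 by move=> E; apply: sw; rewrite -E.
have leL v : ((h v).1 <= vimage h a) = (v.1 <= a) by rewrite !leNgt side.
have leR v : (vimage h a <= (h v).1) = (a <= v.1) by rewrite !leNgt side_left.
have azw : between z.1 a w.1 by move: bb; rewrite -ab /between !leL !leR.
case: zw azw => [<-|H] azw; first by apply: za; exact: between_xx.
exact: (H a).
Qed.

Lemma image_level z w : same_strip s1 z.1 w.1 -> s1 z.1 <> 0 ->
  p1 z = p1 w <-> p2 (h z) = p2 (h w).
Proof.
have [_ _ _ _ L] := hg; move=> zw sz; split => E.
  by have /L [] : same_leaf r1 s1 z w by split.
by have /L [] : same_leaf r2 s2 (h z) (h w) by split => //; exact: image_same_strip.
Qed.

Definition level_incr x := forall z w, same_strip s1 x z.1 -> same_strip s1 x w.1 ->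
  p1 z < p1 w -> p2 (h z) < p2 (h w).
Definition level_decr x := forall z w, same_strip s1 x z.1 -> same_strip s1 x w.1 ->
  p1 z < p1 w -> p2 (h w) < p2 (h z).

Lemma p2h_continuous : continuous (p2 \o h).
Proof.
have [ch _ _ _ _] := hg; have [cr cs _ _] := T2.
by move=> z; apply: (@comp2_continuous_at _ _ z h); [exact: ch|exact: linear_like_continuous].
Qed.

Lemma level_point_continuous r s x : continuous (level_point r s x).
Proof. by rewrite /level_point; cont. Qed.

(** In one strip p2 o h is an injective continuous function of the level of p1, hence strictly
    monotone in it. *)
Lemma level_incr_or_decr x : s1 x <> 0 -> level_incr x \/ level_decr x.
Proof.
move=> sx; have [ch _ _ _ _] := hg.
pose f c := p2 (h (level_point r1 s1 x c)).
have cf : continuous f.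
  move=> c; apply: (continuous_comp (f := level_point r1 s1 x) (g := p2 \o h)).
    exact: level_point_continuous.
  exact: p2h_continuous.
have fE z : same_strip s1 x z.1 -> p2 (h z) = f (p1 z).
  move=> xz; apply/esym/image_level => //=.
  exact: level_pointK.
have fi : injective f.
  move=> c c' /image_level E; have := E (same_strip_refl _ _) sx.
  by rewrite !level_pointK.
have := @itv_continuous_inj_mono R f `]-oo, +oo[.
case.
- by apply: continuous_subspaceT.
- by move=> ? ? _ _; exact: fi.
- by move=> fm; left => z w xz xw zw; rewrite !fE //; apply: fm.
- by move=> fm; right => z w xz xw zw; rewrite !fE //; apply: fm.
Qed.

Lemma level_incr_strip x y : same_strip s1 x y -> level_incr x -> level_incr y.
Proof.
by move=> xy I z w yz yw; apply: I; [exact: same_strip_trans yz|exact: same_strip_trans yw].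
Qed.

(** The neighbour of nu_a at level r1 a is inseparable from nu_a, so its image has the level of the
    image of nu_a. *)
Lemma adjacent_level a x : s1 a = 0 -> a <> x ->
  (forall t, between a t x -> t <> a -> s1 t <> 0) ->
  p2 (h (level_point r1 s1 x (r1 a))) = r2 (vimage h a).
Proof.
move=> sa ax H; have [cr1 cs1 _ _] := T1; have [cr2 cs2 _ _] := T2.
have sx : s1 x <> 0 by apply: H => [|/esym //]; exact: between_r.
have I : inseparable r1 s1 (a, 0) (level_point r1 s1 x (r1 a)).
  by apply: (@inseparable_adjacent _ _ _ _ x) => //; exact: level_pointK.
rewrite -(inseparable_level cr2 cs2 (inseparable_image hg I)).
by rewrite /linear_like -/(vimage h a) (vimage_zero T1 T2 hg sa) mul0r addr0.
Qed.

(** Over x near a, compare (x, 0) with the point w at level r1 a. By [tame_level_sign], the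
    difference of their levels has the sign of d1 a * (x - a). The image of (x, 0) is close to the
    image line while that of w has exactly its level, so the difference after h has the sign of d2
    times the displacement of the abscissa; by [side] this displacement has the sign of x - a. *)
Lemma level_direction_near a : s1 a = 0 -> \forall x \near a, x <> a ->
  [/\ s1 x <> 0, level_incr x -> d1 a = d2 (vimage h a) &
    level_decr x -> d1 a = - d2 (vimage h a)].
Proof.
move=> sa; have [ch _ _ _ _] := hg; have [cr1 cs1 fZ1 D1] := T1; have [_ _ _ D2] := T2.
have sb := vimage_zero T1 T2 hg sa.
have [da _] := D1 a sa; have [db _] := D2 _ sb.
have [dl1 dl10 H1] := tame_level_sign 0 T1 sa.
have [dl2 dl20 H2] := tame_level_sign (`|(h (a, 0)).2| + 1) T2 sb.
have cz : continuous (fun t : R => (t, 0) : R * R) by cont.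
have ch1 : continuous (fun t : R => (h (t, 0)).1).
  move=> t; apply: fst_continuous_at; exact: (continuous_comp (cz t) (ch _)).
have ch2 : continuous (fun t : R => (h (t, 0)).2).
  move=> t; apply: snd_continuous_at; exact: (continuous_comp (cz t) (ch _)).
have /cvgrPdist_lt /(_ _ dl20) n1 := ch1 a.
have /cvgrPdist_lt /(_ _ ltr01) n2 := ch2 a.
have n3 := near_between_all (finite_near a fZ1).
have n4 : \forall t \near a, `|a - t| < dl1 by apply/nbhs_ballP; exists dl1.
near=> x => xa.
have zx t : between a t x -> t <> a -> s1 t <> 0.
  by move=> tb ta st; apply: ta; move: t tb st; near: x.
have sx : s1 x <> 0 by apply: zx => //; exact: between_r.
have k1 : 0 < d1 a * (p1 (x, 0) - r1 a) * (x - a).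
  by apply: (H1 (x, 0)) => //=; rewrite ?normr0 // distrC; near: x.
have k2 : 0 < d2 (vimage h a) * (p2 (h (x, 0)) - r2 (vimage h a)) * ((h (x, 0)).1 - vimage h a).
  apply: H2.
  - by move=> /(vimageP T1 T2 hg _ sa).
  - by rewrite distrC /vimage; near: x.
  - have : `|(h (a, 0)).2 - (h (x, 0)).2| < 1 by near: x.
    move=> /ltW K; rewrite -lerBlDl (le_trans _ K) // distrC.
    exact: lerB_dist.
have k3 : 0 < ((h (x, 0)).1 - vimage h a) * (x - a).
  move: xa => /eqP; rewrite neq_lt => /orP [xa|xa].
    by rewrite nmulr_rgt0 subr_lt0 ?side_left.
  by rewrite pmulr_rgt0 subr_gt0 ?side.
have E := adjacent_level sa (nesym xa) zx.
set w := level_point r1 s1 x (r1 a) in E.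
have wE : p1 w = r1 a by exact: level_pointK.
rewrite -wE in k1; rewrite -E in k2.
set A := p1 (x, 0) - p1 w in k1; set B := p2 (h (x, 0)) - p2 (h w) in k2.
have k4 : 0 < (d1 a * A) * (d2 (vimage h a) * B).
  have : 0 < (d1 a * A * (x - a)) * (d2 (vimage h a) * B * ((h (x, 0)).1 - vimage h a)) by exact: mulr_gt0.
  rewrite (_ : _ * _ = ((d1 a * A) * (d2 (vimage h a) * B)) * (((h (x, 0)).1 - vimage h a) * (x - a))).
    by rewrite pmulr_lgt0.
  by ring.
have sxx : same_strip s1 x (x, 0 : R).1 by left.
have sxw : same_strip s1 x w.1 by left.
split => // M.
- have AB : 0 < A * B.
    have [AA|AA] := ltP (p1 (x, 0)) (p1 w).
      have := M _ _ sxx sxw AA; rewrite /A /B; nra.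
    have {}AA : p1 w < p1 (x, 0).
      rewrite lt_neqAle AA andbT; apply/eqP => AA'.
      by move: k1; rewrite /A AA' subrr mulr0 mul0r ltxx.
    have := M _ _ sxw sxx AA; rewrite /A /B; nra.
  by case: da db k4 => -> [] -> k4 //; exfalso; nra.
- have AB : A * B < 0.
    have [AA|AA] := ltP (p1 (x, 0)) (p1 w).
      have := M _ _ sxx sxw AA; rewrite /A /B; nra.
    have {}AA : p1 w < p1 (x, 0).
      rewrite lt_neqAle AA andbT; apply/eqP => AA'.
      by move: k1; rewrite /A AA' subrr mulr0 mul0r ltxx.
    have := M _ _ sxw sxx AA; rewrite /A /B; nra.
  by case: da db k4 => -> [] -> k4; rewrite ?opprK //; exfalso; nra.
Unshelve. all: by end_near. Qed.

(* Whether p2 o h increases with p1 near the line x = const is locally constant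
   in x: at a zero a of s1 it is read off the signs d1 a and d2 (vimage h a). *)
Lemma level_incr_everywhere x0 : s1 x0 <> 0 -> ~ level_decr x0 ->
  (forall x, s1 x <> 0 -> level_incr x) /\
  (forall a, s1 a = 0 -> d1 a = d2 (vimage h a)).
Proof.
move=> sx0 nd.
pose P x := (s1 x <> 0 /\ level_incr x) \/ (s1 x = 0 /\ d1 x = d2 (vimage h x)).
have [_ _ fZ1 D1] := T1.
have Ploc x : \forall y \near x, P y <-> P x.
  have [sx|/eqP sx] := eqVneq (s1 x) 0; last first.
    apply: filterS (near_same_strip fZ1 sx) => y xy.
    have sy : s1 y <> 0 by move=> sy; apply: sx; rewrite (same_strip_zero sy (same_strip_sym xy)).
    split => -[[_ I]|[]] //; left; split=> //; apply: level_incr_strip I => //.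
    exact: same_strip_sym.
  apply: filterS (level_direction_near sx) => y H.
  have [->//|/eqP yx] := eqVneq y x; have [sy h1 h2] := H yx.
  split => [[[_ /h1 I]|[]] //|[[//]|[_ E]]]; first by right.
  left; split => //; have [//|/h2 E'] := level_incr_or_decr sy.
  have [da _] := D1 x sx; exfalso.
  by case: da => da; move: E E'; rewrite da => <- ?; lra.
have P0 : P x0 by left; split => //; have [//|] := level_incr_or_decr sx0.
split => [x sx|a sa]; first by have [[]|[]] := locally_constant Ploc x P0.
by have [[]|[]] := locally_constant Ploc a P0.
Qed.

End LevelDirection.

(** * Excluding decreasing levels; monotonicity along a leaf *)

Section Orientation.
Context {R : realType}.
Implicit Types (z w : R * R) (a x y t : R).
Context (r1 s1 d1 r2 s2 d2 : R -> R) (h g : R * R -> R * R).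
Context (T1 : tame r1 s1 d1) (T2 : tame r2 s2 d2).
Context (hg : leaf_iso r1 s1 r2 s2 h g).
Context (side : forall a, s1 a = 0 -> forall z, (vimage h a < (h z).1) = (a < z.1)).
Local Notation p1 := (linear_like r1 s1).
Local Notation p2 := (linear_like r2 s2).

(** Take for v the first zero after a at which r1 changes value, and for u the last zero before v;
    by minimality of v, r1 u = r1 a. *)
Lemma consecutive_zeros a b : s1 a = 0 -> s1 b = 0 -> r1 a <> r1 b ->
  exists u v, [/\ s1 u = 0, s1 v = 0, u < v, r1 u <> r1 v &
    forall t, u < t -> t < v -> s1 t <> 0].
Proof.
have [_ _ fZ1 _] := T1.
wlog ab : a b / a < b.
  move=> W sa sb rab; have [ab|ba|ab] := ltgtP a b.
  - exact: (W a b).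
  - by apply: (W b a) => // /esym.
  - by exfalso; apply: rab; rewrite ab.
move=> sa sb rab.
have [||v [sv av rv] vm] := @finite_set_min R [set t | [/\ s1 t = 0, a < t & r1 t <> r1 a]].
- by apply: sub_finite_set fZ1 => t [].
- by exists b; split => // /esym.
have [||u [su uv] um] := @finite_set_max R [set t | s1 t = 0 /\ t < v].
- by apply: sub_finite_set fZ1 => t [].
- by exists a.
exists u, v; split => //.
  have au : a <= u by exact: um.
  have -> : r1 u = r1 a; last by apply/nesym.
  apply: contrapT => ru.
  have ua : a < u by rewrite lt_neqAle au andbT; apply/eqP => E; apply: ru; rewrite E.
  by have := vm u (And3 su ua ru); lra.
by move=> t ut tv st; have := um t (conj st tv); lra.
Qed.

(** Over a point x between consecutive zeros u and v pass a neighbour of nu_u and one of nu_v. Their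
    levels r1 u and r1 v are sent to their images under sigma, in the same order. *)
Lemma not_level_decr_values (sigma : R -> R) a b :
  (forall a, s1 a = 0 -> sigma (r1 a) = r2 (vimage h a)) ->
  (forall a b, s1 a = 0 -> s1 b = 0 -> r1 a < r1 b -> sigma (r1 a) < sigma (r1 b)) ->
  s1 a = 0 -> s1 b = 0 -> r1 a <> r1 b ->
  exists x, s1 x <> 0 /\ ~ level_decr r1 s1 r2 s2 h x.
Proof.
move=> sE sI sa sb rab.
have [u [v [su sv uv ruv H]]] := consecutive_zeros sa sb rab.
pose x := (u + v) / 2; have [ux xv] : u < x /\ x < v by rewrite /x; split; lra.
have sx : s1 x <> 0 by apply: H.
have Eu : p2 (h (level_point r1 s1 x (r1 u))) = sigma (r1 u).
  rewrite sE //; apply: (adjacent_level T1 T2 hg) => //; first by move=> E; lra.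
  move=> t [[? ?]|[? ?]] tu; last lra.
  by apply: H; last lra; rewrite lt_neqAle; apply/andP; split=> //; apply/eqP => /esym.
have Ev : p2 (h (level_point r1 s1 x (r1 v))) = sigma (r1 v).
  rewrite sE //; apply: (adjacent_level T1 T2 hg) => //; first by move=> E; lra.
  move=> t [[? ?]|[? ?]] tv; first lra.
  by apply: H; first lra; rewrite lt_neqAle; apply/andP; split=> //; apply/eqP.
exists x; split => // D.
have X c : same_strip s1 x (level_point r1 s1 x c).1 by left.
have := D _ _ (X (r1 u)) (X (r1 v)); have := D _ _ (X (r1 v)) (X (r1 u)).
rewrite !level_pointK // Eu Ev.
move: ruv => /eqP; rewrite neq_lt => /orP [L|L] h1 h2.
  by have := h2 L; have := sI _ _ su sv L; lra.
by have := h1 L; have := sI _ _ sv su L; lra.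
Qed.

(** When all vertical lines have one level, z is compared with the neighbour, in its strip, of the
    nearest one. *)
Lemma not_level_decr_point a z : s1 a = 0 -> s1 z.1 <> 0 -> p1 z <> r1 a ->
  (forall b, s1 b = 0 -> r1 b = r1 a) ->
  (forall b, s1 b = 0 -> (p1 z < r1 a -> p2 (h z) < r2 (vimage h b)) /\
    (r1 a < p1 z -> r2 (vimage h b) < p2 (h z))) ->
  ~ level_decr r1 s1 r2 s2 h z.1.
Proof.
move=> sa sz za ra H D; have [_ _ fZ1 _] := T1.
have [b sb bz] := nearest_point fZ1 (ex_intro _ a sa) sz.
have E := adjacent_level T1 T2 hg sb (x := z.1) _ bz.
have {}E : p2 (h (level_point r1 s1 z.1 (r1 b))) = r2 (vimage h b).
  by apply: E => bz1; apply: sz; rewrite -bz1.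
have X c : same_strip s1 z.1 (level_point r1 s1 z.1 c).1 by left.
have := D _ _ (X (r1 b)) (same_strip_refl _ _); have := D _ _ (same_strip_refl _ _) (X (r1 b)).
rewrite level_pointK // E (ra b sb) => h1 h2.
have [k1 k2] := H b sb.
move: za => /eqP; rewrite neq_lt => /orP [L|L].
  by have := h1 L; have := k1 L; lra.
by have := h2 L; have := k2 L; lra.
Qed.

(** Along a leaf inside a strip, the abscissa of the image is an injective function of the abscissa,
    the image leaf being a graph. It is therefore monotone, and the single point u decides its
    sense. *)
Lemma leaf_monotone z u w : s1 z.1 <> 0 -> same_leaf r1 s1 z u -> same_leaf r1 s1 z w ->
  0 < (u.1 - z.1) * ((h u).1 - (h z).1) -> w.1 <> z.1 ->
  0 < (w.1 - z.1) * ((h w).1 - (h z).1).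
Proof.
move=> sz zu zw hu wz; have [ch _ _ _ L] := hg; have [cr cs _ _] := T1.
pose lo := Num.min z.1 (Num.min u.1 w.1); pose hi := Num.max z.1 (Num.max u.1 w.1).
have strip x : lo <= x <= hi -> same_strip s1 z.1 x.
  have inI v : same_strip s1 z.1 v -> forall t, between z.1 t v -> s1 t <> 0.
    by case=> [<- t /between_xx ->|].
  have minI p q : same_strip s1 z.1 p -> same_strip s1 z.1 q -> same_strip s1 z.1 (Num.min p q).
    by case: (lerP p q).
  have maxI p q : same_strip s1 z.1 p -> same_strip s1 z.1 q -> same_strip s1 z.1 (Num.max p q).
    by case: (lerP p q).
  move=> xI; right.
  have [[zu' _] [zw' _]] := (zu, zw).
  apply: (is_interval_strip _ _ xI); apply: inI.
    by apply: (minI); [left|exact: minI].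
  by apply: (maxI); [left|exact: maxI].
have sI x : lo <= x <= hi -> s1 x <> 0.
  by move=> /strip xz sx; apply: sz; rewrite (same_strip_zero sx (same_strip_sym xz)).
pose c := p1 z.
pose f x := (h (level_point r1 s1 x c)).1.
have cf : {within [set` `[lo, hi]], continuous f}.
  apply: continuous_in_subspaceT => x; rewrite inE /= in_itv /= => xI.
  have c1 := cr x; have c2 := cs x.
  have c3 : {for x, continuous (fun x => level_point r1 s1 x c)}.
    by rewrite /level_point; cont; apply/eqP/sI.
  by apply: fst_continuous_at; exact: (continuous_comp c3 (ch _)).
have fi : {in `[lo, hi] &, injective f}.
  move=> x y; rewrite !in_itv /= => xI yI fxy.
  have : same_leaf r1 s1 (level_point r1 s1 x c) (level_point r1 s1 y c).
    split; first exact: same_strip_trans (same_strip_sym (strip _ xI)) (strip _ yI).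
    by rewrite !level_pointK //; exact: sI.
  move=> xy; have E : h (level_point r1 s1 x c) = h (level_point r1 s1 y c).
    have /L [_ E2] := xy.
    have sx : s2 (h (level_point r1 s1 x c)).1 <> 0.
      by apply: (image_nonzero T1 T2 hg); exact: sI.
    have sy : s2 (h (level_point r1 s1 y c)).1 <> 0.
      by apply: (image_nonzero T1 T2 hg); exact: sI.
    rewrite -[LHS](level_point_linear_like r2 sx).
    rewrite -[RHS](level_point_linear_like r2 sy).
    by rewrite E2 -/(f x) -/(f y) fxy.
  by have [_ _ hK _ _] := hg; have /(can_inj hK) [] := E.
have vE v : same_leaf r1 s1 z v -> level_point r1 s1 v.1 c = v.
  move=> [zv zE]; rewrite /c zE level_point_linear_like // => sv.
  by apply: sz; rewrite (same_strip_zero sv (same_strip_sym zv)).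
have [zI [uI wI]] : z.1 \in `[lo, hi] /\ u.1 \in `[lo, hi] /\ w.1 \in `[lo, hi].
  rewrite !in_itv /= /lo /hi !ge_min !le_max !lexx ?orbT; split=> //.
have fz : f z.1 = (h z).1 by rewrite /f vE //; exact: same_leaf_refl.
have fu : f u.1 = (h u).1 by rewrite /f vE.
have fw : f w.1 = (h w).1 by rewrite /f vE.
have [fm|fm] := itv_continuous_inj_mono cf fi.
  have [K|K] : w.1 < z.1 \/ z.1 < w.1 by apply/orP; rewrite -neq_lt; apply/eqP.
    by have := fm _ _ wI zI K; rewrite fz fw; nra.
  by have := fm _ _ zI wI K; rewrite fz fw; nra.
exfalso; have [K|K|K] := ltgtP u.1 z.1.
- by have := fm _ _ zI uI K; rewrite fz fu; nra.
- by have := fm _ _ uI zI K; rewrite fz fu; nra.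
- by move: hu; rewrite K subrr mul0r ltxx.
Qed.

(** The cosine of theta t + 2 pi t stays positive, so this sum cannot grow by pi; winding number 1
    would make it grow by 4 pi. *)
Lemma winding_reflection (K rho : R) : K < 0 -> 0 < rho ->
  ~ winding (fun t : R => (rho * cos (2 * pi * t), K * (rho * sin (2 * pi * t)))) (0, 0) 1.
Proof.
move=> K0 rho0 [theta [ct pt wt]].
pose f t := theta t + 2 * pi * t.
have pos t : t \in `[0, 1] -> 0 < cos (f t).
  move=> /pt [q q0 [E1 E2]]; rewrite cosD.
  have cs := cos2Dsin2 (2 * pi * t).
  rewrite -(pmulr_rgt0 _ q0) mulrBr !mulrA; rewrite !add0r in E1 E2; rewrite -E1 -E2.
  have -> : rho * cos (2 * pi * t) * cos (2 * pi * t) - K * (rho * sin (2 * pi * t)) * sin (2 * pi * t)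
    = rho * (cos (2 * pi * t) ^+ 2 + (- K) * sin (2 * pi * t) ^+ 2) by ring.
  rewrite mulr_gt0 //; set C := cos _ in cs *; set S := sin _ in cs *.
  have [C0|C0] := eqVneq C 0; first by move: cs; rewrite C0; nra.
  have : 0 < C ^+ 2 by rewrite exprn_even_gt0.
  nra.
have p0 := pi_gt0 R.
have f1 : f 1 = f 0 + 4 * pi.
  rewrite /f mulr0 mulr1 addr0; move: wt; rewrite /=; lra.
have cf : {within `[0, 1], continuous f}.
  have cl : continuous (fun t : R => 2 * pi * t) by cont.
  move=> t; apply: cvgD; first exact: ct.
  exact: (continuous_subspaceT cl).
have [|||t] := @IVT R f 0 1 (f 0 + pi) => //.
  by rewrite f1; case: (lerP (f 0) (f 0 + 4 * pi)) => *; apply/andP; split; lra.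
move=> t01 ft; have := pos t t01; rewrite ft cosDpi.
have : 0 < cos (f 0) by apply: pos; rewrite in_itv /= lexx ler01.
lra.
Qed.

End Orientation.

(** * Signs of s1 and s2 on corresponding strips *)

Section SignImage.
Context {R : realType}.
Implicit Types (z w : R * R) (a x y t : R).

Lemma same_strip_sign (s : R -> R) x y : continuous s -> s x <> 0 -> same_strip s x y ->
  0 < s x * s y.
Proof.
move=> cs sx xy; have sy : s y <> 0.
  by move=> sy; apply: sx; rewrite (same_strip_zero sy (same_strip_sym xy)).
case: xy => [<-|H]; first by rewrite -expr2 exprn_even_gt0 //; exact/eqP.
rewrite lt_neqAle eq_sym mulf_neq0 ?andTb; try exact/eqP.
rewrite leNgt; apply/negP => sxy.
wlog xy : x y sx sy H sxy / x <= y.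
  move=> W; have [xy|/ltW xy] := lerP x y; first exact: (W x y).
  by apply: (W y x) => //; [move=> t /between_sym; exact: H|rewrite mulrC].
have [|||t] := @IVT R s x y 0 => //.
- by apply: continuous_subspaceT.
- by case: (lerP (s x) (s y)) => *; apply/andP; split; nra.
by rewrite in_itv /= => /andP[? ?]; apply: H; left.
Qed.

Context (r1 s1 d1 r2 s2 d2 : R -> R) (h g : R * R -> R * R).
Context (T1 : tame r1 s1 d1) (T2 : tame r2 s2 d2).
Context (hg : leaf_iso r1 s1 r2 s2 h g).
Context (side : forall a, s1 a = 0 -> forall z, (vimage h a < (h z).1) = (a < z.1)).
Local Notation p1 := (linear_like r1 s1).
Local Notation p2 := (linear_like r2 s2).

(* The half of the leaf of z lying close to nu_a is mapped close to the image
   of nu_a, which fixes the direction in which h runs along that leaf. *)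
Lemma monotone_leaf_exists a x : s1 a = 0 -> a <> x ->
  (forall t, between a t x -> t <> a -> s1 t <> 0) ->
  exists z u, [/\ z.1 = x, same_leaf r1 s1 z u & 0 < (u.1 - z.1) * ((h u).1 - (h z).1)].
Proof.
move=> sa ax H; have [ch _ _ _ _] := hg; have [cr cs _ _] := T1.
have sx : s1 x <> 0 by apply: H => [|/esym//]; exact: between_r.
(* The point (t, 0) has level r1 t, and [vt t] is the point over x at that level. At t = a the image
   of the former is on the image line and that of the latter is on the expected side of it, so this
   persists for t near a. *)
pose ut t : R * R := (t, 0); pose vt t := level_point r1 s1 x (r1 t).
have cu : continuous (fun t => (h (ut t)).1).
  move=> t; have c1 : {for t, continuous ut} by rewrite /ut; cont.
  by apply: fst_continuous_at; exact: (continuous_comp c1 (ch _)).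
have cv : continuous (fun t => (h (vt t)).1).
  move=> t; have c0 := cr t; have c1 : {for t, continuous vt} by rewrite /vt /level_point; cont.
  by apply: fst_continuous_at; exact: (continuous_comp c1 (ch _)).
have c : continuous (fun t => ((h (ut t)).1 - (h (vt t)).1) * (a - x)).
  by move=> t; have c1 := cu t; have c2 := cv t; cont.
have pos : 0 < ((h (ut a)).1 - (h (vt a)).1) * (a - x).
  rewrite -/(vimage h a); move: ax => /eqP; rewrite neq_lt => /orP [ax|ax].
    by rewrite nmulr_lgt0 ?subr_lt0 // side.
  by rewrite pmulr_lgt0 ?subr_gt0 // (side_left T1 T2 hg side).
have /cvgrPdist_lt /(_ _ pos) n := c a.
have [t [Pt ta tb]] := near_between ax n.
exists (vt t), (ut t); split => //.
  split; last by rewrite level_pointK // /linear_like /= mulr0 addr0.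
  apply: same_strip_sym; right => q qb; apply: H.
    by move: tb qb; rewrite /ut /vt /between /= => -[[? ?]|[? ?]] [[? ?]|[? ?]];
      first [by left; split; lra|by right; split; lra].
  move=> qa; apply: ta; move: tb qb; rewrite qa /ut /vt /between /= => tb qb.
  apply/eqP; rewrite eq_le; move: ax => /eqP; rewrite neq_lt => /orP [?|?];
  by case: tb qb => -[? ?] [[? ?]|[? ?]]; apply/andP; split; lra.
rewrite /= in Pt *; move: Pt; rewrite ltr_norml => /andP[_ Pt].
have {}Pt : 0 < ((h (ut t)).1 - (h (vt t)).1) * (a - x) by lra.
have tx : 0 < (t - x) * (a - x).
  have tx : t <> x.
    move=> tx; move: Pt; rewrite /ut /vt tx.
    have -> : level_point r1 s1 x (r1 x) = (x, 0) by rewrite /level_point subrr mul0r.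
    by rewrite subrr mul0r ltxx.
  move: ax tx => /eqP; rewrite neq_lt => /orP [?|?] /eqP; rewrite neq_lt => /orP [?|?]; case: tb => -[? ?]; nra.
have a2 : 0 < (a - x) ^+ 2 by rewrite exprn_even_gt0 //= subr_eq0; exact/eqP.
rewrite -(pmulr_lgt0 _ a2) /ut /vt /=.
set A := _ - (h _).1 in Pt *.
have -> : (t - x) * A * (a - x) ^+ 2 = ((t - x) * (a - x)) * (A * (a - x)) by ring.
exact: mulr_gt0.
Qed.

(* In the coordinates (x, p1) and (x, p2) the map h is increasing in both
   directions around a suitable point, so if the signs of s1 and s2 differed the
   image of a small circle would be homotopic to a reflected circle. *)
Lemma sign_image z : (forall z rho, 0 < rho -> winding (h \o circle z rho) (h z) 1) ->
  (exists a, s1 a = 0) -> (forall x, s1 x <> 0 -> level_incr r1 s1 r2 s2 h x) ->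
  s1 z.1 <> 0 -> 0 < s1 z.1 * s2 (h z).1.
Proof.
move=> W Z1 LI; have [ch _ _ _ _] := hg; have [cr cs fZ1 _] := T1; have [cr2 cs2 _ _] := T2.
set x := z.1; move=> sx.
have [a sa ax] := nearest_point fZ1 Z1 sx.
have [z0 [u [z0x zu hu]]] : exists z u,
    [/\ z.1 = x, same_leaf r1 s1 z u & 0 < (u.1 - z.1) * ((h u).1 - (h z).1)].
  by apply: (monotone_leaf_exists sa) => // E; apply: sx; rewrite -E.
have sz0 : s1 z0.1 <> 0 by rewrite z0x.
have S0 := image_nonzero T1 T2 hg sz0.
(* The points z0 and z lie over the same x, so their images lie in one strip. *)
suff K0 : 0 < s1 x * s2 (h z0).1.
  have : same_strip s2 (h z0).1 (h z).1.
    by apply: (image_same_strip T1 T2 hg side) => //; left.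
  by move=> /(same_strip_sign cs2 S0) => ?; nra.
set S2 := s2 (h z0).1 in S0 *; set S1 := s1 x in sx *.
rewrite lt_neqAle eq_sym mulf_neq0 ?andTb; try exact/eqP.
rewrite leNgt; apply/negP => Sneg.
have /nbhs_ballP [e /= e0 He] := near_same_strip fZ1 sx.
pose rho := e / 2; have rho0 : 0 < rho by rewrite /rho; lra.
pose pt : R -> R * R := circle z0 rho.
have ptS t : same_strip s1 x (pt t).1.
  apply: He; rewrite /ball /= z0x opprD addNKr normrN normrM gtr0_norm //.
  by have := cos_max (2 * pi * t); have := normr_ge0 (cos (2 * pi * t)); rewrite /rho; nra.
have ptE t : ((pt t).1 - x) ^+ 2 + ((pt t).2 - z0.2) ^+ 2 = rho ^+ 2.
  rewrite /pt /circle /= z0x ![_ + _ - _]addrC !addKr !exprMn -mulrDr cos2Dsin2 mulr1 //.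
have loop : pt 0 = pt 1 by exact: circle_loop.
have cpt : continuous pt.
  move=> t; have cl : {for t, continuous (fun t : R => 2 * pi * t)} by cont.
  have cc := comp_continuous_at cl (@continuous_cos R).
  have cs' := comp_continuous_at cl (@continuous_sin R).
  have c2 : {for t, continuous (fun t : R => (rho * cos (2 * pi * t), rho * sin (2 * pi * t)) : R * R)} by cont.
  apply: (@cvgD _ _ _ _ _ (fun=> z0)); [exact: cvg_cst|exact: c2].
have chp : continuous (h \o pt) by move=> t; exact: (continuous_comp (cpt t) (ch _)).
have cp1 : continuous (fun t => p1 (pt t)).
  by move=> t; apply: (@comp2_continuous_at _ _ t pt); [exact: cpt|exact: linear_like_continuous].
have cp2 : continuous (fun t => p2 (h (pt t))).
  by move=> t; apply: (@comp2_continuous_at _ _ t (h \o pt)); [exact: chp|exact: linear_like_continuous].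
(* From [h \o pt] to c3, consecutive loops are never opposite about their centres. The weight S2
   makes vertical displacements in the source and target of the first comparison differ by S2 ^+ 2;
   the last loop is a circle reflected when S1 * S2 < 0. *)
pose c1 t : R * R := ((h (pt t)).1, S2 * p2 (h (pt t))).
pose c2 t : R * R := ((pt t).1, S2 * p1 (pt t)).
pose c3 t : R * R := (rho * cos (2 * pi * t), (S1 * S2) * (rho * sin (2 * pi * t))).
have cc1 : continuous c1.
  move=> t; have k1 := cp2 t; have k2 : {for t, continuous (fun t => h (pt t))} := chp t.
  by rewrite /c1; cont.
have cc2 : continuous c2.
  by move=> t; have k1 := cp1 t; have k2 := cpt t; rewrite /c2; cont.
have cc3 : continuous c3.
  move=> t; have cl : {for t, continuous (fun t : R => 2 * pi * t)} by cont.
  have cc := comp_continuous_at cl (@continuous_cos R).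
  have cs' := comp_continuous_at cl (@continuous_sin R).
  by rewrite /c3; cont.
have l1 : c1 0 = c1 1 by rewrite /c1 loop.
have l2 : c2 0 = c2 1 by rewrite /c2 loop.
have l3 : c3 0 = c3 1 by rewrite /c3 mulr0 mulr1 sin0 cos0 [2 * pi]mulr_natl cos2pi sin2pi.
have S20 : 0 < S2 ^+ 2 by rewrite exprn_even_gt0 //; exact/eqP.
have S10 : 0 < S1 ^+ 2 by rewrite exprn_even_gt0 //; exact/eqP.
have hne t : h (pt t) <> h z0.
  have [_ _ hK _ _] := hg; move=> /(can_inj hK) E; have := ptE t; rewrite E z0x !subrr.
  by have := exprn_gt0 2 rho0; lra.
have n1 t : not_opposite ((h (pt t)) - h z0) (c1 t - ((h z0).1, S2 * p2 (h z0))).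
  rewrite /not_opposite /crossp /dotp /= => cr0.
  set dX := (h (pt t)).1 - (h z0).1 in cr0 *; set dY := (h (pt t)).2 - (h z0).2 in cr0 *.
  set dP := S2 * _ - _ in cr0 *.
  have [dX0|dX0] := eqVneq dX 0.
    have dPE : dP = S2 ^+ 2 * dY.
      have E : (h (pt t)).1 = (h z0).1 by apply/eqP; rewrite -subr_eq0 -/dX dX0.
      by rewrite /dP /linear_like E -/S2 /dY; ring.
    have dY0 : dY != 0.
      apply/eqP => dY0; apply: (hne t); rewrite [LHS]surjective_pairing [RHS]surjective_pairing.
      by congr (_, _); apply/eqP; rewrite -subr_eq0; apply/eqP.
    have : 0 < dY ^+ 2 by rewrite exprn_even_gt0.
    by rewrite dX0 dPE; nra.
  have : 0 < dX ^+ 2 by rewrite exprn_even_gt0.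
  have -> : dP = dY by apply: (mulfI dX0); lra.
  nra.
(* If dc = 0 the point is on the leaf of z0 and [leaf_monotone] makes the abscissas move together;
   otherwise the levels do, by [LI]. *)
have n2 t : not_opposite (c1 t - ((h z0).1, S2 * p2 (h z0))) (c2 t - (x, S2 * p1 z0)).
  rewrite /not_opposite /crossp /dotp /= -!mulrBr => cr0.
  set dX := (h (pt t)).1 - (h z0).1 in cr0 *; set dP := p2 _ - _ in cr0 *.
  set dx := (pt t).1 - x in cr0 *; set dc := p1 _ - _ in cr0 *.
  have xz0 : same_strip s1 x z0.1 by left.
  have [dc0|dc0] := eqVneq dc 0.
    have lf : same_leaf r1 s1 z0 (pt t).
      split; first by rewrite z0x.
      by apply/eqP; rewrite eq_sym -subr_eq0; apply/eqP.
    have dP0 : dP = 0.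
      apply/eqP; rewrite subr_eq0 eq_sym; apply/eqP.
      by have [_ _ _ _ L] := hg; have /L [] := lf.
    have dx0 : (pt t).1 <> z0.1.
      rewrite z0x => E; move: dc0 (ptE t); rewrite /dc /linear_like E z0x -/S1.
      have -> : r1 x + S1 * (pt t).2 - (r1 x + S1 * z0.2) = S1 * ((pt t).2 - z0.2) by ring.
      move=> /eqP; rewrite mulf_eq0 [S1 == 0](introF eqP sx) /= => /eqP ->.
      by have := exprn_gt0 2 rho0; lra.
    have := leaf_monotone T1 T2 hg sz0 zu lf hu dx0.
    by rewrite z0x -/dx -/dX dc0 dP0; lra.
  have mon : 0 < dP * dc.
    have [|] := ltP (p1 (pt t)) (p1 z0) => L.
      by have := LI x sx _ _ (ptS t) xz0 L; rewrite /dP /dc; nra.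
    have {}L : p1 z0 < p1 (pt t) by rewrite lt_neqAle L andbT eq_sym -subr_eq0.
    by have := LI x sx _ _ xz0 (ptS t) L; rewrite /dP /dc; nra.
  have dc2 : 0 < dc ^+ 2 by rewrite exprn_even_gt0.
  have E : dX * dc = dP * dx.
    by apply: (mulfI (introN eqP S0)); lra.
  have : 0 < (dX * dx + S2 * dP * (S2 * dc)) * dc ^+ 2.
    have -> : (dX * dx + S2 * dP * (S2 * dc)) * dc ^+ 2 =
      (dX * dc) * (dx * dc) + (S2 ^+ 2 * (dP * dc)) * dc ^+ 2 by ring.
    rewrite E.
    have -> : dP * dx * (dx * dc) = (dP * dc) * dx ^+ 2 by ring.
    have h1 : 0 <= dP * dc * dx ^+ 2 := mulr_ge0 (ltW mon) (sqr_ge0 _).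
    have h2 : 0 < S2 ^+ 2 * (dP * dc) * dc ^+ 2 := mulr_gt0 (mulr_gt0 S20 mon) dc2.
    lra.
  by rewrite pmulr_lgt0.
have n3 t : not_opposite (c2 t - (x, S2 * p1 z0)) (c3 t - (0, 0)).
  have -> : c3 t - (0, 0) = ((pt t).1 - x, S1 * S2 * ((pt t).2 - z0.2)).
    rewrite /c3 /pt /circle /= -z0x; congr (_, _); rewrite /=; ring.
  rewrite /not_opposite /crossp /dotp /= -!mulrBr => cr0.
  have := ptE t; have := exprn_gt0 2 rho0.
  set dy := (pt t).2 - z0.2 in cr0 *.
  set dx := (pt t).1 - x in cr0 *; set dc := p1 _ - _ in cr0 *.
  move=> r20 dE.
  have [dx0|dx0] := eqVneq dx 0.
    have dcE : dc = S1 * dy.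
      have E : (pt t).1 = x by apply/eqP; rewrite -subr_eq0 -/dx dx0.
      by rewrite /dc /linear_like E z0x -/S1 /dy; ring.
    rewrite dx0 dcE.
    have -> : 0 * 0 + S2 * (S1 * dy) * (S1 * S2 * dy) = S2 ^+ 2 * S1 ^+ 2 * dy ^+ 2 by ring.
    have dy2 : 0 < dy ^+ 2 by move: dE; rewrite dx0; lra.
    exact: mulr_gt0 (mulr_gt0 S20 S10) dy2.
  have dx2 : 0 < dx ^+ 2 by rewrite exprn_even_gt0.
  have -> : S1 * S2 * dy = S2 * dc by apply: (mulfI dx0); lra.
  by have := sqr_ge0 (S2 * dc); lra.
have := W z0 rho rho0; rewrite -/pt => W0.
have W1 : winding c1 ((h z0).1, S2 * p2 (h z0)) 1.
  by apply: winding_not_opposite W0 => //=; rewrite ?loop.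
have W2 : winding c2 (x, S2 * p1 z0) 1.
  by apply: winding_not_opposite W1.
have W3 : winding c3 (0, 0) 1.
  by apply: winding_not_opposite W2.
exact: winding_reflection Sneg rho0 W3.
Qed.

End SignImage.

(** * Level-preserving homeomorphisms *)

Section Equivalence.
Context {R : realType}.
Implicit Types (z w : R * R) (a x y t : R).

Lemma near_continuous_at (T U : topologicalType) (f f' : T -> U) (p : T) :
  (\forall q \near p, f q = f' q) -> {for p, continuous f'} -> {for p, continuous f}.
Proof.
move=> E c A nA.
have fp : f p = f' p by have /nbhs_singleton := E.
rewrite fp in nA; have := c A nA; rewrite /= !nbhs_simpl /= => nA'.
by near=> q; rewrite /= (near E q) //; near: q.
Unshelve. all: by end_near. Qed.

(* A homeomorphism with this property has local degree 1 on a circle far to the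
   right, hence everywhere. *)
Definition fibred_at_infinity (h : R * R -> R * R) := forall M, exists N, forall z w,
  N < z.1 -> N < w.1 -> [/\ M < (h z).1, z.1 < w.1 -> (h z).1 < (h w).1 &
    z.1 = w.1 -> z.2 < w.2 -> (h z).1 = (h w).1 /\ (h z).2 < (h w).2].

(** Orientation is recorded by the behaviour at infinity, which is directly stable under
    composition. *)
Definition level_equiv (f f' : R * R -> R) := exists h g l l',
  [/\ continuous h, continuous g, cancel h g & cancel g h] /\
  [/\ incb l l', forall z, l (f z) = f' (h z) & fibred_at_infinity h].

Lemma level_equiv_trans f f' f'' : level_equiv f' f -> level_equiv f f'' -> level_equiv f' f''.
Proof.
move=> [h [g [l [l' [[ch cg hK gK] [ll lE hi]]]]]] [k [q [m [m' [[ck cq kK qK] [mm mE ki]]]]]].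
exists (k \o h), (g \o q), (m \o l), (l' \o m'); split; split.
- by move=> z; exact: (continuous_comp (ch z) (ck _)).
- by move=> z; exact: (continuous_comp (cq z) (cg _)).
- exact: can_comp.
- exact: can_comp.
- exact: incb_comp.
- by move=> z /=; rewrite lE mE.
- move=> M; have [N1 H1] := ki M; have [N2 H2] := hi N1.
  exists N2 => z w z2 w2 /=.
  have [a1 b1 c1] := H2 z w z2 w2; have [a2 _ _] := H2 w z w2 z2.
  have [a3 b3 c3] := H1 (h z) (h w) a1 a2.
  split => //; first by move=> /b1 /b3.
  by move=> zw /(c1 zw) [/c3].
Qed.

Lemma winding_circle z rho : 0 < rho -> winding (circle z rho) z 1.
Proof.
move=> r0; exists (fun t => 2 * pi * t); split.
- by apply: continuous_subspaceT; cont.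
- by move=> t _; exists rho.
- by rewrite mulr1 mulr0 subr0 mul1r.
Qed.

(** Far to the right, the displacement from the centre and that of the images have horizontal parts
    of the same sign, or both are vertical and of the same sign. They are never opposite, so the
    image of a circle winds once. *)
Lemma level_equiv_o_equiv_fun f f' : level_equiv f f' -> o_equiv_fun f f'.
Proof.
move=> [h [g [l [l' [[ch cg hK gK] [ll lE hi]]]]]]; exists h, l; split; last by apply/funext => z; exact: lE.
  split; first by split => //; exists g.
  have [N H] := hi 0.
  (* The unit circle around this centre lies in the region x > N. *)
  pose z0 : R * R := (N + 2, 0).
  move=> z rho rho0; apply: (@winding_circle_indep R h z0 1 z rho 1 ch (can_inj hK) ltr01 rho0).
  have cC : continuous (circle z0 1).
    move=> t; have cl : {for t, continuous (fun t : R => 2 * pi * t)} by cont.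
    have cc := comp_continuous_at cl (@continuous_cos R).
    have cs := comp_continuous_at cl (@continuous_sin R).
    have c2 : {for t, continuous (fun t : R => (1 * cos (2 * pi * t), 1 * sin (2 * pi * t)) : R * R)} by cont.
    apply: (@cvgD _ _ _ _ _ (fun=> z0)); [exact: cvg_cst|exact: c2].
  have cl := @circle_loop R z0 1.
  apply: winding_not_opposite (winding_circle z0 ltr01) => //.
  - by move=> t; exact: (continuous_comp (cC t) (ch _)).
  - by rewrite /= cl.
  move=> t _; rewrite /not_opposite /crossp /dotp /=.
  set w := circle z0 1 t.
  have w1 : w.1 = z0.1 + cos (2 * pi * t) by rewrite /w /circle /= mul1r.
  have w2 : w.2 = z0.2 + sin (2 * pi * t) by rewrite /w /circle /= mul1r.
  have E1 : z0.1 + 1 * cos (2 * pi * t) - z0.1 = w.1 - z0.1 by rewrite w1 mul1r.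
  have E2 : z0.2 + 1 * sin (2 * pi * t) - z0.2 = w.2 - z0.2 by rewrite w2 mul1r.
  rewrite E1 E2.
  have cs : (w.1 - z0.1) ^+ 2 + (w.2 - z0.2) ^+ 2 = 1.
    by rewrite w1 w2 -[RHS](cos2Dsin2 (2 * pi * t)); ring.
  have Nw : N < w.1 by rewrite w1 /=; have := cos_geN1 (2 * pi * t); lra.
  have Nz : N < z0.1 by rewrite /=; lra.
  have [_ b1 c1] := H w z0 Nw Nz; have [_ b2 c2] := H z0 w Nz Nw.
  have [xz|zx|xz] := ltgtP w.1 z0.1.
  - move=> cr; have X := b1 xz.
    set dx := w.1 - z0.1 in cs cr *; set dX := (h w).1 - (h z0).1 in cr *.
    set dy := w.2 - z0.2 in cs cr *; set dY := (h w).2 - (h z0).2 in cr *.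
    have dx0 : dx < 0 by rewrite /dx; lra.
    have dX0 : dX < 0 by rewrite /dX; lra.
    have p0 : 0 < dx * dX by nra.
    have dx2 : 0 < dx ^+ 2 by nra.
    rewrite -(pmulr_lgt0 _ dx2).
    have -> : (dx * dX + dy * dY) * dx ^+ 2 = dx * dX * dx ^+ 2 + dy * dx * (dx * dY) by ring.
    have -> : dx * dY = dy * dX by lra.
    have -> : dy * dx * (dy * dX) = dx * dX * dy ^+ 2 by ring.
    have := sqr_ge0 dy; nra.
  - move=> cr; have X := b2 zx.
    set dx := w.1 - z0.1 in cs cr *; set dX := (h w).1 - (h z0).1 in cr *.
    set dy := w.2 - z0.2 in cs cr *; set dY := (h w).2 - (h z0).2 in cr *.
    have dx0 : 0 < dx by rewrite /dx; lra.
    have dX0 : 0 < dX by rewrite /dX; lra.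
    have p0 : 0 < dx * dX by nra.
    have dx2 : 0 < dx ^+ 2 by nra.
    rewrite -(pmulr_lgt0 _ dx2).
    have -> : (dx * dX + dy * dY) * dx ^+ 2 = dx * dX * dx ^+ 2 + dy * dx * (dx * dY) by ring.
    have -> : dx * dY = dy * dX by lra.
    have -> : dy * dx * (dy * dX) = dx * dX * dy ^+ 2 by ring.
    have := sqr_ge0 dy; nra.
  - move=> _; rewrite xz subrr mul0r add0r.
    have [yz|zy|yz] := ltgtP w.2 z0.2.
    + by have [_] := c1 xz yz; nra.
    + by have [_] := c2 (esym xz) zy; nra.
    + by move: cs; rewrite xz yz; lra.
split; last by case: ll.
split; first exact: incb_continuous ll.
by exists l'; case: (ll) => _ ? ?; split => //; exact: incb_continuous (incb_sym ll).
Qed.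

Section Fibre.
Implicit Types (r s phi l : R -> R).

(** Where s1 does not vanish, the level l (p1 z) determines the height over phi x; on a vertical
    line it does not, and the height is kept. *)
Definition fibre_map r1 s1 r2 s2 phi l z : R * R :=
  (phi z.1, if s1 z.1 == 0 then z.2 else
    (l (linear_like r1 s1 z) - r2 (phi z.1)) / s2 (phi z.1)).

(** Near a vertical line the last premise reduces the formula to (phi x, y). *)
Lemma fibre_map_continuous r1 s1 r2 s2 phi l :
  continuous r1 -> continuous s1 -> continuous r2 -> continuous s2 ->
  continuous phi -> continuous l -> (forall x, s1 x = 0 <-> s2 (phi x) = 0) ->
  (forall z, s1 z.1 = 0 -> \forall w \near z,
    l (linear_like r1 s1 w) = linear_like r2 s2 (phi w.1, w.2)) ->
  continuous (fibre_map r1 s1 r2 s2 phi l).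
Proof.
move=> cr1 cs1 cr2 cs2 cphi cl s12 H z.
have c1 : {for z, continuous (fun w => phi w.1)} by apply: comp_continuous_at cphi; cont.
have [sz|/eqP sz] := eqVneq (s1 z.1) 0.
  apply: (@near_continuous_at _ _ _ (fun w => (phi w.1, w.2))); last by cont.
  apply: filterS (H z sz) => w wE; rewrite /fibre_map; congr (_, _); case: eqP => // sw.
  rewrite wE /linear_like /= addrC addKr mulrC mulKf //.
  by apply/eqP => /s12.
have c2 : {for z, continuous (fun w => l (linear_like r1 s1 w))}.
  by apply: comp_continuous_at cl; exact: linear_like_continuous.
have c3 := comp_continuous_at c1 cr2; have c4 := comp_continuous_at c1 cs2.
apply: (@near_continuous_at _ _ _ (fun w =>
   (phi w.1, (l (linear_like r1 s1 w) - r2 (phi w.1)) / s2 (phi w.1)))).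
  have cs1z : {for z, continuous (fun w : R * R => s1 w.1)} by apply: comp_continuous_at cs1; cont.
  have /cvgrPdist_lt /(_ `|s1 z.1|) := cs1z.
  rewrite normr_gt0 => /(_ (introN eqP sz)); apply: filterS => w Hw.
  rewrite /fibre_map; congr (_, _); case: eqP => // sw.
  by move: Hw; rewrite sw subr0 ltxx.
by cont; apply/eqP => /s12.
Qed.

Lemma fibre_map_level r1 s1 r2 s2 phi l : (forall x, s1 x = 0 <-> s2 (phi x) = 0) ->
  (forall z, s1 z.1 = 0 -> l (linear_like r1 s1 z) = linear_like r2 s2 (phi z.1, z.2)) ->
  forall z, l (linear_like r1 s1 z) = linear_like r2 s2 (fibre_map r1 s1 r2 s2 phi l z).
Proof.
move=> s12 H z; have [sz|sz] := eqVneq (s1 z.1) 0.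
  by rewrite H // /fibre_map sz eqxx.
rewrite [RHS]/linear_like /fibre_map /= (negbTE sz) mulrC divfK; first by rewrite addrC subrK.
by apply/eqP => /s12 /eqP; apply/negP.
Qed.

Lemma fibre_mapK r1 s1 r2 s2 phi phi' l l' : cancel phi phi' -> cancel l l' ->
  (forall x, s1 x = 0 <-> s2 (phi x) = 0) ->
  (forall z, s1 z.1 = 0 -> l (linear_like r1 s1 z) = linear_like r2 s2 (phi z.1, z.2)) ->
  cancel (fibre_map r1 s1 r2 s2 phi l) (fibre_map r2 s2 r1 s1 phi' l').
Proof.
move=> pK lK s12 H z; rewrite {1}/fibre_map -fibre_map_level // lK [(fibre_map _ _ _ _ _ _ _).1]/=.
rewrite pK [RHS]surjective_pairing; congr (_, _); case: eqP => [/s12 sz|sz].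
  by rewrite /fibre_map /= sz eqxx.
rewrite /linear_like addrC addKr mulrC mulKf //; apply/eqP => sz'; exact/sz/s12.
Qed.

(** The sign condition makes the map increasing on vertical lines, as [fibred_at_infinity]
    demands. *)
Lemma level_equiv_fibre r1 s1 r2 s2 phi phi' l l' :
  continuous r1 -> continuous s1 -> continuous r2 -> continuous s2 ->
  incb phi phi' -> incb l l' -> (forall x, s1 x = 0 <-> s2 (phi x) = 0) ->
  (forall x, s1 x <> 0 -> 0 < s1 x * s2 (phi x)) ->
  (forall z, s1 z.1 = 0 -> \forall w \near z,
    l (linear_like r1 s1 w) = linear_like r2 s2 (phi w.1, w.2)) ->
  level_equiv (linear_like r1 s1) (linear_like r2 s2).
Proof.
move=> cr1 cs1 cr2 cs2 pp ll s12 pos H.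
have [_ pK pK'] := pp; have [_ lK lK'] := ll.
have cp := incb_continuous pp; have cp' := incb_continuous (incb_sym pp).
have cl := incb_continuous ll; have cl' := incb_continuous (incb_sym ll).
have s21 x : s2 x = 0 <-> s1 (phi' x) = 0 by rewrite s12 pK'.
have H' z : s2 z.1 = 0 -> \forall w \near z,
    l' (linear_like r2 s2 w) = linear_like r1 s1 (phi' w.1, w.2).
  move=> /s21 sz.
  have c1 : {for z, continuous (fun w => phi' w.1)} by apply: comp_continuous_at cp'; cont.
  have c : {for z, continuous (fun w : R * R => (phi' w.1, w.2) : R * R)} by cont.
  have : \forall w \near z, l (linear_like r1 s1 (phi' w.1, w.2)) =
      linear_like r2 s2 (phi (phi' w.1), w.2) := c _ (H (phi' z.1, z.2) sz).
  by apply: filterS => w; rewrite pK' -surjective_pairing => <-; rewrite lK.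
have K z : s1 z.1 = 0 -> l (linear_like r1 s1 z) = linear_like r2 s2 (phi z.1, z.2).
  by move=> /H /nbhs_singleton.
have K' z : s2 z.1 = 0 -> l' (linear_like r2 s2 z) = linear_like r1 s1 (phi' z.1, z.2).
  by move=> /H' /nbhs_singleton.
exists (fibre_map r1 s1 r2 s2 phi l), (fibre_map r2 s2 r1 s1 phi' l'), l, l'; split; split => //.
- exact: fibre_map_continuous.
- exact: fibre_map_continuous.
- exact: fibre_mapK.
- exact: fibre_mapK.
- exact: fibre_map_level.
- move=> M; exists (phi' M) => z w Mz Mw; have m := incb_mono pp; split => /=.
  + by rewrite -[M]pK' m.
  + by rewrite m.
  + move=> zw yzw; rewrite zw; split => //; case: eqP => // sw.
    have := pos _ sw; set S := s2 _ => p.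
    have S0 : S != 0 by apply/eqP => S0; move: p; rewrite S0 mulr0 ltxx.
    rewrite -subr_gt0 -mulrBl opprB addrA subrK.
    have L c d : 0 < l c - l d -> d < c by rewrite subr_gt0 (incb_mono ll).
    have [Sp|Sn] : 0 < S \/ S < 0 by apply/orP; rewrite -neq_lt eq_sym.
      rewrite divr_gt0 // subr_gt0 (incb_mono ll) /linear_like zw ltrD2l ltr_pM2l //; nra.
    rewrite -mulrNN -invrN opprB divr_gt0 ?oppr_gt0 // subr_gt0 (incb_mono ll) /linear_like zw ltrD2l ltr_nM2l //; nra.
Qed.

End Fibre.

End Equivalence.

(** * A compactly supported stretching of the line *)

Section Squeeze.
Context {R : realType}.
Implicit Types k w v : R.

(* An increasing self-map of [0, +oo[ equal to k * v for small v and to the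
   identity for v >= w / 2; its inverse is obtained by replacing k by 1 / k. *)
Definition half_squeeze k w v :=
  Num.max (Num.min v (2 * v - w / 2)) (Num.min (k * v) (Num.max v ((v + w / 2) / 2))).

Lemma half_squeeze_id k w v : w / 2 <= v -> half_squeeze k w v = v.
Proof.
move=> wv; rewrite /half_squeeze.
rewrite (min_idPl _); last lra.
rewrite (max_idPl (_ : (v + w / 2) / 2 <= v)); last lra.
by apply/max_idPl; rewrite ge_min lexx orbT.
Qed.

(** The line of slope k through the origin is clamped between the lines of slopes 2 and 1/2 through
    (w / 2, w / 2). These two are inverse to each other, hence [half_squeezeK]. *)
Lemma half_squeezeE k w v : v <= w / 2 ->
  half_squeeze k w v = Num.max (2 * v - w / 2) (Num.min (k * v) ((v + w / 2) / 2)).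
Proof.
move=> wv; rewrite /half_squeeze (min_idPr _); last lra.
by rewrite (max_idPr (_ : v <= (v + w / 2) / 2)) //; lra.
Qed.

Lemma half_squeeze0 k w : 0 <= w -> half_squeeze k w 0 = 0.
Proof.
move=> w0; rewrite half_squeezeE ?divr_ge0 // !mulr0 (min_idPl _); last lra.
by apply/max_idPr; lra.
Qed.

Lemma half_squeeze_gt0 k w v : 0 <= w -> 0 < k -> 0 < v -> 0 < half_squeeze k w v.
Proof.
move=> w0 k0 v0; have [wv|/ltW wv] := lerP (w / 2) v; first by rewrite half_squeeze_id.
rewrite half_squeezeE // lt_max lt_min mulr_gt0 //=; apply/orP; right; lra.
Qed.

Lemma half_squeeze_le k w v : v <= w / 2 -> half_squeeze k w v <= w / 2.
Proof.
move=> wv; rewrite half_squeezeE // ge_max ge_min; apply/andP; split; first lra.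
apply/orP; right; lra.
Qed.

Lemma half_squeeze1 w v : 0 <= v -> half_squeeze 1 w v = v.
Proof.
move=> v0; have [wv|/ltW wv] := lerP (w / 2) v; first by rewrite half_squeeze_id.
rewrite half_squeezeE // mul1r (min_idPl _); last lra.
by apply/max_idPr; lra.
Qed.

Lemma half_squeeze_lin k w v : 0 <= v -> v <= w / 8 -> 0 <= k * v -> k * v <= w / 8 ->
  half_squeeze k w v = k * v.
Proof.
move=> v0 vw kv0 kvw; rewrite half_squeezeE; last lra.
rewrite (min_idPl _); last lra.
by apply/max_idPr; lra.
Qed.

Lemma half_squeezeK k w v : 0 <= w -> 0 < k -> 0 <= v ->
  half_squeeze k^-1 w (half_squeeze k w v) = v.
Proof.
move=> w0 k0 v0; have [wv|wv] := lerP (w / 2) v; first by rewrite !half_squeeze_id // half_squeeze_id.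
have k'0 : 0 < k^-1 by rewrite invr_gt0.
have kk : k^-1 * k = 1 by rewrite mulVf // lt0r_neq0.
set k' := k^-1 in k'0 kk *.
rewrite [X in half_squeeze _ _ X]half_squeezeE; last exact: ltW.
have [h1|h1] := lerP (k * v) ((v + w / 2) / 2).
  have [h2|h2] := lerP (2 * v - w / 2) (k * v).
    rewrite half_squeezeE; last lra.
    have -> : k' * (k * v) = v by rewrite mulrA kk mul1r.
    rewrite (min_idPl _); last lra.
    by apply/max_idPr; lra.
  rewrite half_squeezeE; last lra.
  have h3 : v <= k' * (2 * v - w / 2).
    have : k' * (k * v) <= k' * (2 * v - w / 2) by rewrite ler_pM2l // ltW.
    by rewrite mulrA kk mul1r.
  rewrite (min_idPr _); last lra.
  by rewrite (max_idPr _); lra.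
have h2 : 2 * v - w / 2 <= (v + w / 2) / 2 by lra.
rewrite (max_idPr h2) half_squeezeE; last lra.
have h3 : k' * ((v + w / 2) / 2) <= v.
  have : k' * ((v + w / 2) / 2) <= k' * (k * v) by rewrite ler_pM2l // ltW.
  by rewrite [k' * (k * v)]mulrA kk mul1r.
rewrite (min_idPl _); last lra.
by rewrite (max_idPl _); lra.
Qed.

Definition squeeze k w v :=
  if 0 <= v then half_squeeze k w v else - half_squeeze k w (- v).

Lemma squeeze_ge0 k w v : 0 <= w -> 0 < k -> (0 <= squeeze k w v) = (0 <= v).
Proof.
move=> w0 k0; rewrite /squeeze; case: (lerP 0 v) => v0.
  case: (ltgtP 0 v) v0 => // [v0 _|<- _]; last by rewrite half_squeeze0 // lexx.
  by apply/ltW/half_squeeze_gt0.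
by apply/negbTE; rewrite -ltNge oppr_lt0 half_squeeze_gt0 // oppr_gt0.
Qed.

Lemma squeezeK k w v : 0 <= w -> 0 < k -> squeeze k^-1 w (squeeze k w v) = v.
Proof.
move=> w0 k0; have E := squeeze_ge0 v w0 k0.
rewrite [LHS]/squeeze E /squeeze; case: (lerP 0 v) => v0; first exact: half_squeezeK.
by rewrite opprK half_squeezeK ?opprK //; lra.
Qed.

Lemma squeeze_id k w v : 0 <= w -> w / 2 <= `|v| -> squeeze k w v = v.
Proof.
move=> w0 wv; rewrite /squeeze; case: (lerP 0 v) => v0.
  by apply: half_squeeze_id; rewrite ger0_norm in wv.
by rewrite half_squeeze_id ?opprK // -ltr0_norm.
Qed.

Lemma squeeze1 w v : squeeze 1 w v = v.
Proof.
rewrite /squeeze; case: (lerP 0 v) => v0; first exact: half_squeeze1.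
by rewrite half_squeeze1 ?opprK //; lra.
Qed.

Lemma norm_squeeze_le k w v : 0 <= w -> 0 < k -> `|v| <= w / 2 -> `|squeeze k w v| <= w / 2.
Proof.
move=> w0 k0 vw; rewrite /squeeze; case: (lerP 0 v) => v0.
  rewrite ger0_norm; last by have := squeeze_ge0 v w0 k0; rewrite /squeeze v0.
  by apply: half_squeeze_le; rewrite ger0_norm in vw.
rewrite normrN ger0_norm; last by apply/ltW/half_squeeze_gt0 => //; lra.
by apply: half_squeeze_le; rewrite ltr0_norm in vw.
Qed.

Lemma squeeze_lin k w v : 0 <= k -> `|v| <= w / 8 -> k * `|v| <= w / 8 ->
  squeeze k w v = k * v.
Proof.
move=> k0; rewrite /squeeze; case: (lerP 0 v) => v0.
  by rewrite ger0_norm // => h1 h2; rewrite half_squeeze_lin // mulr_ge0.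
by rewrite ltr0_norm // => h1 h2; rewrite half_squeeze_lin ?mulrN ?opprK //; nra.
Qed.

Lemma max_continuous_at (T : topologicalType) (f g : T -> R) (p : T) :
  {for p, continuous f} -> {for p, continuous g} ->
  {for p, continuous (fun q => Num.max (f q) (g q))}.
Proof. by move=> cf cg; exact: (@continuous_max R T f g). Qed.

Lemma min_continuous_at (T : topologicalType) (f g : T -> R) (p : T) :
  {for p, continuous f} -> {for p, continuous g} ->
  {for p, continuous (fun q => Num.min (f q) (g q))}.
Proof. by move=> cf cg; exact: (@continuous_min R T f g). Qed.

Lemma half_squeeze_continuous_at (T : topologicalType) (k w v : T -> R) (p : T) :
  {for p, continuous k} -> {for p, continuous w} -> {for p, continuous v} ->
  {for p, continuous (fun q => half_squeeze (k q) (w q) (v q))}.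
Proof.
move=> ck cw cv; rewrite /half_squeeze.
by apply: max_continuous_at; apply: min_continuous_at; cont; apply: max_continuous_at; cont.
Qed.

Lemma squeeze_continuous_at (T : topologicalType) (k w v : T -> R) (p : T) :
  (forall q, 0 <= w q) ->
  {for p, continuous k} -> {for p, continuous w} -> {for p, continuous v} ->
  {for p, continuous (fun q => squeeze (k q) (w q) (v q))}.
Proof.
move=> w0 ck cw cv.
(* Writing the odd extension with positive and negative parts removes the case distinction on the
   sign. *)
have -> : (fun q => squeeze (k q) (w q) (v q)) = fun q =>
    half_squeeze (k q) (w q) (Num.max (v q) 0) - half_squeeze (k q) (w q) (Num.max (- v q) 0).
  apply/funext => q; rewrite /squeeze; case: ifPn => [v0|]; last rewrite -ltNge => v0.
    by rewrite (max_idPl v0) (max_idPr (_ : - v q <= 0)) ?half_squeeze0 ?subr0 // oppr_le0.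
  by rewrite (max_idPr (ltW v0)) (max_idPl (_ : 0 <= - v q)) ?half_squeeze0 ?sub0r // oppr_ge0 ltW.
have c1 : {for p, continuous (fun q => Num.max (v q) 0)} by apply: max_continuous_at; cont.
have c2 : {for p, continuous (fun q => Num.max (- v q) 0)} by apply: max_continuous_at; cont.
have c3 := half_squeeze_continuous_at ck cw c1.
have c4 := half_squeeze_continuous_at ck cw c2.
by cont.
Qed.

End Squeeze.

(** * The cone map: algebra and inverse *)

Section Cone.
Context {R : realType}.
Implicit Types (r s t : R -> R) (z w : R * R) (a eta dl u x xi : R).

(** A vanishing strict derivative: the estimate concerns pairs of points, because the cone map
    compares s at two points different from a. *)
Definition flat_at s a := forall e, 0 < e -> exists2 dl, 0 < dl & forall x y,
  `|x - a| < dl -> `|y - a| < dl -> `|s y - s x| <= e * `|y - x|.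

(** The functions s and t differ only within dl of a, while r is affine and a the only zero up to 2
    * dl; the ring in between is a buffer. *)
Definition cone_data r s t a eta dl :=
  [/\ 0 < dl, eta = 1 \/ eta = -1, continuous r, continuous s & continuous t] /\
  [/\ s a = 0, flat_at s a, flat_at t a & (forall x, s x = 0 <-> t x = 0)] /\
  [/\ forall x, s x <> 0 -> 0 < s x * t x,
      forall x, `|x - a| < 2 * dl -> r x = r a + eta * (x - a),
      forall x, `|x - a| < 2 * dl -> s x = 0 -> x = a &
      forall x, dl <= `|x - a| -> s x = t x].

Lemma cone_data_sym r s t a eta dl : cone_data r s t a eta dl -> cone_data r t s a eta dl.
Proof.
move=> [[h1 h2 h3 h4 h5] [[h6 h7 h8 h9] [h10 h11 h12 h13]]].
split; first by split.
split; first by split=> //; [exact/h9|move=> x; rewrite h9].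
split => //.
- by move=> x tx; rewrite mulrC; apply: h10 => /h9.
- by move=> x xa /h9; exact: h12.
- by move=> x /h13.
Qed.

(** The value at u = 0 is 0 / 0 = 0; it is never met, since [cone_x] uses the ratio only when 0 < xi
    * u. *)
Definition slope_ratio s t a dl u := if `|u| < dl then t (a + u) / s (a + u) else 1.

Definition cone_x s t a dl xi u :=
  if 0 < xi * u then u + squeeze (slope_ratio s t a dl u) `|u| (xi - u) else xi.

(* A level-preserving map from r + s y to r + t y: on the level set of value
   r a + eta u the point at abscissa a + u is fixed, and near it abscissas are
   stretched by the factor t (a + u) / s (a + u), so that the second
   coordinate is asymptotically preserved near the line nu_a. *)
Definition cone_map r s t a eta dl z : R * R :=
  if s z.1 == 0 then z else
  let x := a + cone_x s t a dl (z.1 - a) (eta * (linear_like r s z - r a)) in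
  (x, (linear_like r s z - r x) / t x).

Section Fixed.
Context (r s t : R -> R) (a eta dl : R) (H : cone_data r s t a eta dl).

Lemma slope_ratio_gt0 u : u <> 0 -> 0 < slope_ratio s t a dl u.
Proof.
have [[h1 h2 h3 h4 h5] [[h6 h7 h8 h9] [h10 h11 h12 h13]]] := H.
move=> u0; rewrite /slope_ratio; case: ifPn => // ul.
have su : s (a + u) <> 0.
  by move=> su; apply: u0; have := h12 (a + u); rewrite addrC addKr => /(_ ltac:(lra) su); lra.
have := h10 _ su; set S := s _ in su *; set T := t _ => ST.
have S2 : 0 < S ^+ 2 by rewrite exprn_even_gt0 //; exact/eqP.
rewrite -(pmulr_lgt0 _ S2) expr2 mulrA divfK; last exact/eqP.
by rewrite mulrC.
Qed.

Lemma slope_ratioV u : slope_ratio t s a dl u = (slope_ratio s t a dl u)^-1.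
Proof. by rewrite /slope_ratio; case: ifP => _; rewrite ?invf_div ?invr1. Qed.

Lemma cone_xE_far xi u : `|u| / 2 <= `|xi - u| -> cone_x s t a dl xi u = xi.
Proof.
by move=> h; rewrite /cone_x; case: ifP => // _; rewrite squeeze_id // addrC subrK.
Qed.

Lemma cone_xE_big xi u : dl <= `|u| -> cone_x s t a dl xi u = xi.
Proof.
move=> h; rewrite /cone_x; case: ifP => // _; rewrite /slope_ratio ifF ?squeeze1 ?subrKC //.
by apply/negbTE; rewrite -leNgt.
Qed.

Lemma cone_x_near_level xi u : 0 < xi * u -> `|xi - u| < `|u| / 2 ->
  `|cone_x s t a dl xi u - u| <= `|u| / 2.
Proof.
move=> xu h; rewrite /cone_x xu addrC addKr norm_squeeze_le ?normr_ge0 //; last exact: ltW.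
by apply: slope_ratio_gt0 => u0; move: xu; rewrite u0 mulr0 ltxx.
Qed.

Lemma cone_x_gt0 xi u : xi <> 0 -> 0 < xi * cone_x s t a dl xi u.
Proof.
move=> xi0; have xx : 0 < xi * xi by rewrite -expr2 exprn_even_gt0 //; exact/eqP.
have [h|h] := lerP (`|u| / 2) `|xi - u|; first by rewrite cone_xE_far.
have [xu|xu] := ltP 0 (xi * u); last by rewrite /cone_x [0 < xi * u]ltNge xu.
have := cone_x_near_level xu h; set X := cone_x _ _ _ _ _ _.
rewrite ler_norml => /andP[].
have [u0|u0|u0] := ltgtP 0 u; last by move: xu; rewrite -u0 mulr0 ltxx.
  by rewrite gtr0_norm // => *; nra.
by rewrite ltr0_norm // => *; nra.
Qed.

(** Abscissas move only if |u| < dl and |xi - u| < |u| / 2, whence the radius 3 / 2 * dl. *)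
Lemma cone_x_far xi u : 3 / 2 * dl <= `|xi| -> cone_x s t a dl xi u = xi.
Proof.
move=> h; have [ul|ul] := lerP dl `|u|; first exact: cone_xE_big.
apply: cone_xE_far; have := lerB_dist xi u; have := normr_ge0 u; lra.
Qed.

Lemma cone_x_near xi u : `|xi| < 3 / 2 * dl -> `|cone_x s t a dl xi u| < 3 / 2 * dl.
Proof.
move=> h; have [ul|ul] := lerP dl `|u|; first by rewrite cone_xE_big.
have [h'|h'] := lerP (`|u| / 2) `|xi - u|; first by rewrite cone_xE_far.
have [xu|xu] := ltP 0 (xi * u); last by rewrite /cone_x [0 < xi * u]ltNge xu.
have := cone_x_near_level xu h'; set X := cone_x _ _ _ _ _ _ => h3.
have := ler_normD (X - u) u; rewrite subrK; lra.
Qed.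

Lemma cone_x_posE xi u : xi <> 0 -> (0 < cone_x s t a dl xi u * u) = (0 < xi * u).
Proof.
move=> xi0; have := cone_x_gt0 u xi0; set X := cone_x _ _ _ _ _ _ => p.
apply/idP/idP => q; have [u0|u0|u0] := ltgtP 0 u; try (by move: q; rewrite -u0 mulr0 ltxx); nra.
Qed.

Lemma cone_xK xi u : xi <> 0 -> cone_x t s a dl (cone_x s t a dl xi u) u = xi.
Proof.
move=> xi0; rewrite {1}/cone_x cone_x_posE //; case: ifPn => xu; last by rewrite /cone_x (negbTE xu).
have k0 : 0 < slope_ratio s t a dl u.
  by apply: slope_ratio_gt0 => u0; move: xu; rewrite u0 mulr0 ltxx.
rewrite /cone_x xu slope_ratioV; set q := squeeze _ _ (xi - u).
have -> : u + q - u = q by rewrite addrC addKr.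
by rewrite /q squeezeK // addrC subrK.
Qed.

(** The new abscissa stays on its side of a and within 3 / 2 * dl, where a is the only zero; farther
    out nothing moves. *)
Lemma cone_target x u : s x <> 0 -> t (a + cone_x s t a dl (x - a) u) <> 0.
Proof.
have [[h1 h2 h3 h4 h5] [[h6 h7 h8 h9] [h10 h11 h12 h13]]] := H.
move=> sx /h9; have [h|h] := lerP (3 / 2 * dl) `|x - a|.
  by rewrite cone_x_far // addrC subrK.
move=> s0; have xa : x - a <> 0 by move=> xa; apply: sx; rewrite -(subrK a x) xa add0r.
have := cone_x_gt0 u xa; have := cone_x_near u h; set X := cone_x _ _ _ _ _ _ in s0 * => X1 X2.
have := h12 _ _ s0; rewrite addrC addKr => /(_ ltac:(lra)) E.
by have : X = 0 by [lra]; move=> X0; move: X2; rewrite X0 mulr0 ltxx.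
Qed.

Lemma cone_map_level z : linear_like r t (cone_map r s t a eta dl z) = linear_like r s z.
Proof.
have [[h1 h2 h3 h4 h5] [[h6 h7 h8 h9] [h10 h11 h12 h13]]] := H.
rewrite /cone_map; case: eqP => sz.
  by rewrite /linear_like sz ((h9 _).1 sz) !mul0r.
by apply: level_pointK; exact: cone_target.
Qed.

Lemma cone_map_far z : 3 / 2 * dl <= `|z.1 - a| -> cone_map r s t a eta dl z = z.
Proof.
have [[h1 h2 h3 h4 h5] [[h6 h7 h8 h9] [h10 h11 h12 h13]]] := H.
move=> h; rewrite /cone_map; case: eqP => // /eqP sz; rewrite cone_x_far // [a + _]addrC subrK.
rewrite [RHS]surjective_pairing; congr (_, _).
by rewrite -h13; [rewrite /linear_like addrC addKr mulrC mulKf|lra].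
Qed.

End Fixed.

Lemma cone_mapK r s t a eta dl : cone_data r s t a eta dl ->
  cancel (cone_map r s t a eta dl) (cone_map r t s a eta dl).
Proof.
move=> H z; have L := cone_map_level H z; have G := @cone_target _ _ _ _ _ _ H.
have [[h1 h2 h3 h4 h5] [[h6 h7 h8 h9] [h10 h11 h12 h13]]] := H.
rewrite {1}/cone_map L; move: L; rewrite /cone_map; case: eqP => [sz _|sz _].
  by rewrite ((h9 _).1 sz) eqxx.
rewrite /=; case: eqP => [/G //|_].
rewrite [a + _ - a]addrC addKr (cone_xK H); last first.
  by move=> xa; apply: sz; rewrite -(subrK a z.1) xa add0r.
rewrite [a + _]addrC subrK [RHS]surjective_pairing; congr (_, _).
by rewrite /linear_like addrC addKr mulrC mulKf //; exact/eqP.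
Qed.

(** The quantity estimated is the new height minus the old one: Sx / S and T / T' are both close to
    1. The factor 3 bounds (16/15 + 16/15) / (14/15). *)
Lemma cone_bound (S Sx T T' y e M : R) : S != 0 -> T != 0 -> 0 <= e -> 0 <= M ->
  16 * (e * M) <= 1 -> `|y| <= M -> `|Sx - S| <= e * M * `|Sx| ->
  `|T' - T| <= 16 / 15 * (e * M) * `|T| ->
  `|T / S * Sx * y / T' - y| <= 3 * e * M ^+ 2.
Proof.
move=> S0 T0 e0 M0 eM yM hS hT.
have S1 : 0 < `|S| by rewrite normr_gt0.
have T1 : 0 < `|T| by rewrite normr_gt0.
have c0 : 0 <= e * M by exact: mulr_ge0.
set c := e * M in c0 eM hS hT.
have SxS : `|Sx| <= 16 / 15 * `|S|.
  have := lerB_dist Sx S; have := normr_ge0 Sx; nra.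
have TT : 14 / 15 * `|T| <= `|T'|.
  have := lerB_dist T T'; rewrite distrC => h; have := normr_ge0 T; nra.
have T'0 : 0 < `|T'| by lra.
have T'1 : T' != 0 by rewrite -normr_gt0.
have -> : T / S * Sx * y / T' - y = y * ((T * (Sx - S) - S * (T' - T)) / (S * T')).
  by field; rewrite S0 T'1.
rewrite normrM (_ : 3 * e * M ^+ 2 = M * (3 * c)); last by rewrite /c; ring.
apply: ler_pM => //; rewrite normrM normfV ler_pdivrMr ?normrM ?mulr_gt0 //.
apply: le_trans (ler_normB _ _) _; rewrite !normrM.
have k1 : `|T| * `|Sx - S| <= `|T| * (c * (16 / 15 * `|S|)).
  exact: (ler_wpM2l (ltW T1) (le_trans hS (ler_wpM2l c0 SxS))).
have k2 : `|S| * `|T' - T| <= `|S| * (16 / 15 * c * `|T|) by rewrite ler_wpM2l // ltW.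
have k3 : 3 * c * (`|S| * (14 / 15 * `|T|)) <= 3 * c * (`|S| * `|T'|).
  have c3 : 0 <= 3 * c by lra.
  exact: (ler_wpM2l c3 (ler_wpM2l (ltW S1) TT)).
have k4 : 0 <= c * (`|S| * `|T|) by rewrite !mulr_ge0 // ltW.
lra.
Qed.

End Cone.

(** * Continuity of the cone map *)

Section ConeContinuity.
Context {R : realType}.
Implicit Types (r s t : R -> R) (z w : R * R) (a eta dl u x xi : R).

Lemma near_neq0 (T : topologicalType) (f : T -> R) (p : T) :
  {for p, continuous f} -> f p != 0 -> \forall q \near p, f q != 0.
Proof.
move=> /cvgrPdist_lt /(_ `|f p|); rewrite normr_gt0 => /[apply].
apply: filterS => q h; apply/eqP => f0; by move: h; rewrite f0 subr0 ltxx.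
Qed.

Lemma near_gt0 (T : topologicalType) (f : T -> R) (p : T) :
  {for p, continuous f} -> 0 < f p -> \forall q \near p, 0 < f q.
Proof.
move=> /cvgrPdist_lt /(_ (f p)) /[apply].
by apply: filterS => q; rewrite ltr_norml => /andP[_]; lra.
Qed.

Lemma norm_continuous_at (T : topologicalType) (f : T -> R) (p : T) :
  {for p, continuous f} -> {for p, continuous (fun q => `|f q|)}.
Proof. by move=> cf; apply: comp_continuous_at cf _; exact: norm_continuous. Qed.

Lemma slope_ratio_continuous r s t a eta dl u : cone_data r s t a eta dl -> u != 0 ->
  {for u, continuous (slope_ratio s t a dl)}.
Proof.
move=> [[h1 h2 h3 h4 h5] [[h6 h7 h8 h9] [h10 h11 h12 h13]]] u0.
have cu : {for u, continuous (fun u : R => u)} by cont.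
have cn := norm_continuous_at cu.
have [ul|ul] := lerP (2 * dl) `|u|.
  apply: (@near_continuous_at _ _ _ (fun=> 1 : R)); last by cont.
  have c : {for u, continuous (fun u => `|u| - dl)} by cont.
  have : 0 < `|u| - dl by lra.
  move=> /(near_gt0 c); apply: filterS => v; rewrite subr_gt0 => h.
  by rewrite /slope_ratio ltNge ltW.
have c4 : {for u, continuous (fun u => s (a + u))} by apply: (@comp_continuous_at _ _ u (fun u => a + u) s) => //; cont.
have c5 : {for u, continuous (fun u => t (a + u))} by apply: (@comp_continuous_at _ _ u (fun u => a + u) t) => //; cont.
have sn v : v != 0 -> `|v| < 2 * dl -> s (a + v) != 0.
  move=> v0 vl; apply/eqP => sv; have := h12 (a + v); rewrite addrC addKr => /(_ vl sv) E.
  by move/eqP: v0; apply; lra.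
apply: (@near_continuous_at _ _ _ (fun u => t (a + u) / s (a + u))); last by cont; exact: sn.
have c : {for u, continuous (fun u => 2 * dl - `|u|)} by cont.
have n1 : \forall v \near u, 0 < 2 * dl - `|v| by apply: (near_gt0 c); lra.
have n2 := near_neq0 cu u0.
apply: filterS (filterI n1 n2) => v [/= v1 v2]; rewrite /slope_ratio; case: ltP => // vl.
have sv : s (a + v) != 0 by apply: sn => //; lra.
by rewrite -h13 ?divff // addrC addKr.
Qed.

Lemma cone_x_continuous (T : topologicalType) (f g : T -> R) (p : T) r s t a eta dl :
  cone_data r s t a eta dl ->
  {for p, continuous f} -> {for p, continuous g} -> f p != 0 ->
  {for p, continuous (fun q => cone_x s t a dl (f q) (g q))}.
Proof.
move=> H cf cg f0.
have cfg : {for p, continuous (fun q => f q * g q)} by cont.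
have [fg|fg|fg] := ltgtP 0 (f p * g p).
- have g0 : g p != 0 by apply/eqP => g0; move: fg; rewrite g0 mulr0 ltxx.
  apply: (@near_continuous_at _ _ _ (fun q => g q +
    squeeze (slope_ratio s t a dl (g q)) `|g q| (f q - g q))).
    by have := near_gt0 cfg fg; apply: filterS => q; rewrite /cone_x => ->.
  have c1 : {for p, continuous (fun q => slope_ratio s t a dl (g q))}.
    exact: (@continuous_comp _ _ _ g (slope_ratio s t a dl) p cg (slope_ratio_continuous H g0)).
  have c2 := norm_continuous_at cg.
  have c3 : {for p, continuous (fun q => f q - g q)} by cont.
  have c4 := squeeze_continuous_at (fun q => normr_ge0 (g q)) c1 c2 c3.
  by cont.
- apply: (@near_continuous_at _ _ _ f) => //.
  have c1 : {for p, continuous (fun q => - (f q * g q))} by cont.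
  have : 0 < - (f p * g p) by lra.
  move=> /(near_gt0 c1); apply: filterS => q; rewrite oppr_gt0 => h.
  by rewrite /cone_x ltNge ltW.
(* On the level of nu_a, xi is nonzero and u tends to 0, so the pair leaves the cone |xi - u| < |u|
   / 2. *)
- have g0 : g p = 0 by apply: (mulfI f0); rewrite -fg mulr0.
  apply: (@near_continuous_at _ _ _ f) => //.
  have c1 := norm_continuous_at cf; have c2 := norm_continuous_at cg.
  have c3 : {for p, continuous (fun q => `|f q| - 2 * `|g q|)} by cont.
  have : 0 < `|f p| - 2 * `|g p| by rewrite g0 normr0 mulr0 subr0 normr_gt0.
  move=> /(near_gt0 c3); apply: filterS => q h; apply: cone_xE_far.
  by have := lerB_dist (f q) (g q); have := normr_ge0 (g q); lra.
Qed.

(** Near nu_a at bounded height, flatness puts points so deep inside the cone that the squeeze is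
    linear there; the new height is then explicit and [cone_bound] applies. *)
Lemma cone_map_estimate r s t a eta dl e M : cone_data r s t a eta dl ->
  0 < e -> 0 <= M -> 16 * (e * M) <= 1 ->
  exists2 rho, 0 < rho & forall w, `|w.1 - a| < rho -> `|w.2| <= M ->
    `|(cone_map r s t a eta dl w).1 - a| <= 2 * `|w.1 - a| /\
    `|(cone_map r s t a eta dl w).2 - w.2| <= 3 * e * M ^+ 2.
Proof.
move=> H e0 M0 eM; have [[h1 h2 h3 h4 h5] [[h6 h7 h8 h9] [h10 h11 h12 h13]]] := H.
have [ds ds0 fs] := h7 e e0; have [dt dt0 ft] := h8 e e0.
(* The fractions leave room for |u| <= 17/16 |xi| and for the new abscissa, which is within 2 |xi|
   of a. *)
have [rho rho0 [r1 r2 r3]] : exists2 rho, 0 < rho & [/\ rho <= dl / 2, rho <= ds / 4 & rho <= dt / 4].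
  exists (Num.min (dl / 2) (Num.min (ds / 4) (dt / 4))).
    by rewrite !lt_min; apply/and3P; split; lra.
  by rewrite !ge_min !lexx !orbT.
exists rho => // -[x y] /= xr yM; rewrite /cone_map /=; case: eqP => [_|sx].
  by split; [have := normr_ge0 (x - a); lra|rewrite subrr normr0 mulr_ge0 ?sqr_ge0 // mulr_ge0 // ltW].
set p := linear_like r s (x, y); set xi := x - a in xr *; set u := eta * (p - r a).
have eta2 : eta * eta = 1 by case: h2 => ->; ring.
have etan : `|eta| = 1 by case: h2 => ->; rewrite ?normrN normr1.
have rx : r x = r a + eta * xi by apply: h11; lra.
have pE : p = r a + eta * u.
  by rewrite /u mulrA eta2 mul1r addrC subrK.
(* This gap is - eta * s x * y: it carries all the dependence on the height, and it is what the
   squeeze multiplies by the ratio. *)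
pose v := xi - u.
have vE : v = - eta * s x * y.
  have : u = eta * eta * xi + eta * s x * y by rewrite /u /p /linear_like /= rx; ring.
  by rewrite eta2 /v => ->; ring.
have vN : `|v| = `|s x| * `|y| by rewrite vE !mulNr normrN -mulrA !normrM etan mul1r.
have sxi : `|s x| <= e * `|xi|.
  have := fs a x; rewrite subrr normr0 h6 subr0; apply=> //.
  by rewrite -/xi; clear - xr r2 ds0; lra.
have vxi : `|v| <= `|xi| / 16.
  have : `|v| <= e * `|xi| * M by rewrite vN ler_pM.
  by have := normr_ge0 xi; clear - eM; nra.
have uE : xi - v = u by rewrite /v; ring.
have u1 : `|u| <= 17 / 16 * `|xi| by have := ler_normB xi v; rewrite uE; clear - vxi; lra.
have u2 : 15 / 16 * `|xi| <= `|u| by have := lerB_dist xi v; rewrite uE; clear - vxi; lra.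
have xi0 : 0 < `|xi|.
  rewrite normr_gt0 /xi subr_eq0; apply/eqP => xa; apply: sx; by rewrite xa.
have un : u != 0 by rewrite -normr_gt0; clear - u2 xi0; lra.
have xiu : 0 < xi * u.
  have := esym uE.
  move: vxi xi0; have [xp|xn|<-] := ltgtP 0 xi; last by rewrite normr0 ltxx.
    by rewrite (gtr0_norm xp) ler_norml => /andP[h h'] _ ->; clear - h h' xp; nra.
  by rewrite (ltr0_norm xn) ler_norml => /andP[h h'] _ ->; clear - h h' xn; nra.
have un2 : `|u| < dl by clear - u1 r1 xr h1; lra.
have un3 : `|u| < 2 * dl by clear - un2 h1; lra.
have uds : `|u| < ds by clear - u1 r2 xr ds0; lra.
have udt : `|u| < dt by clear - u1 r3 xr dt0; lra.
have xds : `|xi| < ds by clear - r2 xr ds0; lra.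
set S := s (a + u); set T := t (a + u).
have S0 : S != 0.
  apply/eqP => S0; have := h12 (a + u); rewrite addrC addKr => /(_ un3 S0) E.
  by move/eqP: un; apply; clear - E; lra.
have T0 : T != 0 by apply/eqP => /h9; apply/eqP.
have SS : `|s x - S| <= e * M * `|s x|.
  have := fs (a + u) x; rewrite addrC addKr -/xi => /(_ uds xds).
  have -> : x - (a + u) = v by rewrite /v /xi; ring.
  rewrite vN -/S => h; apply: le_trans h _.
  rewrite -mulrA [M * _]mulrC; apply: ler_wpM2l; first exact: ltW.
  exact: ler_wpM2l.
have sS : `|s x| <= 16 / 15 * `|S|.
  have := lerB_dist (s x) S; have := normr_ge0 (s x); clear - SS eM; nra.
have TT : `|T| <= e * `|u|.
  have := ft a (a + u); rewrite subrr normr0 ((h9 a).1 h6) subr0 [a + u - a]addrC addKr; apply=> //.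
pose k := T / S.
have kE : slope_ratio s t a dl u = k by rewrite /slope_ratio un2.
have k0 : 0 < k by rewrite -kE; apply: (slope_ratio_gt0 H); exact/eqP.
have kv : k * `|v| <= `|T| * (16 / 15 * M).
  have -> : k = `|T| / `|S| by rewrite -normf_div gtr0_norm.
  rewrite vN -!mulrA; apply: ler_wpM2l => //; rewrite mulrC ler_pdivrMr ?normr_gt0 //.
  have := ler_pM (normr_ge0 _) (normr_ge0 _) sS yM; clear; lra.
have kvu : k * `|v| <= `|u| / 8.
  have : `|T| * (16 / 15 * M) <= e * `|u| * (16 / 15 * M) by apply: ler_wpM2r => //; clear - M0; lra.
  by have := normr_ge0 u; clear - kv eM; nra.
have vu : `|v| <= `|u| / 8 by clear - vxi u2 xi0; lra.
(* Both |v| and k * |v| are at most |u| / 8, the linear range of [squeeze]. *)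
have XE : cone_x s t a dl xi u = u + k * v.
  rewrite /cone_x xiu -/v kE squeeze_lin //; exact: ltW.
rewrite XE; set x' := a + (u + k * v).
have kvn : `|k * v| = k * `|v| by rewrite normrM gtr0_norm.
have xa : `|x' - a| <= 2 * `|xi|.
  rewrite /x' addrC addKr; apply: le_trans (ler_normD _ _) _; rewrite kvn; clear - kvu u1 xi0; lra.
split => //.
have rx' : r x' = r a + eta * (u + k * v).
  by rewrite h11; [rewrite /x' [a + _ - a]addrC addKr|clear - xa xr r1 h1; lra].
have -> : (p - r x') / t x' = T / S * s x * y / t x'.
  rewrite pE rx' -/k vE.
  have -> : r a + eta * u - (r a + eta * (u + k * (- eta * s x * y))) =
    eta * eta * (k * s x * y) by ring.
  by rewrite eta2 mul1r.
apply: cone_bound => //; first exact: ltW.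
have x'dt : `|x' - a| < dt by clear - xa xr r3 dt0; lra.
rewrite -/T; have := ft (a + u) x'; rewrite [a + u - a]addrC addKr => /(_ udt x'dt).
have -> : x' - (a + u) = k * v by rewrite /x'; ring.
rewrite kvn -/T => h; apply: le_trans h _.
have : e * (k * `|v|) <= e * (`|T| * (16 / 15 * M)) by apply: ler_wpM2l => //; exact: ltW.
clear; lra.
Qed.

Lemma cone_map_continuous r s t a eta dl : cone_data r s t a eta dl ->
  continuous (cone_map r s t a eta dl).
Proof.
move=> H z; have [[h1 h2 h3 h4 h5] [[h6 h7 h8 h9] [h10 h11 h12 h13]]] := H.
have cz : {for z, continuous (fun w : R * R => w)} by cont.
have cs : {for z, continuous (fun w : R * R => s w.1)} by apply: comp_continuous_at h4; cont.
have cp : {for z, continuous (linear_like r s)} by exact: linear_like_continuous.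
have [sz|sz] := eqVneq (s z.1) 0; last first.
  pose X w := cone_x s t a dl (w.1 - a) (eta * (linear_like r s w - r a)).
  have za : z.1 - a != 0 by rewrite subr_eq0; apply/eqP => za; move: sz; rewrite za h6 eqxx.
  have c1 : {for z, continuous (fun w : R * R => w.1 - a)} by cont.
  have c2 : {for z, continuous (fun w : R * R => eta * (linear_like r s w - r a))} by cont.
  have cX : {for z, continuous X} := cone_x_continuous H c1 c2 za.
  apply: (@near_continuous_at _ _ _ (fun w => (a + X w, (linear_like r s w - r (a + X w)) / t (a + X w)))).
    by have := near_neq0 cs sz; apply: filterS => w; rewrite /cone_map => /negbTE ->.
  have c3 : {for z, continuous (fun w => a + X w)} by cont.
  have c4 := comp_continuous_at c3 h3; have c5 := comp_continuous_at c3 h5.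
  by cont; apply/eqP; apply: (cone_target H); exact/eqP.
(* Another zero is at distance at least 2 * dl from a, where the map is the identity; only nu_a
   requires the estimate. *)
have [za|/eqP za] := eqVneq z.1 a; last first.
  apply: (@near_continuous_at _ _ _ id); last by cont.
  have c1 : {for z, continuous (fun w : R * R => w.1 - a)} by cont.
  have c2 := norm_continuous_at c1.
  have c3 : {for z, continuous (fun w : R * R => `|w.1 - a| - 3 / 2 * dl)} by cont.
  have : 0 < `|z.1 - a| - 3 / 2 * dl.
    have : 2 * dl <= `|z.1 - a| by rewrite leNgt; apply/negP => /h12 /(_ sz).
    lra.
  move=> /(near_gt0 c3); apply: filterS => w h; apply: (cone_map_far H); lra.
have Kz : cone_map r s t a eta dl z = z by rewrite /cone_map sz eqxx.
set K := cone_map r s t a eta dl in Kz *.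
pose M := `|z.2| + 1.
have M0 : 1 <= M by rewrite /M lerDr.
have n1 : \forall w \near z, `|w.2| <= M.
  have c1 : {for z, continuous (fun w : R * R => w.2 - z.2)} by cont.
  have c2 := norm_continuous_at c1.
  have c3 : {for z, continuous (fun w : R * R => 1 - `|w.2 - z.2|)} by cont.
  have : 0 < 1 - `|z.2 - z.2| by rewrite subrr normr0 subr0.
  move=> /(near_gt0 c3); apply: filterS => w h.
  by have := ler_normD (w.2 - z.2) z.2; rewrite subrK /M; lra.
have n2 eps : 0 < eps -> \forall w \near z, `|w.1 - a| < eps.
  move=> eps0; have c1 : {for z, continuous (fun w : R * R => w.1 - a)} by cont.
  have c2 := norm_continuous_at c1.
  have c3 : {for z, continuous (fun w : R * R => eps - `|w.1 - a|)} by cont.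
  have : 0 < eps - `|z.1 - a| by rewrite za subrr normr0 subr0.
  by move=> /(near_gt0 c3); apply: filterS => w h; lra.
have n3 eps : 0 < eps -> \forall w \near z, `|w.2 - z.2| < eps.
  move=> eps0; have c1 : {for z, continuous (fun w : R * R => w.2 - z.2)} by cont.
  have c2 := norm_continuous_at c1.
  have c3 : {for z, continuous (fun w : R * R => eps - `|w.2 - z.2|)} by cont.
  have : 0 < eps - `|z.2 - z.2| by rewrite subrr normr0 subr0.
  by move=> /(near_gt0 c3); apply: filterS => w h; lra.
have M00 : 0 <= M by lra.
have k1 : {for z, continuous (fun w => (K w).1)}.
  have Kz1 : (K z).1 = a by rewrite Kz.
  apply/cvgrPdist_lt => eps eps0; rewrite Kz1.
  pose e := (16 * M)^-1; have e0 : 0 < e by rewrite invr_gt0; lra.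
  have eM : 16 * (e * M) <= 1 by rewrite mulrCA mulVf //; lra.
  have [rho rho0 est] := cone_map_estimate H e0 M00 eM.
  have eps2 : 0 < eps / 2 by lra.
  have nr := n2 _ rho0; have ne := n2 _ eps2.
  near=> w.
  have w1 : `|w.2| <= M by near: w.
  have w2 : `|w.1 - a| < rho by near: w.
  have w3 : `|w.1 - a| < eps / 2 by near: w.
  by have [k _] := est w w2 w1; rewrite distrC; lra.
have k2 : {for z, continuous (fun w => (K w).2)}.
  have Kz2 : (K z).2 = z.2 by rewrite Kz.
  apply/cvgrPdist_lt => eps eps0; rewrite Kz2.
  (* The first bound makes the estimate applicable, the second brings its error below eps / 2. *)
  pose e := Num.min (16 * M)^-1 (eps / (8 * M ^+ 2)).
  have M2 : 0 < M ^+ 2 by nra.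
  have e0 : 0 < e by rewrite lt_min; apply/andP; split; [rewrite invr_gt0; lra|apply: divr_gt0 => //; lra].
  have e1 : e <= (16 * M)^-1 by rewrite ge_min lexx.
  have e2 : e <= eps / (8 * M ^+ 2) by rewrite ge_min lexx orbT.
  have eM : 16 * (e * M) <= 1.
    have : (16 * M)^-1 * (16 * M) = 1 by rewrite mulVf //; lra.
    by move=> E; have : e * (16 * M) <= (16 * M)^-1 * (16 * M); [apply: ler_wpM2r => //; lra|lra].
  have eM2 : 3 * e * M ^+ 2 <= eps / 2.
    have : eps / (8 * M ^+ 2) * (8 * M ^+ 2) = eps by rewrite divfK //; lra.
    by move=> E; have : e * (8 * M ^+ 2) <= eps / (8 * M ^+ 2) * (8 * M ^+ 2); [apply: ler_wpM2r => //; lra|lra].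
  have [rho rho0 est] := cone_map_estimate H e0 M00 eM.
  have eps2 : 0 < eps / 2 by lra.
  have nr := n2 _ rho0; have ne := n3 _ eps2.
  near=> w.
  have w1 : `|w.2| <= M by near: w.
  have w2 : `|w.1 - a| < rho by near: w.
  have w3 : `|w.2 - z.2| < eps / 2 by near: w.
  have [_ k] := est w w2 w1; rewrite distrC.
  have -> : (K w).2 - z.2 = ((K w).2 - w.2) + (w.2 - z.2) by ring.
  by apply: le_lt_trans (ler_normD _ _) _; lra.
have -> : K = fun w => ((K w).1, (K w).2) by apply/funext => w; exact: surjective_pairing.
by cont.
Unshelve. all: by end_near. Qed.

Lemma level_equiv_cone r s t a eta dl : cone_data r s t a eta dl ->
  level_equiv (linear_like r s) (linear_like r t).
Proof.
move=> H; have H' := cone_data_sym H; have [[h1 _ _ _ _] _] := H.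
exists (cone_map r s t a eta dl), (cone_map r t s a eta dl), id, id; split; split.
- exact: cone_map_continuous.
- exact: cone_map_continuous.
- exact: cone_mapK.
- exact: cone_mapK.
- by split.
- by move=> z; rewrite (cone_map_level H).
- move=> M; exists (Num.max M (a + 2 * dl)) => z w.
  rewrite !gt_max => /andP[z1 z2] /andP[w1 w2].
  by rewrite !(cone_map_far H) //; rewrite ger0_norm; lra.
Qed.

End ConeContinuity.

(** * Synthesis from the combinatorial data *)

Section Construction.
Context {R : realType}.
Implicit Types (r s t d phi : R -> R) (z w : R * R) (a dl x y : R).

Lemma incb_of_continuous (f : R -> R) : continuous f -> {homo f : x y / x < y} ->
  (forall y, exists x, f x <= y) -> (forall y, exists x, y <= f x) -> exists g, incb f g.
Proof.
move=> cf hf lo hi.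
have m := leW_mono (le_mono hf).
have surj y : exists x, f x = y.
  have [x1 h1] := lo y; have [x2 h2] := hi y.
  have x12 : x1 <= x2 by rewrite leNgt; apply/negP; rewrite -m; lra.
  have [||x _ <-] := @IVT R f x1 x2 y x12; last by exists x.
    exact: continuous_subspaceT.
  have := le_trans h1 h2 => h; rewrite (min_idPl h) (max_idPr h); lra.
have [g gK] := choice surj; exists g; split => //.
exact: (inj_can_sym gK (inc_inj (le_mono hf))).
Qed.

(** Beyond a - dl / 2 and a + dl / 2 the function is continued with slope 1. *)
Lemma incb_extend (f : R -> R) a dl : 0 < dl -> continuous f ->
  (forall x y, a - dl < x -> x < y -> y < a + dl -> f x < f y) ->
  exists G G', incb G G' /\ forall x, `|x - a| < dl / 2 -> G x = f x.
Proof.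
move=> dl0 cf hf.
pose lo := a - dl / 2; pose hi := a + dl / 2.
pose c x := Num.max lo (Num.min x hi).
have loh : lo < hi by rewrite /lo /hi; lra.
have cE x : [\/ x <= lo /\ c x = lo, (lo <= x /\ x <= hi) /\ c x = x | hi <= x /\ c x = hi].
  rewrite /c; case: (lerP x hi) => xh.
    case: (lerP lo x) => xl; first by apply: Or32.
    by apply: Or31; split => //; exact: ltW.
  by apply: Or33; rewrite (max_idPr (ltW loh)); split=> //; exact: ltW.
have cc : continuous c.
  move=> x; apply: (@max_continuous_at R R (fun=> lo) (fun x => Num.min x hi)); first by cont.
  by apply: (@min_continuous_at R R (fun x => x) (fun=> hi)); cont.
pose G x := f (c x) + (x - c x).
have cG : continuous G.
  by move=> x; have c1 := cc x; have c2 := comp_continuous_at c1 cf; rewrite /G; cont.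
have hG : {homo G : x y / x < y}.
  have hf' x y : lo <= x -> x < y -> y <= hi -> f x < f y.
    by rewrite /lo /hi => h1 h2 h3; apply: hf => //; lra.
  move=> x y xy; rewrite /G.
  case: (cE x) => -[h1 ->]; case: (cE y) => -[h2 ->]; try lra.
  - have [e|e] := eqVneq lo y; first by rewrite -e; lra.
    have : f lo < f y by apply: hf'; [|rewrite lt_neqAle e|]; lra.
    lra.
  - have : f lo < f hi by apply: hf'. 
    lra.
  - have : f x < f y by apply: hf'; lra.
    lra.
  - have [e|e] := eqVneq x hi; first by rewrite e; lra.
    have : f x < f hi by apply: hf'; [|rewrite lt_neqAle e|]; lra.
    lra.
have [||G' GG] := incb_of_continuous cG hG.
- move=> y; exists (Num.min lo (lo + (y - f lo))); rewrite /G.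
  have ml : Num.min lo (lo + (y - f lo)) <= lo by rewrite ge_min lexx.
  have m2 : Num.min lo (lo + (y - f lo)) <= lo + (y - f lo) by rewrite ge_min lexx orbT.
  have -> : c (Num.min lo (lo + (y - f lo))) = lo by case: (cE (Num.min lo (lo + (y - f lo)))) => -[h ->]; lra.
  lra.
- move=> y; exists (Num.max hi (hi + (y - f hi))); rewrite /G.
  have ml : hi <= Num.max hi (hi + (y - f hi)) by rewrite le_max lexx.
  have m2 : hi + (y - f hi) <= Num.max hi (hi + (y - f hi)) by rewrite le_max lexx orbT.
  have -> : c (Num.max hi (hi + (y - f hi))) = hi by case: (cE (Num.max hi (hi + (y - f hi)))) => -[h ->]; lra.
  lra.
exists G, G'; split => // x; rewrite ltr_norml => /andP[h1 h2].
rewrite /G; have -> : c x = x by case: (cE x) => -[]; rewrite /lo /hi => h ->; lra.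
by rewrite subrr addr0.
Qed.

Definition normal_at r s d a := (\forall x \near a, r x = r a + d a * (x - a)) /\ flat_at s a.

(** Near a zero a the new abscissa is a + d a * (r x - r a), in which r is affine. Tameness bounds
    increments of s by those of r, so in this abscissa it becomes flatness. *)
Lemma tame_normalize r s d : tame r s d -> exists phi phi',
  [/\ incb phi phi', forall a, s a = 0 -> phi a = a &
    forall a, s a = 0 -> normal_at (r \o phi') (s \o phi') d a].
Proof.
move=> [cr cs fZ T].
have [A AE] := (finite_seqP _).1 fZ.
have ZA a : s a = 0 <-> a \in A by rewrite -[s a = 0]/(zeros s a) AE.
have germ a : exists G, a \in A -> (exists G', incb G G') /\
    \forall x \near a, G x = a + d a * (r x - r a).
  have [aA|aA] := boolP (a \in A); last by exists id.
  have [da /(_ 1 ltr01) [dl dl0 K]] := T a ((ZA a).2 aA).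
  have cf : continuous (fun x => a + d a * (r x - r a)).
    by move=> x; have c1 := cr x; cont.
  have [|G [G' [GG GE]]] := @incb_extend (fun x => a + d a * (r x - r a)) a dl dl0 cf.
    by move=> x y h1 h2 h3; have [_] := K x y h1 h2 h3; lra.
  exists G => _; split; first by exists G'.
  apply/nbhs_ballP; exists (dl / 2) => /=; first lra.
  by move=> x; rewrite /ball /= distrC => /GE.
have [G GP] := choice germ.
have Ga a : a \in A -> G a a = a.
  by move=> /GP [_ /nbhs_singleton ->]; rewrite subrr mulr0 addr0.
have [||phi [phi' [pp pG]]] := @incb_germs R A G.
- by move=> a /GP [].
- by move=> a b aA bA ab; rewrite !Ga.
exists phi, phi'; have pa a : a \in A -> phi a = a.
  by move=> aA; have /nbhs_singleton -> := pG a aA; exact: Ga.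
split => // [a /ZA /pa //|a /ZA aA].
have [_ pK pK'] := pp.
have p'a : phi' a = a by rewrite -{1}(pa a aA) pK.
have cp' := incb_continuous (incb_sym pp).
have [da H] := T a ((ZA a).2 aA).
have N : \forall x \near a, phi x = a + d a * (r x - r a).
  by apply: filterS2 (pG a aA) (GP a aA).2 => x -> ->.
have N' : \forall x \near a, x = a + d a * (r (phi' x) - r a).
  have N0 : \forall x \near phi' a, phi x = a + d a * (r x - r a) by rewrite p'a.
  have N1 : \forall x \near a, phi (phi' x) = a + d a * (r (phi' x) - r a) := cp' a _ N0.
  by apply: filterS N1 => x; rewrite pK'.
have d2 : d a * d a = 1 by case: da => ->; ring.
split.
  apply: filterS N' => x /= E; rewrite p'a.
  have : x - a = d a * (r (phi' x) - r a) by rewrite {1}E addrC addKr.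
  by move=> ->; rewrite mulrA d2 mul1r addrC subrK.
move=> e e0; have [dl dl0 K] := H e e0.
have N2 : \forall x \near a, `|phi' x - a| < dl.
  have /cvgrPdist_lt /(_ _ dl0) := cp' a; apply: filterS => x.
  by rewrite p'a distrC.
have NN : \forall x \near a, x = a + d a * (r (phi' x) - r a) /\ `|phi' x - a| < dl.
  exact: filterI N' N2.
move: NN => /nbhs_ballP [dl' /= dl'0 B].
exists dl' => // x y xa ya.
have {xa} [xE xl] : x = a + d a * (r (phi' x) - r a) /\ `|phi' x - a| < dl.
  by apply: B; rewrite /ball /= distrC.
have {ya} [yE yl] : y = a + d a * (r (phi' y) - r a) /\ `|phi' y - a| < dl.
  by apply: B; rewrite /ball /= distrC.
rewrite /=; wlog xy : x y xE xl yE yl / x <= y.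
  move=> W; have /orP [xy|xy] := le_total x y; first exact: (W x y xE xl yE yl xy).
  have := W y x yE yl xE xl xy; by rewrite [`|x - y|]distrC [`|s (phi' x) - _|]distrC.
move: xy; rewrite le_eqVlt => /predU1P[->|xy]; first by rewrite !subrr normr0 mulr0.
move: xl yl; rewrite !ltr_norml => /andP[? ?] /andP[? ?].
have [|||k1 k2] := K (phi' x) (phi' y); try lra.
  by rewrite (incb_mono (incb_sym pp)).
apply: le_trans k1 _; apply: ler_wpM2l; first exact: ltW.
have E : y - x = d a * (r (phi' y) - r (phi' x)) by rewrite {1}yE {1}xE; ring.
by rewrite -E ler_norm.
Qed.

Lemma flat_at_near s t a : (\forall x \near a, s x = t x) -> flat_at t a -> flat_at s a.
Proof.
move=> /nbhs_ballP [d1 /= d10 B] F e e0; have [d2 d20 K] := F e e0.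
exists (Num.min d1 d2); first by rewrite lt_min d10.
move=> x y; rewrite !lt_min => /andP[x1 x2] /andP[y1 y2].
by rewrite !B ?K // /ball /= distrC.
Qed.

Lemma flat_at_shift s phi a c : phi a = a + c -> (\forall x \near a, phi x = x + c) ->
  flat_at s (phi a) -> flat_at (s \o phi) a.
Proof.
move=> pa /nbhs_ballP [d1 /= d10 B] F e e0; have [d2 d20 K] := F e e0.
exists (Num.min d1 d2); first by rewrite lt_min d10.
move=> x y; rewrite !lt_min => /andP[x1 x2] /andP[y1 y2] /=.
have xE : phi x = x + c by apply: B; rewrite /ball /= distrC.
have yE : phi y = y + c by apply: B; rewrite /ball /= distrC.
have := K (phi x) (phi y); rewrite xE yE pa.
have -> : x + c - (a + c) = x - a by ring.
have -> : y + c - (a + c) = y - a by ring.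
have -> : y + c - (x + c) = y - x by ring.
by apply.
Qed.

End Construction.

(** * Changing s near its zeros and assembling the equivalence *)

Section Synthesis.
Context {R : realType}.
Implicit Types (r s t d phi : R -> R) (z w : R * R) (a b dl x y : R).

Lemma mul_gt0_trans (u v w : R) : 0 < u * v -> 0 < v * w -> 0 < u * w.
Proof.
move=> uv vw; have v0 : v != 0 by apply/eqP => v0; move: uv; rewrite v0 mulr0 ltxx.
have v2 : 0 < v ^+ 2 by rewrite exprn_even_gt0.
rewrite -(pmulr_lgt0 _ v2); have -> : u * w * v ^+ 2 = (u * v) * (v * w) by ring.
exact: mulr_gt0.
Qed.

Lemma mul_gt0_neq0 (u v : R) : 0 < u * v -> u <> 0 /\ v <> 0.
Proof.
by move=> uv; split => E; move: uv; rewrite E ?mulr0 ?mul0r ltxx.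
Qed.

Definition cutoff a dl x : R := Num.max 0 (Num.min 1 (2 - 2 * `|x - a| / dl)).

Lemma cutoff_itv a dl x : 0 <= cutoff a dl x <= 1.
Proof. by rewrite le_max lexx /= ge_max ler01 ge_min lexx. Qed.

Lemma cutoff_far a dl x : 0 < dl -> dl <= `|x - a| -> cutoff a dl x = 0.
Proof.
move=> dl0 h; apply/max_idPl; rewrite ge_min; apply/orP; right.
have E : 2 * `|x - a| / dl * dl = 2 * `|x - a| by rewrite divfK // lt0r_neq0.
by rewrite -(pmulr_lle0 _ dl0) mulrBl E; lra.
Qed.

Lemma cutoff_near a dl x : 0 < dl -> `|x - a| <= dl / 2 -> cutoff a dl x = 1.
Proof.
move=> dl0 h; have E : 2 * `|x - a| / dl * dl = 2 * `|x - a| by rewrite divfK // lt0r_neq0.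
have k : 1 <= 2 - 2 * `|x - a| / dl by rewrite -(ler_pM2r dl0) mulrBl E; lra.
by rewrite /cutoff (min_idPl k); apply/max_idPr.
Qed.

Lemma cutoff_continuous a dl : continuous (cutoff a dl).
Proof.
move=> x; have c1 : {for x, continuous (fun x => x - a)} by cont.
have c2 := norm_continuous_at c1.
apply: (@max_continuous_at R R (fun=> 0) (fun x => Num.min 1 (2 - 2 * `|x - a| / dl))); first by cont.
by apply: (@min_continuous_at R R (fun=> 1) (fun x => 2 - 2 * `|x - a| / dl)); cont.
Qed.

(** Induction on the list of zeros, one cone map for each; r never changes. *)
Lemma level_equiv_zeros r s t d (A : seq R) : continuous r -> continuous s -> continuous t ->
  finite_set (zeros s) -> (forall x, s x = 0 <-> t x = 0) ->
  (forall x, s x <> 0 -> 0 < s x * t x) ->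
  (forall a, s a = 0 -> d a = 1 \/ d a = -1) ->
  (forall a, s a = 0 -> [/\ normal_at r s d a & flat_at t a]) ->
  (forall a, a \in A -> s a = 0) ->
  exists u, [/\ continuous u, forall x, s x = 0 <-> u x = 0,
    forall x, s x <> 0 -> 0 < s x * u x,
    forall a, s a = 0 -> flat_at u a & 
    forall a, a \in A -> \forall x \near a, u x = t x] /\
    level_equiv (linear_like r s) (linear_like r u).
Proof.
move=> cr cs ct fZ st pos dP nP; elim: A => [_|a A IH AZ].
  exists s; split.
    split => // [x sx|a /nP [[]]] //.
    by rewrite -expr2 exprn_even_gt0 //; exact/eqP.
  have ii : incb (@id R) id by split.
  apply: (@level_equiv_fibre _ r s r s id id id id) => //.
    by move=> x sx; rewrite -expr2 exprn_even_gt0 //; exact/eqP.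
  by move=> z _; apply: filterE => w; rewrite -surjective_pairing.
have [|u [[cu su pu fu nu] le]] := IH; first by move=> b bA; apply: AZ; rewrite inE bA orbT.
have sa : s a = 0 by apply: AZ; rewrite mem_head.
have [[na _] fta] := nP a sa.
have [dl dl0 [Hr Hz]] : exists2 dl, 0 < dl & (forall x, `|x - a| < 2 * dl -> r x = r a + d a * (x - a)) /\
    (forall x, `|x - a| < 2 * dl -> u x = 0 -> x = a).
  have /nbhs_ballP [d1 /= d10 B1] := na.
  have [d2 d20 B2] := finite_isolated a fZ.
  exists (Num.min (d1 / 2) (d2 / 2)); first by rewrite lt_min; apply/andP; split; lra.
  have m1 : Num.min (d1 / 2) (d2 / 2) <= d1 / 2 by rewrite ge_min lexx.
  have m2 : Num.min (d1 / 2) (d2 / 2) <= d2 / 2 by rewrite ge_min lexx orbT.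
  split => x xa.
    by apply: B1; rewrite /ball /= distrC; lra.
  by move=> /su; apply: B2; lra.
(* A convex combination of two functions having the sign of s keeps that sign, hence the zeros. *)
pose v x := cutoff a dl x * t x + (1 - cutoff a dl x) * u x.
have cv : continuous v.
  by move=> x; have c1 := @cutoff_continuous a dl x; have c2 := ct x; have c3 := cu x; rewrite /v; cont.
have vfar x : dl <= `|x - a| -> v x = u x.
  by move=> h; rewrite /v cutoff_far // mul0r add0r subr0 mul1r.
have vnear : \forall x \near a, v x = t x.
  apply/nbhs_ballP; exists (dl / 2) => /=; first lra.
  move=> x; rewrite /ball /= distrC => h.
  by rewrite /v cutoff_near ?ltW // subrr mul0r addr0 mul1r.
have sv x : s x <> 0 -> 0 < s x * v x.
  move=> sx; have p1 := pos x sx; have p2 := pu x sx.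
  have /andP[c0 c1] := cutoff_itv a dl x.
  have -> : s x * v x = cutoff a dl x * (s x * t x) + (1 - cutoff a dl x) * (s x * u x) by rewrite /v; ring.
  set c := cutoff a dl x in c0 c1 *; set P := s x * t x in p1 *; set Q := s x * u x in p2 *.
  by clear - c0 c1 p1 p2; nra.
have vz x : s x = 0 <-> v x = 0.
  split => [sx|vx]; first by rewrite /v (st x).1 // (su x).1 // !mulr0 addr0.
  by apply: contrapT => /sv; rewrite vx mulr0 ltxx.
have vn b : b <> a -> s b = 0 -> \forall x \near b, v x = u x.
  move=> ba sb; have bl : 2 * dl <= `|b - a|.
    by rewrite leNgt; apply/negP => /Hz => /(_ ((su b).1 sb)).
  have c1 : {for b, continuous (fun x : R => x - a)} by cont.
  have c2 := norm_continuous_at c1.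
  have c3 : {for b, continuous (fun x : R => `|x - a| - dl)} by cont.
  have : 0 < `|b - a| - dl by lra.
  by move=> /(near_gt0 c3); apply: filterS => x h; apply: vfar; lra.
have fv b : s b = 0 -> flat_at v b.
  move=> sb; have [->|/eqP ba] := eqVneq b a; first exact: flat_at_near vnear fta.
  by apply: flat_at_near (fu b sb); exact: vn.
exists v; split; first split => //.
  move=> b; rewrite inE => /predU1P[->//|bA].
  have [->//|/eqP ba] := eqVneq b a.
  have sb : s b = 0 by apply: AZ; rewrite inE bA orbT.
  by apply: filterS2 (vn b ba sb) (nu b bA) => x -> ->.
apply: level_equiv_trans le _; apply: (@level_equiv_cone _ r u v a (d a) dl).
split; first by split=> //; exact: dP.
split; first split.
- exact/su.
- exact: fu.
- exact: fv.
- by move=> x; rewrite -su vz.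
- split => //.
  + move=> x ux; apply: (@mul_gt0_trans _ (s x)); first by rewrite mulrC; apply: pu => /su.
    by apply: sv => /su.
  + by move=> x /vfar.
Qed.

(* beta being the bijection between the zeros of s1 and s2, corresponding strips
   carry coefficients of the same sign. *)
Definition strips_agree s1 s2 (beta : R -> R) := forall x y, s1 x <> 0 -> s2 y <> 0 ->
  (forall a, s1 a = 0 -> (a < x) = (beta a < y)) -> 0 < s1 x * s2 y.

(** First s1 is replaced by a function equal to s2 o phi near the zeros; then the fibre map along
    phi and l is a translation of abscissas near each vertical line. *)
Lemma level_equiv_normal r1 s1 d1 r2 s2 d2 (beta sigma : R -> R) :
  continuous r1 -> continuous s1 -> continuous r2 -> continuous s2 ->
  finite_set (zeros s1) ->
  (forall a, s1 a = 0 -> normal_at r1 s1 d1 a) ->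
  (forall a, s2 a = 0 -> normal_at r2 s2 d2 a) ->
  (forall a, s1 a = 0 -> d1 a = 1 \/ d1 a = -1) ->
  (forall a, s1 a = 0 -> [/\ s2 (beta a) = 0, d1 a = d2 (beta a) & sigma (r1 a) = r2 (beta a)]) ->
  (forall b, s2 b = 0 -> exists2 a, s1 a = 0 & beta a = b) ->
  (forall a b, s1 a = 0 -> s1 b = 0 -> a < b -> beta a < beta b) ->
  (forall a b, s1 a = 0 -> s1 b = 0 -> r1 a < r1 b -> sigma (r1 a) < sigma (r1 b)) ->
  strips_agree s1 s2 beta ->
  level_equiv (linear_like r1 s1) (linear_like r2 s2).
Proof.
move=> cr1 cs1 cr2 cs2 fZ n1 n2 dP bP surj bmono smono agree.
have [A AE] := (finite_seqP _).1 fZ.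
have ZA a : s1 a = 0 <-> a \in A by rewrite -[s1 a = 0]/(zeros s1 a) AE.
have [||phi [phi' [pp pG]]] := @incb_germs R A (fun a x => x + (beta a - a)).
- by move=> a _; exists (fun x => x - (beta a - a)); exact: incb_shift.
- by move=> a b /ZA sa /ZA sb ab; rewrite ![_ + (_ - _)]addrC !subrK; exact: bmono.
(* The germs of l are indexed by values, not by zeros: zeros with the same r1 share one. *)
have [||l [l' [ll lG]]] := @incb_germs R [seq r1 a | a <- A] (fun c x => x + (sigma c - c)).
- by move=> a _; exists (fun x => x - (sigma a - a)); exact: incb_shift.
- move=> c c' /mapP [a /ZA sa ->] /mapP [b /ZA sb ->] ab.
  by rewrite ![_ + (_ - _)]addrC !subrK; exact: smono.
have [_ pK pK'] := pp.
have pa a : s1 a = 0 -> phi a = beta a.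
  by move=> /ZA aA; have /nbhs_singleton -> := pG a aA; rewrite addrC subrK.
have zz x : s1 x = 0 <-> s2 (phi x) = 0.
  split => [sx|/surj [a sa]]; first by rewrite pa //; have [] := bP x sx.
  by rewrite -(pa a sa) => /(can_inj pK) <-.
have pos x : s1 x <> 0 -> 0 < s1 x * s2 (phi x).
  move=> sx; apply: agree => //; first by move=> /zz.
  by move=> a sa; rewrite -pa // (incb_mono pp).
have cp := incb_continuous pp.
have ct : continuous (s2 \o phi) by move=> x; exact: (continuous_comp (cp x) (cs2 _)).
have ft a : s1 a = 0 -> flat_at (s2 \o phi) a.
  move=> sa; apply: (@flat_at_shift _ s2 phi a (beta a - a)).
  - by rewrite pa // addrC subrK.
  - by apply: pG; exact/ZA.
  - by rewrite pa //; have [sb _ _] := bP a sa; have [] := n2 _ sb.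
have [||u [[cu su pu _ nu] le]] := @level_equiv_zeros r1 s1 (s2 \o phi) d1 A cr1 cs1 ct fZ zz pos dP.
- by move=> a sa; split; [exact: n1|exact: ft].
- by move=> a /ZA.
apply: level_equiv_trans le _.
apply: (@level_equiv_fibre _ r1 u r2 s2 phi phi' l l') => //.
- by move=> x; rewrite -su zz.
- move=> x ux; apply: (@mul_gt0_trans _ (s1 x)); first by rewrite mulrC; apply: pu => /su.
  by apply: pos => /su.
- move=> z uz; have sz : s1 z.1 = 0 by exact/su.
  have zA : z.1 \in A by exact/ZA.
  have [sb dE sE] := bP _ sz.
  have m1 : \forall w \near z, r1 w.1 = r1 z.1 + d1 z.1 * (w.1 - z.1) := nbhs_fst (n1 _ sz).1.
  have m2 : \forall w \near z, phi w.1 = w.1 + (beta z.1 - z.1) := nbhs_fst (pG _ zA).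
  have m3 : \forall w \near z, u w.1 = s2 (phi w.1) := nbhs_fst (nu _ zA).
  have m4 : \forall w \near z, r2 (phi w.1) = r2 (beta z.1) + d2 (beta z.1) * (phi w.1 - beta z.1).
    have k : \forall x \near z.1, r2 (phi x) = r2 (beta z.1) + d2 (beta z.1) * (phi x - beta z.1).
      have k0 : \forall x \near phi z.1, r2 x = r2 (beta z.1) + d2 (beta z.1) * (x - beta z.1).
        by rewrite (pa _ sz); exact: (n2 _ sb).1.
      exact: (cp z.1 _ k0).
    exact: nbhs_fst k.
  have pz : linear_like r1 u z = r1 z.1 by rewrite /linear_like uz mul0r addr0.
  have m5 : \forall w \near z, l (linear_like r1 u w) = linear_like r1 u w + (sigma (r1 z.1) - r1 z.1).
    have k0 : \forall c \near linear_like r1 u z, l c = c + (sigma (r1 z.1) - r1 z.1).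
      by rewrite pz; apply: lG; exact: map_f.
    exact: (linear_like_continuous cr1 cu (x := z) k0).
  (* Both sides are affine in x with the same slope and their s-terms agree, so levels match with
     the height unchanged. *)
  near=> w.
  have e1 : r1 w.1 = r1 z.1 + d1 z.1 * (w.1 - z.1) by near: w.
  have e2 : phi w.1 = w.1 + (beta z.1 - z.1) by near: w.
  have e3 : u w.1 = s2 (phi w.1) by near: w.
  have e4 : r2 (phi w.1) = r2 (beta z.1) + d2 (beta z.1) * (phi w.1 - beta z.1) by near: w.
  have -> : l (linear_like r1 u w) = linear_like r1 u w + (sigma (r1 z.1) - r1 z.1) by near: w.
  by rewrite /linear_like /= e1 e3 e4 sE -dE e2; ring.
Unshelve. all: by end_near. Qed.

(** Normalizing both functions fixes the zeros and the values of r there, so the combinatorial data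
    are unaffected. *)
Theorem level_equiv_of_data r1 s1 d1 r2 s2 d2 (beta sigma : R -> R) :
  tame r1 s1 d1 -> tame r2 s2 d2 ->
  (forall a, s1 a = 0 -> [/\ s2 (beta a) = 0, d1 a = d2 (beta a) & sigma (r1 a) = r2 (beta a)]) ->
  (forall b, s2 b = 0 -> exists2 a, s1 a = 0 & beta a = b) ->
  (forall a b, s1 a = 0 -> s1 b = 0 -> a < b -> beta a < beta b) ->
  (forall a b, s1 a = 0 -> s1 b = 0 -> r1 a < r1 b -> sigma (r1 a) < sigma (r1 b)) ->
  strips_agree s1 s2 beta ->
  level_equiv (linear_like r1 s1) (linear_like r2 s2).
Proof.
move=> T1 T2 bP surj bmono smono agree.
have [cr1 cs1 fZ1 D1] := T1; have [cr2 cs2 fZ2 D2] := T2.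
have [f1 [g1 [i1 fx1 n1]]] := tame_normalize T1.
have [f2 [g2 [i2 fx2 n2]]] := tame_normalize T2.
have [_ K1 K1'] := i1; have [_ K2 K2'] := i2.
have gx1 a : s1 a = 0 -> g1 a = a by move=> sa; rewrite -{1}(fx1 a sa) K1.
have gx2 a : s2 a = 0 -> g2 a = a by move=> sa; rewrite -{1}(fx2 a sa) K2.
have z1 x : s1 (g1 x) = 0 -> s1 x = 0.
  by move=> sx; have := fx1 _ sx; rewrite K1' => E; rewrite {1}E.
have z2 x : s2 (g2 x) = 0 -> s2 x = 0.
  by move=> sx; have := fx2 _ sx; rewrite K2' => E; rewrite {1}E.
have cg1 := incb_continuous (incb_sym i1); have cg2 := incb_continuous (incb_sym i2).
have cc (f g : R -> R) : continuous f -> continuous g -> continuous (f \o g).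
  by move=> cf cg x; exact: (continuous_comp (cg x) (cf _)).
have ii : incb (@id R) id by split.
have sq (x : R) : x <> 0 -> 0 < x * x by move=> x0; rewrite -expr2 exprn_even_gt0 //; exact/eqP.
have L1 : level_equiv (linear_like r1 s1) (linear_like (r1 \o g1) (s1 \o g1)).
  apply: (@level_equiv_fibre _ r1 s1 (r1 \o g1) (s1 \o g1) f1 g1 id id); try exact: cc; rewrite //=.
  - by move=> x; rewrite K1.
  - by move=> x sx; rewrite K1; exact: sq.
  - by move=> z _; apply: filterE => w; rewrite /linear_like /= K1.
have L2 : level_equiv (linear_like (r2 \o g2) (s2 \o g2)) (linear_like r2 s2).
  apply: (@level_equiv_fibre _ (r2 \o g2) (s2 \o g2) r2 s2 g2 f2 id id); try exact: cc; rewrite //=.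
  - exact: incb_sym.
  - by move=> x sx; exact: sq.
  - by move=> z _; apply: filterE => w.
apply: level_equiv_trans L1 _; apply: level_equiv_trans _ L2.
apply: (@level_equiv_normal (r1 \o g1) (s1 \o g1) d1 (r2 \o g2) (s2 \o g2) d2 beta sigma); try exact: cc.
- by apply: sub_finite_set fZ1 => x /z1.
- by move=> a /z1 /n1.
- by move=> a /z2 /n2.
- by move=> a /z1 /D1 [].
- move=> a /z1 sa; have [sb dE sE] := bP a sa.
  by rewrite /= !gx1 // !gx2.
- move=> b /z2 /surj [a sa <-]; exists a => //=; by rewrite gx1.
- by move=> a b /z1 sa /z1 sb; exact: bmono.
- by move=> a b /z1 sa /z1 sb; rewrite /= !gx1 //; exact: smono.
- move=> x y /= sx sy H; apply: agree => // a sa.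
  have [sb _ _] := bP a sa.
  have := H a; rewrite /= gx1 // => /(_ sa).
  rewrite -(incb_mono (incb_sym i1)) (gx1 a sa) => ->.
  by rewrite -(incb_mono (incb_sym i2)) gx2.
Qed.

End Synthesis.

(** * Smooth functions and the theorem *)

Section SmoothTame.
Context {R : realType}.
Implicit Types (r s d : R -> R) (z w : R * R) (a b x y : R).

Lemma smooth_derivable (f : R -> R) x : smooth f -> derivable f x 1.
Proof. by move=> /(_ 0%N x); rewrite derive1n0. Qed.

Lemma derivable_continuous (f : R -> R) : (forall x, derivable f x 1) -> continuous f.
Proof. by move=> df x; apply/differentiable_continuous/derivable1_diffP. Qed.

Lemma smooth_continuous (f : R -> R) : smooth f -> continuous f.
Proof. by move=> sf; apply: derivable_continuous => x; exact: smooth_derivable. Qed.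

Lemma smooth_derive1_continuous (f : R -> R) : smooth f -> continuous (f^`())%classic.
Proof. by move=> sf; apply: derivable_continuous => x; have := sf 1%N x; rewrite derive1n1. Qed.

Lemma gradient_linear_like r s a y : derivable r a 1 -> derivable s a 1 -> s a = 0 ->
  gradient (linear_like r s) (a, y) = ((r^`())%classic a + (s^`())%classic a * y, 0).
Proof.
move=> dr ds sa; rewrite /gradient; congr (_, _).
  have -> : 'D_((1, 0) : R * R) (linear_like r s) (a, y) = 'D_1 (fun x => r x + s x * y) a.
    rewrite /derive; set F := (X in lim (X @ _)); set G := (X in _ = lim (X @ _)).
    suff -> : F = G by [].
    by apply/funext => h; rewrite /F /G /linear_like /= scaler0 add0r.
  rewrite !derive1E.
  have D1 : is_derive a 1 r ('D_1 r a) := derivableP dr.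
  have D2 : is_derive a 1 s ('D_1 s a) := derivableP ds.
  have D : is_derive a 1 (r + s * cst y) ('D_1 r a + (s a *: 0 + cst y a *: 'D_1 s a)).
    exact: is_deriveD.
  have -> : (fun x => r x + s x * y) = r + s * cst y by [].
  by rewrite derive_val scaler0 add0r /= mulrC.
have -> : 'D_((0, 1) : R * R) (linear_like r s) (a, y) = 'D_1 (cst (r a) : R -> R) a.
  rewrite /derive; set F := (X in lim (X @ _)); set G := (X in _ = lim (X @ _)).
  suff -> : F = G by [].
  by apply/funext => h; rewrite /F /G /linear_like /= scaler0 add0r sa !mul0r addr0 !subrr !scaler0.
exact: derive_cst.
Qed.

(** Over a, the gradient is (r' + s' y, 0): an affine function of y without zeros is a nonzero
    constant. *)
Lemma submersion_zero r s a : smooth r -> smooth s -> submersion (linear_like r s) ->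
  s a = 0 -> (s^`())%classic a = 0 /\ (r^`())%classic a != 0.
Proof.
move=> sr ss sub sa.
have N y : (r^`())%classic a + (s^`())%classic a * y <> 0.
  move=> E; apply: (sub (a, y)); rewrite gradient_linear_like //; try exact: smooth_derivable.
  by rewrite E.
have s0 : (s^`())%classic a = 0.
  apply/eqP/negPn/negP => s0; apply: (N (- (r^`())%classic a / (s^`())%classic a)).
  by rewrite mulrC divfK // subrr.
by split => //; apply/eqP => r0; apply: (N 0); rewrite mulr0 addr0.
Qed.

Lemma smooth_MVT (f : R -> R) x y : smooth f -> x < y ->
  exists c, [/\ x < c, c < y & f y - f x = (f^`())%classic c * (y - x)].
Proof.
move=> sf xy; have [|| c] := @MVT R f (f^`())%classic x y xy.
- by move=> t _; rewrite derive1E; exact/derivableP/smooth_derivable.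
- by apply: continuous_subspaceT; exact: smooth_continuous.
by rewrite in_itv /= => /andP[? ?] E; exists c.
Qed.

(** By continuity of the derivatives, near a zero r' keeps its sign with |r'| >= |r'(a)| / 2 while
    s' is arbitrarily small; the mean value theorem turns this into increments. *)
Lemma finite_linear_like_submersion_tame r s : finite_linear_like_submersion r s ->
  tame r s (fun a => Num.sg ((r^`())%classic a)).
Proof.
move=> [sr ss sub fZ]; split=> //; try exact: smooth_continuous.
move=> a sa; have [s'a r'a] := submersion_zero sr ss sub sa.
set D := (r^`())%classic a in r'a *.
have Ds : 0 < D \/ D < 0 by apply/orP; rewrite -neq_lt eq_sym.
split; first by case: Ds => Ds; [left; rewrite gtr0_sg|right; rewrite ltr0_sg].
move=> e e0.
have D0 : 0 < `|D| by rewrite normr_gt0.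
have D2 : 0 < `|D| / 2 by lra.
have eD : 0 < e * (`|D| / 2) by exact: mulr_gt0.
have /cvgrPdist_lt /(_ _ eD) ns := smooth_derive1_continuous ss (x := a).
have /cvgrPdist_lt /(_ _ D2) nr := smooth_derive1_continuous sr (x := a).
have NN : \forall t \near a, `|(s^`())%classic a - (s^`())%classic t| < e * (`|D| / 2) /\
    `|D - (r^`())%classic t| < `|D| / 2 by exact: filterI ns nr.
move: NN => /nbhs_ballP [dl /= dl0 B]; exists dl => // x y ax xy ya.
have near c : x < c -> c < y -> ball a dl c.
  by move=> h1 h2; rewrite /ball /= ltr_norml; apply/andP; split; lra.
have [c [xc cy sE]] := smooth_MVT ss xy.
have [c' [xc' cy' rE]] := smooth_MVT sr xy.
have [+ _] := B c (near c xc cy); rewrite s'a sub0r normrN => hs.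
have [_ hr] := B c' (near c' xc' cy').
have hr' : `|D| / 2 <= Num.sg D * (r^`())%classic c'.
  move: hr; case: Ds => Ds.
    by rewrite gtr0_sg // mul1r (gtr0_norm Ds) ltr_norml => /andP[? ?]; lra.
  by rewrite ltr0_sg // mulN1r (ltr0_norm Ds) ltr_norml => /andP[? ?]; lra.
have xy0 : 0 < y - x by lra.
rewrite sE rE normrM (gtr0_norm xy0) !mulrA; split; last by rewrite mulr_gt0 //; lra.
apply: ler_wpM2r; first exact: ltW.
apply: le_trans (ltW hs) _; rewrite -mulrA ler_wpM2l // ltW //.
Qed.

(** These are the coefficients of p composed with the rotation by pi. *)
Lemma tame_rotate r s d : tame r s d ->
  tame (fun x => r (- x)) (fun x => - s (- x)) (fun x => - d (- x)).
Proof.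
move=> [cr cs fZ T]; split.
- by move=> x; exact: (continuous_comp (opp_continuous x) (cr _)).
- by move=> x; apply: opp_continuous_at; exact: (continuous_comp (opp_continuous x) (cs _)).
- apply: sub_finite_set (finite_image -%R fZ) => x /= /eqP; rewrite /zeros /= oppr_eq0 => /eqP sx.
  by exists (- x); rewrite ?opprK.
- move=> a /eqP; rewrite oppr_eq0 => /eqP /T [da H]; split.
    by case: da => ->; [right|left; rewrite opprK].
  move=> e /H [dl dl0 K]; exists dl => // x y h1 h2 h3.
  have [|||k1 k2] := K (- y) (- x); try lra.
  have -> : - d (- a) * (r (- y) - r (- x)) = d (- a) * (r (- x) - r (- y)) by ring.
  by have -> : - s (- y) - - s (- x) = s (- x) - s (- y) by ring.
Qed.

Lemma linear_like_rotate r s z :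
  linear_like (fun x => r (- x)) (fun x => - s (- x)) z = linear_like r s (- z).
Proof. by rewrite /linear_like /= mulrN mulNr. Qed.

Lemma winding_rotate (c : R -> R * R) w k : winding c w k -> winding (fun t => - c t) (- w) k.
Proof.
move=> [theta [ct pt wt]]; exists (fun t => theta t + pi); split.
- by move=> t; apply: cvgD; [exact: ct|exact: cvg_cst].
- move=> t /pt [q q0 ->]; exists q => //.
  by rewrite cosDpi sinDpi opprD !mulrN.
- by rewrite -wt; ring.
Qed.

Lemma o_homeo2_opp (h : R * R -> R * R) : o_homeo2 h -> o_homeo2 (fun z => - h z).
Proof.
move=> [[ch [g [cg hK gK]]] W]; split; last by move=> z rho rho0; exact: winding_rotate (W z rho rho0).
split.
  move=> z; have c : {for z, continuous h} := ch z.
  by have c' : {for z, continuous (fun w => (- (h w).1, - (h w).2) : R * R)} by cont.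
exists (fun z => g (- z)); split => z; last exact: etrans (congr1 -%R (gK (- z))) (opprK z); last first.
  exact: etrans (congr1 g (opprK (h z))) (hK z).
have c : {for z, continuous (fun w : R * R => (- w.1, - w.2) : R * R)} by cont.
exact: (continuous_comp c (cg _)).
Qed.

Lemma o_equiv_fun_rotate (f : R * R -> R) r s :
  o_equiv_fun f (linear_like (fun x => r (- x)) (fun x => - s (- x))) ->
  o_equiv_fun f (linear_like r s).
Proof.
move=> [h [l [oh ol E]]]; exists (fun z => - h z), l; split => //; first exact: o_homeo2_opp.
by rewrite E; apply/funext => z /=; rewrite linear_like_rotate.
Qed.

Lemma same_leaf_rotate r s z w :
  same_leaf (fun x => r (- x)) (fun x => - s (- x)) z w <-> same_leaf r s (- z) (- w).
Proof.
have H (f : R -> R) x y : same_strip f (- x) (- y) -> same_strip (fun x => - f (- x)) x y.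
  case=> [/oppr_inj ->|K]; first by left.
  right => t tb /eqP; rewrite oppr_eq0 => /eqP; apply: K.
  by case: tb => -[? ?]; [right|left]; split; lra.
rewrite /same_leaf !linear_like_rotate; split => -[h1 h2]; split => //; last exact: H.
have := @H (fun x => - s (- x)) (- z.1) (- w.1); rewrite !opprK => /(_ h1) /=.
case=> [->|K]; [by left|right => t tb st; apply: (K t tb)].
by rewrite !opprK.
Qed.

End SmoothTame.

(** * From foliations to the criterion *)

Section Foliations.
Context {R : realType}.
Implicit Types (r s d : R -> R) (z w : R * R) (a b x y : R).

Lemma foliationP r s d (C : set (R * R)) : tame r s d ->
  foliation (linear_like r s) C <-> exists z, C = [set w | same_leaf r s z w].
Proof.
move=> T; split => [[c [z zc ->]]|[z ->]].
  by exists z; rewrite -(connected_componentE z T) zc.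
by exists (linear_like r s z), z => //; rewrite (connected_componentE z T).
Qed.

(** The image of a leaf is a whole leaf and h is injective, so points with images on one leaf come
    from one leaf. *)
Lemma leaf_iso_of_foliation r1 s1 d1 r2 s2 d2 h g : tame r1 s1 d1 -> tame r2 s2 d2 ->
  continuous h -> continuous g -> cancel h g -> cancel g h ->
  (forall C, foliation (linear_like r1 s1) C -> foliation (linear_like r2 s2) (h @` C)) ->
  leaf_iso r1 s1 r2 s2 h g.
Proof.
move=> T1 T2 ch cg hK gK F; split => // z w.
have /F /(foliationP _ T2) [x E] : foliation (linear_like r1 s1) [set w | same_leaf r1 s1 z w].
  by apply/(foliationP _ T1); exists z.
have H v : same_leaf r1 s1 z v <-> same_leaf r2 s2 x (h v).
  have : (h @` [set w | same_leaf r1 s1 z w]) (h v) = same_leaf r2 s2 x (h v) by rewrite E.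
  move=> <-; split=> [zv|[u zu /(can_inj hK) <-] //]; by exists v.
have xz : same_leaf r2 s2 x (h z) by apply/H; exact: same_leaf_refl.
rewrite H; split => [xw|zw]; last exact: same_leaf_trans xz zw.
exact: same_leaf_trans (same_leaf_sym xz) xw.
Qed.

Lemma same_leaf_image r1 s1 d1 r2 s2 d2 h z w : tame r1 s1 d1 -> tame r2 s2 d2 ->
  continuous h ->
  (forall u, linear_like r1 s1 u = linear_like r1 s1 z ->
    linear_like r2 s2 (h u) = linear_like r2 s2 (h z)) ->
  same_leaf r1 s1 z w -> same_leaf r2 s2 (h z) (h w).
Proof.
move=> T1 T2 ch H zw.
have : [set w | same_leaf r1 s1 z w] w by [].
rewrite -(connected_componentE z T1) => -[C [Cz CL Cc] Cw].
suff : [set v | same_leaf r2 s2 (h z) v] (h w) by [].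
rewrite -(connected_componentE (h z) T2); exists (h @` C); last by exists w.
split; first by exists z.
  by move=> _ [u Cu <-]; apply: H; exact: CL.
by apply: connected_continuous_connected => //; exact: continuous_subspaceT.
Qed.

Lemma foliation_image r1 s1 d1 r2 s2 d2 h g C : tame r1 s1 d1 -> tame r2 s2 d2 ->
  leaf_iso r1 s1 r2 s2 h g ->
  foliation (linear_like r1 s1) C -> foliation (linear_like r2 s2) (h @` C).
Proof.
move=> T1 T2 [_ _ hK gK L] /(foliationP _ T1) [z ->]; apply/(foliationP _ T2); exists (h z).
apply/seteqP; split => [_ [w /L zw <-] //|w /= zw].
by exists (g w); [apply/L; rewrite gK|rewrite gK].
Qed.

Section Criterion.
Context (r1 s1 d1 r2 s2 d2 : R -> R) (h g : R * R -> R * R) (sigma : R -> R).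
Context (T1 : tame r1 s1 d1).
Local Notation p1 := (linear_like r1 s1).

(** The case where the order of the vertical lines is preserved. The last premise is the form in
    which the level m enters, through a point of its component. *)
Lemma o_equiv_fun_of_side : tame r2 s2 d2 -> leaf_iso r1 s1 r2 s2 h g ->
  (forall z rho, 0 < rho -> winding (h \o circle z rho) (h z) 1) ->
  (forall a, s1 a = 0 -> forall z, (vimage h a < (h z).1) = (a < z.1)) ->
  (exists a, s1 a = 0) ->
  (forall a, s1 a = 0 -> sigma (r1 a) = r2 (vimage h a)) ->
  (forall a b, s1 a = 0 -> s1 b = 0 -> r1 a < r1 b -> sigma (r1 a) < sigma (r1 b)) ->
  ((forall a b, s1 a = 0 -> s1 b = 0 -> r1 a = r1 b) -> forall a, s1 a = 0 ->
    exists z, [/\ p1 z <> r1 a, p1 z < r1 a -> linear_like r2 s2 (h z) < sigma (r1 a) &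
      r1 a < p1 z -> sigma (r1 a) < linear_like r2 s2 (h z)]) ->
  o_equiv_fun p1 (linear_like r2 s2).
Proof.
move=> T2 hg W side [a0 sa0] sE sI single.
have [x [sx nd]] : exists x, s1 x <> 0 /\ ~ level_decr r1 s1 r2 s2 h x.
  have [same|] := pselect (forall a b, s1 a = 0 -> s1 b = 0 -> r1 a = r1 b).
    have [z [z1 z2 z3]] := single same a0 sa0.
    have sz : s1 z.1 <> 0.
      by move=> sz; apply: z1; rewrite /linear_like sz mul0r addr0; exact: same.
    exists z.1; split => //; apply: (not_level_decr_point T1 T2 hg sa0 sz z1).
      by move=> b sb; exact: same.
    by move=> b sb; rewrite -sE // (same b a0).
  move=> /existsNP [a /existsNP [b /not_implyP [sa /not_implyP [sb rab]]]].
  exact: (not_level_decr_values T1 T2 hg sE sI sa sb rab).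
have [incr dE] := level_incr_everywhere T1 T2 hg side sx nd.
apply: level_equiv_o_equiv_fun.
apply: (@level_equiv_of_data _ r1 s1 d1 r2 s2 d2 (vimage h) sigma) => //.
- by move=> a sa; split; [exact: (vimage_zero T1 T2 hg)|exact: dE|exact: sE].
- exact: (vimage_surj T1 T2 hg).
- by move=> a b sa sb ab; rewrite /(vimage h b) side.
(* Since every zero of s2 is some [vimage h a], the point y lies in the strip of the image of (x',
   0), where [sign_image] gives the sign. *)
move=> x' y sx' sy H; pose z : R * R := (x', 0).
have k : 0 < s1 x' * s2 (h z).1.
  by apply: (sign_image T1 T2 hg side W (ex_intro _ a0 sa0) incr (z := z)).
have [_ hz0] := mul_gt0_neq0 k.
have cs2 : continuous s2 by case: T2.
have : same_strip s2 (h z).1 y.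
  right => b bb sb; have [a sa ab] := vimage_surj T1 T2 hg sb.
  have e1 : (b < (h z).1) = (b < y) by rewrite -ab side // H.
  have n1 : (h z).1 <> b by move=> E; apply: hz0; rewrite E.
  have n2 : y <> b by move=> E; apply: sy; rewrite E.
  case: bb => -[h1 h2].
    have : b < y by rewrite lt_neqAle h2 andbT eq_sym; apply/eqP.
    by rewrite -e1; lra.
  have : b < (h z).1 by rewrite lt_neqAle h2 andbT eq_sym; apply/eqP.
  by rewrite e1; lra.
move=> /(same_strip_sign cs2 hz0) => k2.
exact: mul_gt0_trans k k2.
Qed.

End Criterion.

Lemma o_equiv_fun_of_leaf_iso r1 s1 d1 r2 s2 d2 h g (sigma : R -> R) :
  tame r1 s1 d1 -> tame r2 s2 d2 -> leaf_iso r1 s1 r2 s2 h g -> o_homeo2 h ->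
  (exists a, s1 a = 0) ->
  (forall a, s1 a = 0 -> sigma (r1 a) = r2 (vimage h a)) ->
  (forall a b, s1 a = 0 -> s1 b = 0 -> r1 a < r1 b -> sigma (r1 a) < sigma (r1 b)) ->
  ((forall a b, s1 a = 0 -> s1 b = 0 -> r1 a = r1 b) -> forall a, s1 a = 0 ->
    exists z, [/\ linear_like r1 s1 z <> r1 a,
      linear_like r1 s1 z < r1 a -> linear_like r2 s2 (h z) < sigma (r1 a) &
      r1 a < linear_like r1 s1 z -> sigma (r1 a) < linear_like r2 s2 (h z)]) ->
  o_equiv_fun (linear_like r1 s1) (linear_like r2 s2).
Proof.
move=> T1 T2 hg oh Z1 sE sI single; have [side|side] := vimage_sides T1 T2 hg.
  by apply: (o_equiv_fun_of_side T1 T2 hg _ side Z1 sE sI single); case: oh.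
(* Passing to - h and to p2 composed with the rotation restores the order and leaves all levels p2
   (h z) unchanged. *)
apply: o_equiv_fun_rotate.
have oh' := o_homeo2_opp oh.
have [ch cg hK gK L] := hg.
have hg' : leaf_iso r1 s1 (fun x => r2 (- x)) (fun x => - s2 (- x))
    (fun z => - h z) (fun z => g (- z)).
  split.
  - by case: oh' => -[].
  - move=> z; have c : {for z, continuous (fun w : R * R => (- w.1, - w.2) : R * R)} by cont.
    exact: (continuous_comp c (cg _)).
  - by move=> z; exact: etrans (congr1 g (opprK (h z))) (hK z).
  - by move=> z; exact: etrans (congr1 -%R (gK (- z))) (opprK z).
  - by move=> z w; rewrite same_leaf_rotate !opprK.
have vE a : vimage (fun z => - h z) a = - vimage h a by [].
apply: (o_equiv_fun_of_side T1 (tame_rotate T2) hg' _ _ Z1 (sigma := sigma)).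
- by case: oh'.
- move=> a sa z; rewrite vE /= ltrN2.
  have V := vimageP T1 T2 hg z sa.
  rewrite !lt_neqAle ![_ <= _]leNgt side // eq_sym; congr (~~ _ && _).
  by apply/eqP/eqP => [/esym /V ->//|/esym /V ->].
- by move=> a sa; rewrite vE opprK sE.
- exact: sI.
- move=> same a sa; have [z [z1 z2 z3]] := single same a sa.
  by exists z; rewrite linear_like_rotate opprK.
Qed.

(** With no zeros the only datum is the sign of s, which the rotation by pi reverses. *)
Lemma o_equiv_fun_no_zeros r1 s1 d1 r2 s2 d2 : tame r1 s1 d1 -> tame r2 s2 d2 ->
  (forall x, s1 x <> 0) -> (forall x, s2 x <> 0) ->
  o_equiv_fun (linear_like r1 s1) (linear_like r2 s2).
Proof.
move=> T1 T2 n1 n2.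
have K (r s d r' s' d' : R -> R) : tame r s d -> tame r' s' d' -> (forall x, s x <> 0) -> (forall x, s' x <> 0) ->
    0 < s 0 * s' 0 -> o_equiv_fun (linear_like r s) (linear_like r' s').
  move=> T T' n n' pos; apply: level_equiv_o_equiv_fun.
  apply: (@level_equiv_of_data _ r s d r' s' d' id id) => //; try by move=> a /n.
    by move=> a /n'.
  have [_ cs _ _] := T; have [_ cs' _ _] := T'.
  move=> x y _ _ _; apply: (@mul_gt0_trans _ _ (s 0)).
    by apply: same_strip_sign => //; right => t _.
  apply: (mul_gt0_trans pos).
  by apply: same_strip_sign => //; right => t _.
have [p|p] := ltP 0 (s1 0 * s2 0); first exact: (K _ _ _ _ _ _ T1 T2).
apply: o_equiv_fun_rotate; apply: (K _ _ _ _ _ _ T1 (tame_rotate T2)) => //.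
  by move=> x /eqP; rewrite oppr_eq0 => /eqP; exact: n2.
rewrite oppr0 mulrN oppr_gt0 lt_neqAle p andbT mulf_neq0 //; exact/eqP.
Qed.

End Foliations.

Unset Implicit Arguments.

Theorem theorem5p2 (R : realType) (r1 s1 r2 s2 : R -> R)
    (hp1 : finite_linear_like_submersion r1 s1)
    (hp2 : finite_linear_like_submersion r2 s2) :
  let p1 := linear_like r1 s1 in
  let p2 := linear_like r2 s2 in
  let Z1 := zeros s1 in
  let Z2 := zeros s2 in
  o_equiv_fun p1 p2 <->
  (Z1 = set0 /\ Z2 = set0) \/
  (o_equiv_fol (foliation p1) (foliation p2) /\
   exists (h : R * R -> R * R) (sigma : R -> R),
     [/\ o_equiv_homeo (foliation p1) (foliation p2) h,
         incr_bij (r1 @` Z1) (r2 @` Z2) sigma,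
         (* the images of a leaf under p1, p2 are singletons, so this is an
            equality of values *)
         (forall a, Z1 a -> sigma @` (p1 @` nu a) = p2 @` (h @` nu a)) &
         ((exists c, r1 @` Z1 = [set c]) ->
          exists (m : R) (sigma' : R -> R) (xi : set (R * R)),
            [/\ ~ (r1 @` Z1) m,
                {in r1 @` Z1, sigma' =1 sigma},
                incr_bij (r1 @` Z1 `|` [set m]) (r2 @` Z2 `|` [set sigma' m])
                  sigma',
                is_component (p1 @^-1` [set m]) xi &
                [set sigma' m] = p2 @` (h @` xi)])]).
Proof.
have T1 := finite_linear_like_submersion_tame hp1.
have T2 := finite_linear_like_submersion_tame hp2.
move=> p1 p2 Z1 Z2; split.
  move=> [h [l [oh [hl ml] E]]].
  have [[ch [g [cg hK gK]]] _] := oh; have [cl [l' [cl' lK lK']]] := hl.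
  have Ez z : l (p1 z) = p2 (h z) by rewrite -[LHS]/((l \o p1) z) E.
  have hg : leaf_iso r1 s1 r2 s2 h g.
    split => // z w; split.
      apply: (same_leaf_image T1 T2 ch) => u uz.
      by rewrite -[LHS]Ez -[RHS]Ez; congr (l _); exact: uz.
    move=> /(same_leaf_image (h := g) T2 T1 cg); rewrite !hK; apply=> u uz.
    by apply: (can_inj lK); rewrite [LHS]Ez [RHS]Ez gK.
  have oF : o_equiv_homeo (foliation p1) (foliation p2) h.
    by split => // C; exact: (foliation_image T1 T2 hg).
  have lZ a : s1 a = 0 -> l (r1 a) = r2 (vimage h a).
    move=> sa; have := Ez (a, 0).
    by rewrite /p1 /p2 /linear_like /= -/(vimage h a) (vimage_zero T1 T2 hg sa) sa !mul0r !addr0.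
  have bij : incr_bij (r1 @` Z1) (r2 @` Z2) l.
    split; last by move=> x y _ _; exact: ml.
    split.
    - move=> _ [a sa <-]; exists (vimage h a); last by rewrite lZ.
      exact: (vimage_zero T1 T2 hg).
    - by move=> x y _ _; exact: (can_inj lK).
    - move=> _ [b sb <-]; have [a sa ab] := vimage_surj T1 T2 hg sb.
      by exists (r1 a); [exists a|rewrite lZ // ab].
  right; split; first by exists h.
  (* The map l serves both as sigma and as its extension. *)
  exists h, l; split => //.
    by move=> a _; rewrite image_comp E -image_comp.
  move=> [c cE].
  have [_ _ fZ _] := T1.
  (* Any x with s1 x <> 0 meets every level; the starting point 0 and the level c + 1 are
     arbitrary. *)
  have [x x0 xZ] := right_adjacent 0 fZ.
  have sx : s1 x <> 0 by move=> s0; have := xZ x s0 (ltW x0) (lexx x); lra.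
  pose m := c + 1; pose z := level_point r1 s1 x m.
  have zm : p1 z = m by exact: level_pointK.
  exists m, l, (connected_component (p1 @^-1` [set m]) z); split => //.
  - by rewrite cE /m /= => /eqP; rewrite -subr_eq0 addrC addKr oner_eq0.
  - case: bij => -[b1 b2 b3] b4; split; last by move=> u v _ _; exact: ml.
    split.
    + by move=> u [/b1 ?|->]; [left|right].
    + by move=> u v _ _; exact: (can_inj lK).
    + by move=> v [/b3 [u ru <-]|->]; [exists u => //; left|exists m => //; right].
  - by exists z.
  - apply/seteqP; split => [_ ->|_ [_ [u uz <-] <-]].
      exists (h z); last by rewrite -Ez zm.
      by exists z => //; exact: connected_component_refl.
    by have <- : p1 u = m by exact: connected_component_sub uz.
case=> [[Z10 Z20]|[_ [h [sigma [[oh F] [[sf si ss] sm] sE sg]]]]].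
  apply: (o_equiv_fun_no_zeros T1 T2) => x sx.
    by have : Z1 x by []; rewrite Z10.
  by have : Z2 x by []; rewrite Z20.
have [[ch [g [cg hK gK]]] W] := oh.
have hg := leaf_iso_of_foliation T1 T2 ch cg hK gK F.
(* The second alternative does not exclude an empty Z1; then Z2 is empty as well, its elements being
   images of zeros of s1. *)
have [[a0 sa0]|nZ] := pselect (exists a, s1 a = 0); last first.
  have n1 x : s1 x <> 0 by move=> sx; apply: nZ; exists x.
  apply: (o_equiv_fun_no_zeros T1 T2) => // x sx.
  by have [a sa _] := vimage_surj T1 T2 hg sx; exact: n1 sa.
have vE a : s1 a = 0 -> sigma (r1 a) = r2 (vimage h a).
  move=> sa; have : (sigma @` (p1 @` nu a)) (sigma (r1 a)).
    by exists (r1 a) => //; exists (a, 0) => //; rewrite /p1 /linear_like /= sa mul0r addr0.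
  rewrite sE // => -[_ [z za <-] <-].
  have := (vimageP T1 T2 hg z sa).2 za.
  by rewrite /p2 /linear_like => ->; rewrite (vimage_zero T1 T2 hg sa) mul0r addr0.
apply: (o_equiv_fun_of_leaf_iso T1 T2 hg oh (sigma := sigma)) => //.
- by exists a0.
- by move=> a b sa sb; apply: sm; rewrite inE; [exists a|exists b].
move=> same a sa.
have rE : r1 @` Z1 = [set r1 a].
  by apply/seteqP; split => [_ [b sb <-]|_ ->]; [exact: same|exists a].
have [m [sigma' [xi [Nm s's [_ s'm] [z zm xiE] xm]]]] := sg (ex_intro _ (r1 a) rE).
have zE : p2 (h z) = sigma' m.
  have : (p2 @` (h @` xi)) (p2 (h z)).
    exists (h z) => //; exists z => //; rewrite xiE; exact: connected_component_refl.
  by rewrite -xm.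
have ra : (r1 @` Z1) (r1 a) by exists a.
have s'a : sigma' (r1 a) = sigma (r1 a) by apply: s's; rewrite inE.
have i1 : r1 a \in r1 @` Z1 `|` [set m] by rewrite inE; left.
have i2 : m \in r1 @` Z1 `|` [set m] by rewrite inE; right.
have zm' : p1 z = m := zm.
exists z; rewrite -/p1 -/p2 zm' zE -s'a; split.
- by move=> E; apply: Nm; rewrite E.
- exact: s'm.
- exact: s'm.
Qed.
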